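(* Let $C\subset\mathbb{R}^d$ be a polyhedral cone, let $A$ be a conic Borel set, let $n\in\mathbb{N}$ and $k\in\{1,\dots,d\}$. Let $S_n$ be the isotropic random Schläfli cone with parameter $n$. Then $$\mathbb{E}\,\Phi_k(C\cap S_n,A)=\frac{1}{C(n,d)}\sum_{s=0}^{\min\{n,d-k\}}\binom{n}{s}\Phi_{k+s}(C,A).$$
   Context: Work in $\mathbb{R}^d$, $d\ge 2$. For a linear subspace $L$ of dimension $m$, $\gamma_L$ is the standard Gaussian measure on $L$. A set is conic if it is invariant under multiplication by every $\lambda>0$; a conic Borel set is a conic Borel subset of $\mathbb{R}^d$. A polyhedral cone is $\mathbb{R}^d$ or a finite intersection of closed halfspaces whose boundaries contain the origin; $\mathcal{F}_k(C)$ is its set of $k$-faces, $L(F)$ the linear hull of a face $F$, and $N(C,F)=\{y:\langle y,x\rangle\le0\ \forall x\in C,\ \langle y,x\rangle=0\ \forall x\in F\}$ its normal cone. Curvature measures: $\Phi_k(C,A)=\sum_{F\in\mathcal{F}_k(C)}\gamma_{L(F)}(F\cap A)\gamma_{L(F)^\perp}(N(C,F))$ (zero if there are no $k$-faces, in particular for $k>\dim C$). Linear hyperplanes $H_1,\dots,H_n$ are in general position if any $k\le d$ of them intersect in a subspace of dimension $d-k$; their Schläfli cones are the closures of the connected components of $\mathbb{R}^d\setminus\bigcup_i H_i$, and there are exactly $C(n,d):=2\sum_{r=0}^{d-1}\binom{n-1}{r}$ of them. The isotropic random Schläfli cone $S_n$ is obtained by taking $n$ independent random hyperplanes $u_1^\perp,\dots,u_n^\perp$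 with $u_i$ uniformly distributed on the unit sphere $\mathbb{S}^{d-1}$ (almost surely in general position) and choosing one of the $C(n,d)$ Schläfli cones uniformly at random. *)

(* Defs.v *)
From HB Require Import structures.
From mathcomp Require Import all_boot all_order all_algebra.
From mathcomp Require Import all_classical all_reals all_analysis.
Set Implicit Arguments. Unset Strict Implicit. Unset Printing Implicit Defensive.
Import Order.TTheory GRing.Theory Num.Theory.
Import numFieldNormedType.Exports.
Local Open Scope classical_set_scope.
Local Open Scope ring_scope.

Section Defs.
Variables (R : realType) (d : nat).
Notation vec := 'rV[R]_d.

Definition inner (u v : vec) : R := \sum_(i < d) u ord0 i * v ord0 i.
Definition enorm (u : vec) : R := Num.sqrt (inner u u).

Definition conic (A : set vec) : Prop :=
  forall (lam : R) (x : vec), 0 < lam -> A x -> A (lam *: x).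

Definition borel_set (A : set vec) : Prop :=
  smallest (sigma_algebra setT) [set U : set vec | open U] A.

Definition polyhedral_cone (C : set vec) : Prop :=
  exists (m : nat) (a : 'I_m -> vec), C = [set x | forall i, inner (a i) x <= 0].

Definition lin_hull (S : set vec) : set vec :=
  [set x | exists (m : nat) (c : 'I_m -> R) (v : 'I_m -> vec),
     (forall i, S (v i)) /\ x = \sum_(i < m) c i *: v i].

Definition orth (L : set vec) : set vec :=
  [set y | forall x, L x -> inner y x = 0].

Definition has_dim (L : set vec) (k : nat) : Prop :=
  exists v : 'I_k -> vec,
    (forall c : 'I_k -> R, \sum_(i < k) c i *: v i = 0 -> forall i, c i = 0) /\
    L = lin_hull (range v).

Definition face (C F : set vec) : Prop :=
  exists y : vec, (forall x, C x -> inner y x <= 0) /\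
    F = C `&` [set x | inner y x = 0].

Definition kfaces (C : set vec) (k : nat) : set (set vec) :=
  [set F | face C F /\ has_dim (lin_hull F) k].

Definition normal_cone (C F : set vec) : set vec :=
  [set y | (forall x, C x -> inner y x <= 0) /\ (forall x, F x -> inner y x = 0)].

Definition proj (L : set vec) (g : vec) : vec :=
  xget 0 [set p | L p /\ forall y, L y -> inner (g - p) y = 0].
End Defs.

Fixpoint gauss_iter {R : realType} (m : nat) (f : seq R -> \bar R) : \bar R :=
  match m with
  | 0 => f [::]
  | m'.+1 => (\int[normal_prob (0:R) 1]_x gauss_iter m' (fun s => f (x :: s)))%E
  end.

Definition gauss_exp {R : realType} (p q : nat) (f : 'M[R]_(p, q) -> \bar R) : \bar R :=
  gauss_iter (p * q) (fun s => f (\matrix_(i < p, j < q) nth 0 s (i * q + j))).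

(* standard Gaussian measure on a linear subspace L of R^d: law of the
   orthogonal projection onto L of a standard Gaussian vector of R^d *)
Definition gamma {R : realType} {d : nat} (L : set 'rV[R]_d) (B : set 'rV[R]_d) : \bar R :=
  @gauss_exp R 1 d (fun g => (\1_[set h | B (proj L h)] g)%:E).

Definition curv {R : realType} {d : nat} (C : set 'rV[R]_d) (k : nat) (A : set 'rV[R]_d) : \bar R :=
  (\sum_(F \in kfaces C k)
     gamma (lin_hull F) (F `&` A) * gamma (orth (lin_hull F)) (normal_cone C F))%E.

Definition general_position {R : realType} {d n : nat} (u : 'I_n -> 'rV[R]_d) : Prop :=
  forall I : {set 'I_n}, (#|I| <= d)%N ->
    has_dim [set x | forall i, i \in I -> inner (u i) x = 0] (d - #|I|).

Definition schlafli_cones {R : realType} {d n : nat} (u : 'I_n -> 'rV[R]_d) : set (set 'rV[R]_d) :=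
  let U := [set x | forall i, inner (u i) x <> 0] in
  [set D | exists x, U x /\ D = closure (connected_component U x)].

Definition C_nd (n d : nat) : nat := 2 * \sum_(r < d) 'C(n.-1, r).

(* expectation of f(S_n) for the isotropic random Schlaefli cone S_n:
   u_i = g_i / |g_i| uniform on the sphere (g_i i.i.d. standard Gaussian
   vectors), then a uniform choice among the Schlaefli cones *)
Definition schlafli_exp {R : realType} (d n : nat) (f : set 'rV[R]_d -> \bar R) : \bar R :=
  @gauss_exp R n d (fun G =>
    let u := fun i : 'I_n => (enorm (row i G))^-1 *: row i G in
    if `[< general_position u >] then
      ((((\sum_(D \in schlafli_cones u) 1)%N)%:R : R)^-1)%:E *
        (\sum_(D \in schlafli_cones u) f D)%E
    else 0)%E.

(* Main.v *)
(* For a cone [cone a] given by a list [a] of constraints, the curvature measure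
   of order [k] at [A] is the probability [Psi a k A] that the metric projection
   of a Gaussian vector on the cone lies in [A] and in the relative interior of a
   [k]-face.  A hyperplane orthogonal to [u] cuts the cone into two pieces, and
   outside a null event the projection event satisfies the valuation identity
     ev (u :: a) + ev (- u :: a) = ev a + ev (u :: - u :: a).
   For Gaussian [u] the section term has mean [Psi a k.+1 A]: the projection on a
   face of the section is analysed in the linear hull of the corresponding face
   of [cone a] and in its complement, and both contributions are isotropic, so
   that membership in a conic set has the same probability as for a Gaussian
   vector.  Hence one random hyperplane replaces [Psi a k] by
   [Psi a k + Psi a k.+1], and [n] of them give the binomial sum.  In general
   position the sign vectors without an open cell give the cone [{0}], which does
   not contribute for [k >= 1]; the others enumerate the Schlaefli cones, and
   their number is [C_nd n d] by deletion and restriction. *)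

Require Import Defs.
From HB Require Import structures.
From mathcomp Require Import all_boot all_order all_algebra.
From mathcomp Require Import all_classical all_reals all_analysis.
From mathcomp Require Import measurable_realfun.
From mathcomp Require Import ring lra zify.
Set Implicit Arguments. Unset Strict Implicit. Unset Printing Implicit Defensive.
Import Order.TTheory GRing.Theory Num.Theory.
Import numFieldNormedType.Exports.
Local Open Scope classical_set_scope.
Local Open Scope ring_scope.

(** * Gaussian measure on row vectors *)

(** The passage from curvature measures to [Psi] works because the two factors belonging to a face
    are probabilities of events about the two orthogonal components of one Gaussian vector, and
    these are independent. [Psi] accepts any list of constraints, redundant or zero ones included,
    so cutting by a hyperplane is consing [u], [- u] or both, and the induction can treat all cones
    at once. In the hull of a face the section replaces the component y of x by its residual along
    the component v of u; in the complement it replaces z by z - c w, where c depends on y and v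
    only. Given y and v, the vector z - c w is Gaussian up to scale. Isotropic laws are compared by
    averaging over a random orthogonal matrix, made by Gram-Schmidt from Gaussian vectors, in the
    place of Haar measure. Besides killing the cone {0}, k >= 1 leaves at least two dimensions in
    the hull of a (k+1)-face, so that the residual of y along v is almost surely nonzero.
    Measurability is needed for functions of lists of vectors; hence projections and polarity are
    described by finitely many tests on sublists. *)

Definition mx_measure_display : measure_display. Proof. exact. Qed.

Section matrix_measurable.
Variables (R : realType) (m n : nat).

(** Generators of the product sigma-algebra, for which matrix-valued maps are measurable as soon as
    their entries are. [measurable_borel] brings the Borel sets of the statement into it. *)
Definition coord_sets : set (set 'M[R]_(m, n)) :=
  [set X | exists i j (B : set R), measurable B /\ X = [set M : 'M[R]_(m, n) | B (M i j)]].

Let mx_set0 : <<s coord_sets >> set0. Proof. exact: sigma_algebra0. Qed.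
Let mx_setC A : <<s coord_sets >> A -> <<s coord_sets >> (~` A).
Proof. exact: sigma_algebraC. Qed.
Let mx_bigcup (F : (set 'M[R]_(m, n))^nat) :
  (forall i, <<s coord_sets >> (F i)) -> <<s coord_sets >> (\bigcup_i F i).
Proof. exact: sigma_algebra_bigcup. Qed.

HB.instance Definition _ := @isMeasurable.Build mx_measure_display
  'M[R]_(m, n) <<s coord_sets >> mx_set0 mx_setC mx_bigcup.

Lemma measurable_entry i j : measurable_fun setT (fun M : 'M[R]_(m, n) => M i j).
Proof.
move=> _ B mB; rewrite setTI; apply: sub_sigma_algebra.
by exists i, j, B.
Qed.

Lemma measurable_mxP dT (T : measurableType dT) (f : T -> 'M[R]_(m, n)) :
  measurable_fun setT f <-> forall i j, measurable_fun setT (fun t => f t i j).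
Proof.
split=> [mf i j|mf].
  exact: (measurableT_comp (measurable_entry i j) mf).
apply: (measurability coord_sets) => //.
move=> _ [_ [i [j [B [mB ->]]]] <-].
exact: (mf i j).
Qed.

End matrix_measurable.

Section gauss.
Variable R : realType.
Notation N01 := (normal_prob (0 : R) 1).

Definition consrv n (p : measurableTypeR R * 'rV[R]_n) : 'rV[R]_(1 + n) := row_mx p.1%:M p.2.

Lemma measurable_consrv n : measurable_fun setT (@consrv n).
Proof.
apply/measurable_mxP => i j.
case: (split_ordP j) => k ->.
  rewrite (_ : (fun t => _) = fst); first exact: measurable_fst.
  by apply/funext => t; rewrite row_mxEl mxE (ord1 i) (ord1 k) eqxx mulr1n.
rewrite (_ : (fun t => _) = (fun v : 'rV[R]_n => v i k) \o snd).
  by apply: measurableT_comp => //; exact: measurable_entry.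
by apply/funext => t; rewrite row_mxEr.
Qed.
HB.instance Definition _ n := isMeasurableFun.Build _ _ _ _ _ (@measurable_consrv n).

(** Prepending one normal coordinate mirrors the recursion of [gauss_iter], so that the iterated
    integrals of the statement become integrals against a measure, to which Tonelli's theorem
    applies. *)
Fixpoint gm (n : nat) : probability 'rV[R]_n R :=
  match n with
  | 0 => [the probability _ _ of \d_(0 : 'rV[R]_0)]
  | n'.+1 => [the probability _ _ of distribution
      [the probability _ _ of (N01 \x gm n')%E] [the {mfun _ >-> _} of @consrv n']]
  end.
End gauss.
Arguments gm : simpl never.

Lemma gauss_iter_cat (R : realType) m n (f : seq R -> \bar R) :
  gauss_iter (m + n) f = gauss_iter m (fun s => gauss_iter n (fun t => f (s ++ t))).
Proof.
elim: m f => [|m IH] f //=.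
by apply: eq_integral => x _; rewrite IH.
Qed.

Lemma eq_gauss_iter (R : realType) m (f g : seq R -> \bar R) :
  (forall s, size s = m -> f s = g s) -> gauss_iter m f = gauss_iter m g.
Proof.
elim: m f g => [|m IH] f g fg /=; first exact: fg.
by apply: eq_integral => x _; apply: IH => s sm; apply: fg; rewrite /= sm.
Qed.

Section gauss_integral.
Variable R : realType.
Notation N01 := (normal_prob (0 : R) 1).
Notation RR := (measurableTypeR R).

Lemma integral_gmS n (f : 'rV[R]_n.+1 -> \bar R) :
  measurable_fun setT f -> (forall x, 0 <= f x)%E ->
  (\int[gm R n.+1]_x f x = \int[N01]_x \int[gm R n]_v f (consrv (x, v)))%E.
Proof.
move=> mf f0.
have mc := @measurable_consrv R n.
transitivity (\int[(N01 \x gm R n)%E]_p f (consrv p))%E.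
  by rewrite [LHS](ge0_integral_pushforward mc)// preimage_setT.
rewrite (fubini_tonelli1 (m1 := N01) (m2 := gm R n))//.
exact: (measurableT_comp mf mc).
Qed.

Lemma gauss_iterE n (f : 'rV[R]_n -> \bar R) :
  measurable_fun setT f -> (forall x, 0 <= f x)%E ->
  gauss_iter n (fun s => f (\row_j s`_j)) = (\int[gm R n]_x f x)%E.
Proof.
elim: n f => [|n IH] f mf f0.
  rewrite /= integral_dirac// diracT mul1e; congr f.
  by apply/rowP => -[].
rewrite integral_gmS//=; apply: eq_integral => x _.
rewrite -IH//; last first.
  apply: (measurableT_comp mf).
  apply: (@measurableT_comp _ _ _ _ _ _ (@consrv R n) _ (fun v => (x, v))).
    exact: measurable_consrv.
  exact: pair1_measurable.
apply: eq_gauss_iter => s _; congr f; apply/rowP => j.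
by rewrite !mxE; case: (split_ordP (j : 'I_(1 + n))) => k jk;
  have /= := congr1 val jk; rewrite !mxE => -> //; rewrite ?(ord1 k)// eqxx mulr1n.
Qed.

Lemma measurable_row_mx dT (T : measurableType dT) m n
    (f : T -> 'rV[R]_m) (g : T -> 'rV[R]_n) :
  measurable_fun setT f -> measurable_fun setT g ->
  measurable_fun setT (fun t => row_mx (f t) (g t)).
Proof.
move=> /measurable_mxP mf /measurable_mxP mg; apply/measurable_mxP => i j.
case: (split_ordP j) => k ->.
  rewrite (_ : (fun t => _) = (fun t => f t i k)); first exact: mf.
  by apply/funext => t; rewrite row_mxEl.
rewrite (_ : (fun t => _) = (fun t => g t i k)); first exact: mg.
by apply/funext => t; rewrite row_mxEr.
Qed.

Lemma integral_gm_cat m n (f : 'rV[R]_(m + n) -> \bar R) :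
  measurable_fun setT f -> (forall x, 0 <= f x)%E ->
  (\int[gm R (m + n)]_x f x = \int[gm R m]_x \int[gm R n]_y f (row_mx x y))%E.
Proof.
move=> mf f0; rewrite -gauss_iterE// gauss_iter_cat.
have mf2 : measurable_fun setT (fun p : 'rV[R]_m * 'rV[R]_n => f (row_mx p.1 p.2)).
  by apply: (measurableT_comp mf); exact: measurable_row_mx.
rewrite -(@gauss_iterE m (fun x => \int[gm R n]_y f (row_mx x y))%E); first last.
- by move=> x; apply: integral_ge0 => y _.
- exact: (measurable_fun_fubini_tonelli_F (m2 := gm R n) _ mf2).
apply: eq_gauss_iter => s sm.
rewrite -gauss_iterE//; last first.
  apply: (measurableT_comp mf); apply: measurable_row_mx => //.
apply: eq_gauss_iter => t tn; congr f; apply/rowP => j; rewrite [LHS]mxE nth_cat sm.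
case: (split_ordP j) => k ->.
  by rewrite row_mxEl [RHS]mxE.
by rewrite [RHS]row_mxEr [RHS]mxE /= addKn.
Qed.

(** The Radon-Nikodym derivative of the normal law and [normal_pdf] have the same integral over
    every measurable set, hence agree almost everywhere. *)
Lemma integral_normal01 (f : RR -> \bar R) :
  measurable_fun setT f -> (forall x, 0 <= f x)%E ->
  (\int[N01]_x f x = \int[lebesgue_measure]_x (f x * (normal_pdf 0 1 x)%:E))%E.
Proof.
move=> mf f0.
have dom := normal_prob_dominates (0 : R) 1.
rewrite -(Radon_Nikodym_SigmaFinite.change_of_variables dom)//.
have intRN := Radon_Nikodym_SigmaFinite.f_integrable dom.
have mpdf : measurable_fun [set: RR] (fun x => (normal_pdf 0 1 x)%:E : \bar R).
  by apply/measurable_EFinP; exact: measurable_normal_pdf.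
apply: ae_eq_integral => //.
- by apply: emeasurable_funM => //; exact: measurable_int intRN.
- exact: emeasurable_funM.
apply: ae_eqe_mul2l; apply: integral_ae_eq => // E _ mE.
by rewrite -Radon_Nikodym_SigmaFinite.f_integral.
Qed.

(** Uniqueness of Lebesgue measure: the pushforward under the affine map, rescaled by [|a|], gives
    half-open intervals their length. For negative [a] the preimage is closed on the other side,
    which does not change its length. *)
Lemma lebesgue_measure_affine (a b : R) : a != 0 -> forall A : set RR,
  measurable A ->
  (lebesgue_measure [set x : RR | A (a * x + b)%R] = `|a|^-1%:E * lebesgue_measure A)%E.
Proof.
move=> a0 A mA.
have mphi : measurable_fun [set: RR] (fun x : RR => (a * x + b)%R : RR).
  by apply: measurable_funD => //; exact: measurable_funM.
pose mu := [the {measure set RR -> \bar R} of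
  mscale (NngNum (normr_ge0 a))
    (measure_function_pushforward__canonical__measure_function_Measure
       lebesgue_measure mphi)].
have muE (X : set RR) : mu X = (`|a|%:E * lebesgue_measure [set x : RR | X (a * x + b)%R])%E by [].
rewrite [in RHS](@lebesgue_measure_unique _ mu)// ?muE ?muleA -?EFinM ?mulVf ?mul1e// ?normr_eq0//.
move=> _ [[u v] /= uv <-]; rewrite muE lebesgue_measure_itv /= lte_fin.
have [a_gt0|a_lt0|] := ltgtP 0 a; last by move=> a00; rewrite -a00 eqxx in a0.
- rewrite (_ : [set x | _] = `](u - b) / a, (v - b) / a]%classic); last first.
    apply/seteqP; split=> x /=; rewrite !in_itv/= ltr_pdivrMr// ler_pdivlMr//;
    by rewrite ltrBlDr lerBrDr mulrC.
  rewrite lebesgue_measure_itv /= lte_fin ltr_pM2r ?invr_gt0// ltrD2r gtr0_norm//.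
  case: ifP => _; last by rewrite mule0.
  by rewrite -!EFinD -EFinM; congr EFin; field.
- rewrite (_ : [set x | _] = `[(v - b) / a, (u - b) / a[%classic); last first.
    apply/seteqP; split=> x /=; rewrite !in_itv/= ltr_ndivlMr// ler_ndivrMr//;
    by rewrite ltrBlDr lerBrDr andbC (mulrC x).
  rewrite lebesgue_measure_itv /= lte_fin ltr_nM2r ?invr_lt0// ltrD2r ltr0_norm//.
  case: ifP => _; last by rewrite mule0.
  by rewrite -!EFinD -EFinM; congr EFin; field.
Qed.

Lemma integral_lebesgue_affine (a b : R) (f : RR -> \bar R) : a != 0 ->
  measurable_fun setT f -> (forall x, 0 <= f x)%E ->
  (\int[lebesgue_measure]_x f (a * x + b)%R = `|a|^-1%:E * \int[lebesgue_measure]_x f x)%E.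
Proof.
move=> a0 mf f0.
have mphi : measurable_fun [set: RR] (fun x : RR => (a * x + b)%R : RR).
  by apply: measurable_funD => //; exact: measurable_funM.
have na : 0 <= `|a|^-1 by [].
transitivity (\int[pushforward lebesgue_measure (fun x : RR => (a * x + b)%R : RR)]_x f x)%E.
  by rewrite (ge0_integral_pushforward mphi)// preimage_setT.
rewrite -(ge0_integral_mscale lebesgue_measure measurableT (NngNum na))//.
apply: eq_measure_integral => A mA _.
by rewrite [LHS](lebesgue_measure_affine b a0).
Qed.

Lemma normal_pdf01_prod (x y x' y' : R) : x ^+ 2 + y ^+ 2 = x' ^+ 2 + y' ^+ 2 ->
  normal_pdf 0 1 x * normal_pdf 0 1 y = normal_pdf 0 1 x' * normal_pdf 0 1 y'.
Proof.
move=> h; rewrite !normal_pdfE ?oner_eq0// /normal_fun.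
rewrite mulrACA [RHS]mulrACA -!expRD; congr (_ * expR _).
by rewrite !subr0 -!mulrDl -!opprD h.
Qed.

End gauss_integral.

(** * Orthogonal invariance *)

Section rotation.
Variable R : realType.
Notation N01 := (normal_prob (0 : R) 1).
Notation RR := (measurableTypeR R).

Lemma integral_normal01_sign (s : R) (f : RR -> \bar R) : s ^+ 2 = 1 ->
  measurable_fun setT f -> (forall x, 0 <= f x)%E ->
  (\int[N01]_x f (s * x)%R = \int[N01]_x f x)%E.
Proof.
move=> s1 mf f0.
have s0 : s != 0 by apply: contra_eq_neq s1 => ->; rewrite expr0n /= eq_sym oner_eq0.
have ns : `|s| = 1.
  by apply/eqP; rewrite -(@eqrXn2 _ 2)// expr1n real_normK ?num_real// s1.
have mpdf : measurable_fun [set: RR] (fun x => (normal_pdf 0 1 x)%:E : \bar R).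
  by apply/measurable_EFinP; exact: measurable_normal_pdf.
have ms : measurable_fun [set: RR] (fun x : RR => s * x : RR) by exact: measurable_funM.
rewrite !integral_normal01//; last exact: (measurableT_comp mf ms).
pose h (x : RR) := (f x * (normal_pdf 0 1 x)%:E)%E.
transitivity (\int[lebesgue_measure]_x h (s * x + 0)%R)%E.
  apply: eq_integral => x _; rewrite /h addr0; congr (_ * _%:E)%E.
  by rewrite !normal_pdfE ?oner_eq0// /normal_fun !subr0 exprMn s1 mul1r.
rewrite integral_lebesgue_affine//; first by rewrite ns invr1 mul1e.
- exact: emeasurable_funM.
- by move=> x; rewrite mule_ge0// lee_fin normal_pdf_ge0.
Qed.

Lemma integral2_normal01 (f : RR * RR -> \bar R) :
  measurable_fun setT f -> (forall x, 0 <= f x)%E ->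
  (\int[N01]_x \int[N01]_y f (x, y) =
   \int[lebesgue_measure]_x \int[lebesgue_measure]_y
     (f (x, y) * (normal_pdf 0 1 x * normal_pdf 0 1 y)%:E))%E.
Proof.
move=> mf f0.
have mpdf : measurable_fun [set: RR] (fun x => (normal_pdf 0 1 x)%:E : \bar R).
  by apply/measurable_EFinP; exact: measurable_normal_pdf.
rewrite integral_normal01//; first last.
- by move=> x; apply: integral_ge0.
- exact: (measurable_fun_fubini_tonelli_F (m2 := N01) f).
apply: eq_integral => x _.
have mfx : measurable_fun setT (fun y => f (x, y)).
  by apply: (measurableT_comp mf); exact: pair1_measurable.
rewrite integral_normal01// -ge0_integralZr//.
- by apply: eq_integral => y _; rewrite -muleA -EFinM [(_ y * _)%R]mulrC.
- exact: emeasurable_funM.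
- by move=> y _; rewrite mule_ge0// lee_fin normal_pdf_ge0.
- by rewrite lee_fin normal_pdf_ge0.
Qed.

(** The joint density depends on [x ^+ 2 + y ^+ 2] only, so it is Lebesgue measure that has to be
    rotated. For [c != 0] the rotation is composed of two affine substitutions in one variable,
    whose Jacobians [|c|] and [|c|^-1] cancel; for [c = 0] it is an exchange of the variables and a
    change of sign. *)
Lemma integral2_normal01_rot (c s : R) (f : RR * RR -> \bar R) :
  c ^+ 2 + s ^+ 2 = 1 ->
  measurable_fun setT f -> (forall x, 0 <= f x)%E ->
  (\int[N01]_x \int[N01]_y f ((c * x - s * y)%R, (s * x + c * y)%R) =
   \int[N01]_x \int[N01]_y f (x, y))%E.
Proof.
move=> cs mf f0.
have mlin (a b : R) : measurable_fun [set: RR * RR] (fun p => a * p.1 + b * p.2 : RR).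
  by apply: measurable_funD; apply: measurable_funM.
have mrot : measurable_fun [set: RR * RR]
    (fun p => ((c * p.1 - s * p.2 : RR)%R, (s * p.1 + c * p.2 : RR)%R)).
  apply/measurable_fun_pair => //.
  by under eq_fun do rewrite -mulNr; exact: mlin.
have mfr := measurableT_comp mf mrot.
have [c0|c0] := eqVneq c 0.
  have s1 : s ^+ 2 = 1 by rewrite -cs c0 expr0n add0r.
  have s1' : (- s) ^+ 2 = 1 by rewrite sqrrN.
  have fub := fubini_tonelli (m1 := N01) (m2 := N01)
    (fun p => f ((c * p.1 - s * p.2)%R, (s * p.1 + c * p.2)%R)) mfr (fun p => f0 _).
  apply: (eq_trans fub) => {fub} /=.
  transitivity (\int[N01]_y \int[N01]_x f ((- s * y)%R, x))%E.
    apply: eq_integral => y _.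
    rewrite -(@integral_normal01_sign s (fun x => f ((- s * y)%R, x)))//.
      by apply: eq_integral => x _; rewrite c0 !mul0r sub0r addr0 mulNr.
    by apply: (measurableT_comp mf); exact: pair1_measurable.
  rewrite (@integral_normal01_sign (- s) (fun y => \int[N01]_x f (y, x))%E)//.
    exact: (measurable_fun_fubini_tonelli_F (m2 := N01) f).
  by move=> x; apply: integral_ge0.
rewrite [RHS]integral2_normal01// (integral2_normal01 mfr (fun p => f0 _)) /=.
pose h p := (f p * (normal_pdf 0 1 p.1 * normal_pdf 0 1 p.2)%:E)%E.
have h0 p : (0 <= h p)%E by rewrite mule_ge0// lee_fin mulr_ge0// normal_pdf_ge0.
have mh : measurable_fun setT h.
  apply: emeasurable_funM => //; apply/measurable_EFinP.
  by apply: measurable_funM; apply: (measurableT_comp (measurable_normal_pdf _ _)).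
transitivity (\int[lebesgue_measure]_x \int[lebesgue_measure]_y
    h ((c * x - s * y)%R, (s * x + c * y)%R))%E.
  apply: eq_integral => x _; apply: eq_integral => y _; rewrite /h /=.
  congr (_ * _%:E)%E; apply: normal_pdf01_prod.
  transitivity ((c ^+ 2 + s ^+ 2) * (x ^+ 2 + y ^+ 2)); first by rewrite cs mul1r.
  by ring.
have fub := fubini_tonelli (m1 := lebesgue_measure) (m2 := lebesgue_measure)
  (fun p : RR * RR => h ((c * p.1 - s * p.2)%R, (s * p.1 + c * p.2)%R))
  (measurableT_comp mh mrot) (fun p => h0 _).
apply: (eq_trans fub) => {fub} /=.
(* With x' = c x - s y one has s x + c y = (s / c) x' + y / c, so the integrand is [g] at x' and
   y. *)
pose g (p : RR * RR) := h (p.1, (s / c * p.1 + c^-1 * p.2)%R).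
have mg : measurable_fun setT g.
  by apply: (measurableT_comp mh); apply/measurable_fun_pair => //; exact: mlin.
transitivity (\int[lebesgue_measure]_y (`|c|^-1%:E * \int[lebesgue_measure]_x g (x, y)))%E.
  apply: eq_integral => y _.
  have mgy : measurable_fun setT (fun x => g (x, y)).
    by apply: (measurableT_comp mg); exact: pair2_measurable.
  apply: (eq_trans _ (@integral_lebesgue_affine _ c (- (s * y)) _ c0 mgy (fun x => h0 _))).
  apply: eq_integral => x _; rewrite /g /=; congr (h (_, _)).
  transitivity (s * x + c^-1 * ((c ^+ 2 + s ^+ 2) * y - s ^+ 2 * y)).
    by field.
  by rewrite cs; field.
have c_ge0 : (0 <= `|c|^-1%:E)%E by rewrite lee_fin.
rewrite (ge0_integralZl _ measurableT
  (measurable_fun_fubini_tonelli_G (m1 := lebesgue_measure) g mg (fun p => h0 _)))//; last first.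
  by move=> y _; apply: integral_ge0 => x _; exact: h0.
have fub := fubini_tonelli (m1 := lebesgue_measure) (m2 := lebesgue_measure) g mg (fun p => h0 _).
apply: (eq_trans (congr1 (fun z => `|c|^-1%:E * z)%E (esym fub))) => {fub}.
rewrite -(ge0_integralZl _ measurableT
  (measurable_fun_fubini_tonelli_F (m2 := lebesgue_measure) g mg (fun p => h0 _)))//; last first.
  by move=> y _; apply: integral_ge0 => x _; exact: h0.
apply: eq_integral => x _.
transitivity (`|c|^-1%:E * (`|c^-1|^-1%:E * \int[lebesgue_measure]_y h (x, y)))%E.
  congr (_ * _)%E.
  have mhx : measurable_fun setT (fun y => h (x, y)).
    by apply: (measurableT_comp mh); exact: pair1_measurable.
  have c0' : c^-1 != 0 by rewrite invr_eq0.
  apply: (eq_trans _ (@integral_lebesgue_affine _ _ (s / c * x) _ c0' mhx (fun y => h0 _))).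
  by apply: eq_integral => y _; rewrite /g /= addrC.
by rewrite muleA -EFinM normfV invrK mulVf ?mul1e// normr_eq0.
Qed.

End rotation.

Section measurable_vectors.
Variables (R : realType) (dT : measure_display) (T : measurableType dT).

Lemma measurable_mulmx_cst m n p (f : T -> 'M[R]_(m, n)) (Q : 'M[R]_(n, p)) :
  measurable_fun setT f -> measurable_fun setT (fun t => f t *m Q).
Proof.
move=> /measurable_mxP mf; apply/measurable_mxP => i j.
under eq_fun do rewrite mxE.
by apply: measurable_sum => k; apply: measurable_funM.
Qed.

Lemma measurable_inner d (f g : T -> 'rV[R]_d) :
  measurable_fun setT f -> measurable_fun setT g ->
  measurable_fun setT (fun t => inner (f t) (g t)).
Proof.
move=> /measurable_mxP mf /measurable_mxP mg.
by apply: measurable_sum => k; apply: measurable_funM.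
Qed.

Lemma measurable_scalemx d (f : T -> R) (g : T -> 'rV[R]_d) :
  measurable_fun setT f -> measurable_fun setT g ->
  measurable_fun setT (fun t => f t *: g t).
Proof.
move=> mf /measurable_mxP mg; apply/measurable_mxP => i j.
by under eq_fun do rewrite mxE; exact: measurable_funM.
Qed.

Lemma measurable_addmx d (f g : T -> 'rV[R]_d) :
  measurable_fun setT f -> measurable_fun setT g ->
  measurable_fun setT (fun t => f t + g t).
Proof.
move=> /measurable_mxP mf /measurable_mxP mg; apply/measurable_mxP => i j.
by under eq_fun do rewrite mxE; exact: measurable_funD.
Qed.

Lemma measurable_oppmx d (g : T -> 'rV[R]_d) :
  measurable_fun setT g -> measurable_fun setT (fun t => - g t).
Proof.
move=> /measurable_mxP mg; apply/measurable_mxP => i j.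
by under eq_fun do rewrite mxE; exact: measurableT_comp.
Qed.

End measurable_vectors.

Section orthogonal_invariance.
Variable R : realType.
Notation N01 := (normal_prob (0 : R) 1).
Notation RR := (measurableTypeR R).

Definition gm_invariant n (Q : 'M[R]_n) := forall f : 'rV[R]_n -> \bar R,
  measurable_fun setT f -> (forall x, 0 <= f x)%E ->
  (\int[gm R n]_x f (x *m Q) = \int[gm R n]_x f x)%E.

Lemma measurable_mulmxr n (Q : 'M[R]_n) :
  measurable_fun setT (fun x : 'rV[R]_n => x *m Q).
Proof. exact: measurable_mulmx_cst. Qed.

Lemma gm_invariantM n (P Q : 'M[R]_n) :
  gm_invariant P -> gm_invariant Q -> gm_invariant (P *m Q).
Proof.
move=> iP iQ f mf f0.
apply: (eq_trans _ (iQ f mf f0)).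
apply: (eq_trans _ (iP _ (measurableT_comp mf (@measurable_mulmxr n Q)) (fun=> f0 _))).
by apply: eq_integral => x _ /=; rewrite mulmxA.
Qed.

Lemma gm_invariant_tr n (Q : 'M[R]_n) : Q *m Q^T = 1%:M ->
  gm_invariant Q -> gm_invariant Q^T.
Proof.
move=> QQ iQ f mf f0.
apply: (eq_trans (esym (iQ _ (measurableT_comp mf (@measurable_mulmxr n Q^T)) (fun=> f0 _)))).
by apply: eq_integral => x _ /=; rewrite -mulmxA QQ mulmx1.
Qed.

Lemma gm_invariant_block n (r : R) (Q : 'M[R]_n) : r ^+ 2 = 1 ->
  gm_invariant Q -> @gm_invariant (1 + n) (block_mx r%:M 0 0 Q).
Proof.
move=> r1 iQ f mf f0.
have mfm : measurable_fun setT (fun x => f (x *m block_mx r%:M 0 0 Q)).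
  by apply: (measurableT_comp mf); exact: measurable_mulmxr.
have mfc : measurable_fun setT (fun p : RR * 'rV[R]_n => f (consrv p)).
  by apply: (measurableT_comp mf); exact: measurable_consrv.
apply: (eq_trans (integral_gmS mfm (fun=> f0 _))).
apply: (eq_trans _ (esym (integral_gmS mf f0))).
have mF := measurable_fun_fubini_tonelli_F (m2 := gm R n) _ mfc (fun=> f0 _).
have F0 x : (0 <= \int[gm R n]_v f (consrv (x, v)))%E by apply: integral_ge0.
apply: (eq_trans _ (integral_normal01_sign r1 mF F0)).
apply: eq_integral => x _.
have mfx : measurable_fun setT (fun v => f (consrv (r * x, v))).
  by apply: (measurableT_comp mfc); exact: pair1_measurable.
apply: (eq_trans _ (iQ _ mfx (fun=> f0 _))).
apply: eq_integral => v _; congr f.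
rewrite /consrv mul_row_block !mulmx0 addr0 add0r /= -scalar_mxM mulrC//.
Qed.

Definition rot2_mx n (c s : R) : 'M[R]_(1 + (1 + n)) :=
  block_mx c%:M (row_mx s%:M 0) (col_mx (- s)%:M 0) (block_mx c%:M 0 0 1%:M).

Lemma row_rot2_mx n (c s a b : R) (v : 'rV[R]_n) :
  row_mx a%:M (row_mx b%:M v) *m rot2_mx n c s =
  row_mx (c * a - s * b)%:M (row_mx (s * a + c * b)%:M v).
Proof.
rewrite /rot2_mx mul_row_block mul_row_col mul_row_block mul_mx_row.
rewrite !mulmx0 !addr0 add0r mulmx1 add_row_mx add0r -!scalar_mxM -!raddfD /=.
by rewrite mulrN (mulrC c) (mulrC s) (mulrC s) (mulrC c).
Qed.

Lemma rot2_mxK n (c s : R) : c ^+ 2 + s ^+ 2 = 1 ->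
  rot2_mx n c s *m (rot2_mx n c s)^T = 1%:M.
Proof.
move=> cs.
have -> : (rot2_mx n c s)^T = rot2_mx n c (- s).
  rewrite /rot2_mx tr_block_mx tr_row_mx tr_col_mx tr_block_mx.
  by rewrite !tr_scalar_mx !trmx0 opprK.
apply/row_matrixP => i; rewrite row1 rowE mulmxA.
set x : 'rV[R]_(1 + (1 + n)) := delta_mx 0 i.
rewrite -[x]hsubmxK -[rsubmx x]hsubmxK [lsubmx x]mx11_scalar [lsubmx (rsubmx x)]mx11_scalar.
rewrite !row_rot2_mx; congr (row_mx _%:M (row_mx _%:M _)).
  by transitivity ((c ^+ 2 + s ^+ 2) * lsubmx x 0 0); [ring|rewrite cs mul1r].
by transitivity ((c ^+ 2 + s ^+ 2) * lsubmx (rsubmx x) 0 0); [ring|rewrite cs mul1r].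
Qed.

Lemma gm_invariant_rot2 n (c s : R) : c ^+ 2 + s ^+ 2 = 1 ->
  gm_invariant (rot2_mx n c s).
Proof.
move=> cs f mf f0.
have mfm : measurable_fun setT (fun x => f (x *m rot2_mx n c s)).
  by apply: (measurableT_comp mf); exact: measurable_mulmxr.
pose k (p : RR * RR * 'rV[R]_n) := consrv (p.1.1, consrv (p.1.2, p.2)).
have mk : measurable_fun setT k.
  apply: (measurableT_comp (@measurable_consrv R (1 + n))).
  apply/measurable_fun_pair; first exact: measurableT_comp.
  apply: (measurableT_comp (@measurable_consrv R n)).
  by apply/measurable_fun_pair => //; exact: measurableT_comp.
have E (h : 'rV[R]_(1 + (1 + n)) -> \bar R) : measurable_fun setT h -> (forall x, 0 <= h x)%E ->
  (\int[gm R (1 + (1 + n))]_x h x =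
   \int[N01]_a \int[N01]_b \int[gm R n]_v h (k ((a, b), v)))%E.
  move=> mh h0; rewrite (integral_gmS mh)//; apply: eq_integral => a _.
  rewrite integral_gmS//; apply: (measurableT_comp mh).
  apply: (measurableT_comp (@measurable_consrv R (1 + n))).
  exact: pair1_measurable.
pose F (p : RR * RR) := (\int[gm R n]_v f (k (p, v)))%E.
have mF : measurable_fun setT F.
  apply: (measurable_fun_fubini_tonelli_F (m2 := gm R n) (fun q => f (k q))) => //.
  exact: (measurableT_comp mf mk).
have F0 p : (0 <= F p)%E by apply: integral_ge0.
apply: (eq_trans (E _ mfm (fun=> f0 _))); apply: (eq_trans _ (esym (E _ mf f0))).
apply: (eq_trans _ (integral2_normal01_rot cs mF F0)).
apply: eq_integral => a _; apply: eq_integral => b _; apply: eq_integral => v _.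
by rewrite /k /consrv /= row_rot2_mx.
Qed.

(** Givens rotations: the tail is turned onto its first axis by induction, and one rotation of the
    first two coordinates then absorbs it into the first entry. *)
Lemma gm_invariant_transitive n (x : 'rV[R]_(1 + n)) : exists G : 'M[R]_(1 + n),
  [/\ G *m G^T = 1%:M, gm_invariant G & exists r : R, x *m G = row_mx r%:M 0].
Proof.
elim: n x => [|n IH] x.
  exists 1%:M; split.
  - by rewrite trmx1 mulmx1.
  - by move=> f mf f0; apply: eq_integral => y _; rewrite mulmx1.
  - exists (lsubmx x 0 0); rewrite mulmx1 -mx11_scalar -[LHS]hsubmxK.
    by congr (row_mx _ _); rewrite thinmx0.
have [G [GG iG [r xG]]] := IH (rsubmx x).
pose a := lsubmx x ord0 ord0.
pose rho := Num.sqrt (a ^+ 2 + r ^+ 2).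
have rhoE : rho ^+ 2 = a ^+ 2 + r ^+ 2 by rewrite sqr_sqrtr// addr_ge0// sqr_ge0.
have [c [s [cs sa]]] : exists c s : R, c ^+ 2 + s ^+ 2 = 1 /\ s * a + c * r = 0.
  have [rho0|rho0] := eqVneq rho 0.
    exists 1, 0; rewrite expr1n expr0n addr0 mul0r mul1r add0r; split=> //.
    move: rhoE; rewrite rho0 expr0n => /esym/eqP.
    by rewrite paddr_eq0 ?sqr_ge0// !sqrf_eq0 => /andP[_ /eqP].
  exists (a / rho), (- r / rho); split; last by field.
  by rewrite !exprMn sqrrN -mulrDl -rhoE exprVn mulfV// sqrf_eq0.
have b1 : block_mx 1%:M 0 0 G *m (block_mx 1%:M 0 0 G)^T = 1%:M :> 'M[R]_(1 + (1 + n)).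
  rewrite tr_block_mx !trmx0 trmx1 mulmx_block !(mulmx0, mul0mx, addr0, add0r) mulmx1 GG.
  by rewrite -scalar_mx_block.
exists (block_mx 1%:M 0 0 G *m rot2_mx n c s); split.
- by rewrite trmx_mul mulmxA -(mulmxA _ _ (rot2_mx _ _ _)^T) rot2_mxK// mulmx1.
- by apply: gm_invariantM (gm_invariant_rot2 cs); apply: gm_invariant_block; rewrite ?expr1n.
- exists (c * a - s * r); rewrite mulmxA.
  rewrite -[x]hsubmxK mul_row_block !(mulmx0, addr0, add0r) mulmx1 xG.
  rewrite (_ : lsubmx x = a%:M); last by rewrite [LHS]mx11_scalar.
  by rewrite row_rot2_mx sa raddf0 row_mx0.
Qed.

(** Once the first row of [Q] is turned onto the first axis, orthogonality makes the product block
    diagonal, with a sign in the corner and a smaller orthogonal block to which induction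
    applies. *)
Lemma gm_orthogonal n (Q : 'M[R]_n) : Q *m Q^T = 1%:M -> gm_invariant Q.
Proof.
elim: n Q => [|n IH] Q QQ.
  by move=> f mf f0; apply: eq_integral => x _; rewrite !thinmx0.
have [G [GG iG [r xG]]] := gm_invariant_transitive (row ord0 Q : 'rV_(1 + n)).
pose P : 'M[R]_(1 + n) := Q *m G.
have PP : P *m P^T = 1%:M by rewrite trmx_mul mulmxA -(mulmxA Q) GG mulmx1.
have Prow : usubmx P = row_mx r%:M 0.
  rewrite -xG -row_mul -/P; move: P {PP} => M; apply/rowP => j.
  by rewrite !mxE; congr (M _ _); exact: val_inj.
have iP : gm_invariant P.
  have Pl : P = block_mx r%:M 0 (dlsubmx P) (drsubmx P).
    rewrite -[LHS]vsubmxK Prow -[dsubmx P]hsubmxK /block_mx; congr (col_mx _ (row_mx _ _));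
    by rewrite /dlsubmx /drsubmx.
  move: PP; rewrite Pl tr_block_mx trmx0 tr_scalar_mx mulmx_block.
  rewrite !(mulmx0, mul0mx, addr0, add0r) -scalar_mxM scalar_mx_block.
  move=> /eq_block_mx[/(congr1 (fun M : 'M[R]_1 => M 0 0))].
  rewrite !mxE /= !mulr1n -expr2 => r1 rc _ dr.
  have r0 : r != 0 by apply: contra_eq_neq r1 => ->; rewrite expr0n /= eq_sym oner_eq0.
  have dl0 : dlsubmx P = 0.
    move: rc; rewrite mul_scalar_mx => /eqP; rewrite scaler_eq0 (negbTE r0) /= => /eqP.
    by move=> /(congr1 trmx); rewrite trmxK trmx0.
  rewrite dl0; apply: gm_invariant_block => //; apply: IH.
  by move: dr; rewrite dl0 mul0mx add0r.
rewrite -[Q]mulmx1 -GG mulmxA; apply: gm_invariantM => //.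
exact: gm_invariant_tr.
Qed.

End orthogonal_invariance.

(** * Orthogonal projections and rank *)

Section inner_product.
Variables (R : realType) (d : nat).
Notation vec := 'rV[R]_d.
Implicit Types (u v w x y z p : vec) (s t a : seq vec).

Lemma innerE u v : inner u v = (u *m v^T) 0 0.
Proof. by rewrite mxE; apply: eq_bigr => i _; rewrite mxE. Qed.

Lemma innerC u v : inner u v = inner v u.
Proof. by apply: eq_bigr => i _; rewrite mulrC. Qed.

Lemma innerDl u v w : inner (u + v) w = inner u w + inner v w.
Proof. by rewrite !innerE mulmxDl mxE. Qed.

Lemma innerDr u v w : inner w (u + v) = inner w u + inner w v.
Proof. by rewrite innerC innerDl !(innerC w). Qed.

Lemma innerZl c u v : inner (c *: u) v = c * inner u v.
Proof. by rewrite !innerE -scalemxAl mxE. Qed.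

Lemma innerZr c u v : inner v (c *: u) = c * inner v u.
Proof. by rewrite innerC innerZl innerC. Qed.

Lemma innerNl u v : inner (- u) v = - inner u v.
Proof. by rewrite -scaleN1r innerZl mulN1r. Qed.

Lemma innerNr u v : inner v (- u) = - inner v u.
Proof. by rewrite innerC innerNl innerC. Qed.

Lemma inner0l v : inner 0 v = 0.
Proof. by rewrite -(scale0r v) innerZl mul0r. Qed.

Lemma inner0r v : inner v 0 = 0.
Proof. by rewrite innerC inner0l. Qed.

Lemma innerBl u v w : inner (u - v) w = inner u w - inner v w.
Proof. by rewrite innerDl innerNl. Qed.

Lemma innerBr u v w : inner w (u - v) = inner w u - inner w v.
Proof. by rewrite innerDr innerNr. Qed.

Lemma inner_ge0 u : 0 <= inner u u.
Proof. by apply: sumr_ge0 => i _; rewrite -expr2 sqr_ge0. Qed.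

Lemma inner_eq0 u : (inner u u == 0) = (u == 0).
Proof.
apply/idP/eqP => [|->]; last by rewrite inner0l.
rewrite psumr_eq0 => [/allP /= u0|i _]; last by rewrite -expr2 sqr_ge0.
apply/rowP => i; rewrite mxE; apply/eqP.
by have := u0 i (mem_index_enum _); rewrite mulf_eq0 orbb.
Qed.

Lemma inner_gt0 u : (0 < inner u u) = (u != 0).
Proof. by rewrite lt_def inner_eq0 inner_ge0 andbT. Qed.

Lemma inner_sumr v n (c : 'I_n -> R) (f : 'I_n -> vec) :
  inner v (\sum_i c i *: f i) = \sum_i c i * inner v (f i).
Proof.
by elim/big_rec2: _ => [|i x y _ <-]; rewrite ?inner0r// innerDr innerZr.
Qed.

Definition perp s x := all (fun v => inner v x == 0) s.

Lemma perpP s x : reflect (forall v, v \in s -> inner v x = 0) (perp s x).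
Proof. by apply: (iffP allP) => h v vs; apply/eqP/h. Qed.

Lemma perpZ s c x : perp s x -> perp s (c *: x).
Proof. by move=> /perpP h; apply/perpP => v /h vx; rewrite innerZr vx mulr0. Qed.

Lemma perpD s x y : perp s x -> perp s y -> perp s (x + y).
Proof. by move=> /perpP hx /perpP hy; apply/perpP => v vs; rewrite innerDr hx// hy// addr0. Qed.

Lemma perpN s x : perp s x -> perp s (- x).
Proof. by rewrite -scaleN1r; exact: perpZ. Qed.

Lemma perpB s x y : perp s x -> perp s y -> perp s (x - y).
Proof. by move=> hx hy; exact: perpD hx (perpN hy). Qed.

(* Orthogonal projection onto the orthogonal complement of the list, by
   Gram-Schmidt without normalisation; a vector depending on the previous ones
   gives [y = 0] and [inner x y / inner y y = 0], hence is skipped. *)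
Fixpoint pr s x : vec :=
  if s is w :: s' then
    let y := pr s' w in pr s' x - (inner x y / inner y y) *: y
  else x.

Lemma pr_spec s x :
  perp s (pr s x) /\ (forall z, perp s z -> inner (x - pr s x) z = 0).
Proof.
elim: s x => [|w s IH] x /=; first by split=> // z _; rewrite subrr inner0l.
have [yp yr] := IH w; have [xp xr] := IH x.
set y := pr s w in yp yr *; set x' := pr s x in xp xr *.
have wx : inner w x' = inner x y.
  have /eqP := yr _ xp; rewrite innerBl subr_eq0 => /eqP ->.
  by have /eqP := xr _ yp; rewrite innerBl subr_eq0 => /eqP ->; rewrite innerC.
have wy : inner w y = inner y y by have /eqP := yr _ yp; rewrite innerBl subr_eq0 => /eqP.
split.
  apply/andP; split.
    rewrite innerBr innerZr wy wx; have [->|y0] := eqVneq y 0.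
      by rewrite !inner0r !mul0r subrr.
    by rewrite divfK ?inner_eq0// subrr.
  by apply: perpB => //; exact: perpZ.
move=> z /andP[/eqP wz zp]; rewrite opprB addrCA innerDl xr// addr0.
rewrite innerZl; have /eqP := yr z zp; rewrite innerBl wz sub0r oppr_eq0 => /eqP ->.
by rewrite mulr0.
Qed.

Lemma pr_perp s x : perp s (pr s x). Proof. by case: (pr_spec s x). Qed.

Lemma pr_res s x z : perp s z -> inner (x - pr s x) z = 0.
Proof. by case: (pr_spec s x) => _; exact. Qed.

Lemma pr_unique s x p : perp s p ->
  (forall z, perp s z -> inner (x - p) z = 0) -> p = pr s x.
Proof.
move=> ps pr0; apply/eqP; rewrite -subr_eq0 -inner_eq0; apply/eqP.
have pp : perp s (p - pr s x) by apply: perpB => //; exact: pr_perp.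
rewrite {1}(_ : p - pr s x = (x - pr s x) - (x - p)); last first.
  by rewrite opprB [RHS]addrC subrKA.
by rewrite innerBl pr0// pr_res// subrr.
Qed.

Lemma pr_id s x : perp s x -> pr s x = x.
Proof. by move=> sx; apply/esym/pr_unique => // z _; rewrite subrr inner0l. Qed.

Lemma prD s x y : pr s (x + y) = pr s x + pr s y.
Proof.
apply/esym/pr_unique => [|z zs]; first exact: perpD (pr_perp _ _) (pr_perp _ _).
by rewrite opprD addrACA innerDl !pr_res// addr0.
Qed.

Lemma prZ s c x : pr s (c *: x) = c *: pr s x.
Proof.
apply/esym/pr_unique => [|z zs]; first exact: perpZ (pr_perp _ _).
by rewrite -scalerBr innerZl pr_res// mulr0.
Qed.

Lemma prN s x : pr s (- x) = - pr s x.
Proof. by rewrite -scaleN1r prZ scaleN1r. Qed.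

Lemma prB s x y : pr s (x - y) = pr s x - pr s y.
Proof. by rewrite prD prN. Qed.

Lemma inner_pr s x z : perp s z -> inner (pr s x) z = inner x z.
Proof. by move=> zs; apply/esym/eqP; rewrite -subr_eq0 -innerBl pr_res. Qed.

Lemma pr_mem s v : v \in s -> pr s v = 0.
Proof.
move=> vs; apply/eqP; rewrite -inner_eq0 inner_pr ?pr_perp//.
by apply/eqP; have /perpP := pr_perp s v; exact.
Qed.

Lemma eq_pr s t : perp s =1 perp t -> pr s =1 pr t.
Proof.
move=> st x; apply: pr_unique; first by rewrite -st pr_perp.
by move=> z; rewrite -st; exact: pr_res.
Qed.

(** Dimension of the span: a vector counts when its residual against the rest of the list is
    nonzero. *)
Fixpoint rk s : nat := if s is w :: s' then (pr s' w != 0) + rk s' else 0.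

Lemma rk_frame s t r (E : 'M[R]_(r, d)) : r = rk s ->
  (forall x, pr s x = x - x *m E^T *m E) -> E *m E^T = 1%:M ->
  exists r0 (E0 : 'M[R]_(r0, d)), [/\ (r0 + r)%N = rk (t ++ s),
    E0 *m E0^T = 1%:M, E0 *m E^T = 0 &
    forall x, pr (t ++ s) x = x - x *m E0^T *m E0 - x *m E^T *m E].
Proof.
move=> rs prs EE; elim: t => [|w t [r0 [E0 [r0E E0E0 E0E prE]]]].
  exists 0, 0; split => //; first by rewrite !flatmx0.
  by rewrite mul0mx. 
  by move=> x; rewrite mulmx0 subr0.
rewrite /= ; set y := pr (t ++ s) w.
have [y0|y0] := eqVneq y 0.
  exists r0, E0; split=> //.
  by move=> x; rewrite y0 scaler0 subr0.
have yE : y *m E^T = 0.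
  rewrite /y prE !mulmxBl -!mulmxA EE E0E mulmx1 !mulmx0 subr0 subrr//.
have EE0 : E *m E0^T = 0 by rewrite -[LHS]trmxK trmx_mul trmxK E0E trmx0.
have yE0 : y *m E0^T = 0.
  by rewrite /y prE !mulmxBl -!mulmxA E0E0 EE0 mulmx1 !mulmx0 subr0 subrr.
pose c := Num.sqrt (inner y y).
have c2 : c ^+ 2 = inner y y by rewrite sqr_sqrtr// inner_ge0.
have c0 : c != 0 by rewrite -sqrf_eq0 c2 inner_eq0.
exists (1 + r0)%N, (col_mx (c^-1 *: y) E0); split.
- by rewrite -addnA r0E.
- have B12 : (c^-1 *: y) *m E0^T = 0 by rewrite -scalemxAl yE0 scaler0.
  have B21 : E0 *m (c^-1 *: y)^T = 0 by rewrite -[LHS]trmxK trmx_mul trmxK B12 trmx0.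
  have B11 : (c^-1 *: y) *m (c^-1 *: y)^T = 1%:M.
    rewrite [LHS]mx11_scalar -innerE innerZl innerZr -c2; congr _%:M.
    by field.
  by rewrite tr_col_mx mul_col_row E0E0 B11 B12 B21 -scalar_mx_block.
- by rewrite mul_col_mx -scalemxAl yE scaler0 E0E col_mx0.
- move=> x; rewrite tr_col_mx mul_mx_row mul_row_col prE.
  rewrite [x *m (_ *: _)^T]mx11_scalar -innerE innerZr mul_scalar_mx scalerA.
  rewrite (_ : c^-1 * _ * _ = inner x y / inner y y); last by rewrite -c2; field.
  by rewrite opprD -!addrA; congr (x + _); rewrite [RHS]addrC -addrA.
Qed.

(** The rows of [E] are an orthonormal basis of the span of [s], those of [E0] one of its orthogonal
    complement, obtained by running Gram-Schmidt on the standard basis after [s]. *)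
Lemma orthonormal_frame s : exists l r (E0 : 'M[R]_(l, d)) (E : 'M[R]_(r, d)),
  [/\ r = rk s, (l + r)%N = d, col_mx E0 E *m (col_mx E0 E)^T = 1%:M,
     (forall x, pr s x = x *m E0^T *m E0) &
     forall x, x = x *m E0^T *m E0 + x *m E^T *m E].
Proof.
have [r [E [rE EE _ prE]]] := @rk_frame [::] s 0 0 erefl
   (fun x => esym (etrans (congr1 (fun z => x - z) (mulmx0 _ _)) (subr0 x)))
   (etrans (flatmx0 _) (esym (flatmx0 _))).
rewrite addn0 cats0 in rE; rewrite cats0 in prE.
have {}prE x : pr s x = x - x *m E^T *m E by rewrite prE mulmx0 subr0.
pose t := [seq delta_mx 0 i : vec | i <- enum 'I_d].
have [l [E0 [lE E0E0 E0E prtE]]] := rk_frame t rE prE EE.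
have t0 x : x - x *m E0^T *m E0 - x *m E^T *m E = 0.
  rewrite -prtE; apply/rowP => i; rewrite mxE.
  have /perpP/(_ (delta_mx 0 i)) := pr_perp (t ++ s) x.
  rewrite mem_cat map_f ?mem_enum// => /(_ isT) <-.
  rewrite /inner (bigD1 i)//= big1 => [|j ji]; first by rewrite mxE !eqxx mul1r addr0.
  by rewrite mxE (negbTE ji) andbF mul0r.
have xE x : x = x *m E0^T *m E0 + x *m E^T *m E.
  by apply/eqP; rewrite -subr_eq0 opprD addrA t0.
have QQ : col_mx E0 E *m (col_mx E0 E)^T = 1%:M.
  rewrite tr_col_mx mul_col_row E0E0 EE E0E -[E *m _]trmxK trmx_mul trmxK E0E trmx0.
  by rewrite -scalar_mx_block.
exists l, r, E0, E; split=> //.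
(* Counting by ranks: the transpose of the stacked frame is its inverse on either side. *)
- apply/eqP; rewrite eqn_leq; apply/andP; split.
    have := mxrankM_maxl (col_mx E0 E) (col_mx E0 E)^T.
    by rewrite QQ mxrank1 => /leq_trans; apply; exact: rank_leq_col.
  have Q1 : (col_mx E0 E)^T *m col_mx E0 E = 1%:M.
    apply/row_matrixP => i; rewrite [RHS]rowE mulmx1 rowE mulmxA tr_col_mx.
    by rewrite mul_mx_row mul_row_col -xE.
  have := mxrankM_maxr (col_mx E0 E)^T (col_mx E0 E).
  by rewrite Q1 mxrank1 => /leq_trans; apply; exact: rank_leq_row.
- by move=> x; rewrite prE {1}[x]xE addrK.
Qed.

Lemma rk_le s : (rk s <= d)%N.
Proof.
have [l [r [E0 [E [<- lr _ _ _]]]]] := orthonormal_frame s.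
by apply: (leq_trans (leq_addl l r)); rewrite lr.
Qed.

Lemma perp_lt s : (rk s < d)%N -> exists2 z, z != 0 & perp s z.
Proof.
have [l [r [E0 [E [<- lr QQ prE _]]]]] := orthonormal_frame s => rd.
have l0 : (0 < l)%N by rewrite -(ltn_add2r r) lr.
move: QQ; rewrite tr_col_mx mul_col_row scalar_mx_block => /eq_block_mx[E00 _ _ _].
pose z := row (Ordinal l0) E0; exists z.
  rewrite -inner_eq0 (_ : inner z z = 1) ?oner_eq0//.
  transitivity ((1%:M : 'M[R]_l) (Ordinal l0) (Ordinal l0)); last by rewrite mxE eqxx.
  by rewrite -E00 mxE; apply: eq_bigr => i _; rewrite !mxE.
have -> : z = pr s z by rewrite prE /z rowE -!mulmxA (mulmxA E0) E00 mul1mx.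
exact: pr_perp.
Qed.

Lemma perp_full s x : rk s = d -> perp s x -> x = 0.
Proof.
have [l [r [E0 [E [<- + QQ prE _]]]]] := orthonormal_frame s => lr rd.
move=> sx; rewrite -(pr_id sx) prE.
have l0 : l = 0%N by apply/eqP; rewrite -(eqn_add2r r) lr rd add0n.
by subst l; rewrite [x *m _]thinmx0 mul0mx.
Qed.

End inner_product.

(** * Indicators of propositions and measurability of events *)

Section indicator.
Variable R : realType.

Definition ind (P : Prop) : \bar R := (`[< P >]%:R)%:E.

Lemma ind_ge0 P : (0 <= ind P)%E. Proof. by rewrite lee_fin. Qed.

Lemma ind_le1 P : (ind P <= 1)%E. Proof. by rewrite lee_fin lern1 leq_b1. Qed.

Lemma ind_true (P : Prop) : P -> ind P = 1%E. Proof. by move=> /asboolT; rewrite /ind => ->. Qed.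

Lemma ind_false (P : Prop) : ~ P -> ind P = 0%E. Proof. by move=> /asboolF; rewrite /ind => ->. Qed.

Lemma ind_iff (P Q : Prop) : (P <-> Q) -> ind P = ind Q.
Proof. by move=> /propext ->. Qed.

Lemma ind_and (P Q : Prop) : ind (P /\ Q) = (ind P * ind Q)%E.
Proof. by rewrite /ind asbool_and -EFinM -natrM mulnb. Qed.

Lemma ind_le (P Q : Prop) : (P -> Q) -> (ind P <= ind Q)%E.
Proof.
move=> PQ; have [p|/ind_false ->] := pselect P; last exact: ind_ge0.
by rewrite !ind_true//; exact: PQ.
Qed.

Lemma ind_not (P : Prop) : (ind P + ind (~ P) = 1)%E.
Proof.
have [p|p] := pselect P; first by rewrite ind_true// ind_false ?adde0//; exact.
by rewrite ind_false// ind_true ?add0e.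
Qed.

Lemma indE (T : Type) (A : set T) (x : T) : ((\1_A x : R)%:E = ind (A x))%E.
Proof. by rewrite /ind indicE; congr (_%:R%:E); apply/idP/asboolP; rewrite inE. Qed.

Variables (dT : measure_display) (T : measurableType dT).

Lemma measurable_ind (P : T -> Prop) : measurable [set t | P t] ->
  measurable_fun setT (fun t => ind (P t)).
Proof.
move=> mP; rewrite (_ : (fun t => _) = EFin \o \1_[set t | P t]).
  by apply/measurable_EFinP; exact: measurable_indic.
by apply/funext => t; rewrite -indE.
Qed.

Lemma integral_ind (mu : {measure set T -> \bar R}) (P : T -> Prop) :
  measurable [set t | P t] -> (\int[mu]_t ind (P t) = mu [set t | P t])%E.
Proof.
move=> mP; rewrite -[in RHS](setIT [set t | P t]) -integral_indic//.
Qed.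

Lemma mset_and (P Q : T -> Prop) : measurable [set t | P t] ->
  measurable [set t | Q t] -> measurable [set t | P t /\ Q t].
Proof. exact: measurableI. Qed.

Lemma mset_not (P : T -> Prop) : measurable [set t | P t] ->
  measurable [set t | ~ P t].
Proof. exact: measurableC. Qed.

Lemma mset_imply (P Q : T -> Prop) : measurable [set t | P t] ->
  measurable [set t | Q t] -> measurable [set t | P t -> Q t].
Proof.
move=> mP mQ; rewrite (_ : [set t | _] = ~` [set t | P t] `|` [set t | Q t]).
  by apply: measurableU => //; exact: measurableC.
apply/seteqP; split=> t /=; last by move=> [np p|q _ //]; case: (np p).
by move=> PQ; have [p|p] := pselect (P t); [right; exact: PQ|left].
Qed.

Lemma mset_exists (I : finType) (P : I -> T -> Prop) :
  (forall i, measurable [set t | P i t]) -> measurable [set t | exists i, P i t].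
Proof.
move=> mP; rewrite (_ : [set t | _] = \bigcup_(i in [set: I]) [set t | P i t]).
  by apply: fin_bigcup_measurable.
by apply/seteqP; split=> [t [i Pi]|t [i _ Pi]]; exists i.
Qed.

Lemma mset_forall (I : finType) (P : I -> T -> Prop) :
  (forall i, measurable [set t | P i t]) -> measurable [set t | forall i, P i t].
Proof.
move=> mP; rewrite (_ : [set t | _] = \bigcap_(i in [set: I]) [set t | P i t]).
  by apply: fin_bigcap_measurable.
by apply/seteqP; split=> [t Pi i _|t Pi i]; apply: Pi.
Qed.

Lemma mset_bool (b : T -> bool) : measurable_fun setT b -> measurable [set t | b t].
Proof. by move=> mb; rewrite -[X in measurable X]setTI; exact: (mb measurableT [set true]). Qed.

Lemma mset_le (f g : T -> R) : measurable_fun setT f -> measurable_fun setT g ->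
  measurable [set t | f t <= g t].
Proof. by move=> mf mg; apply: mset_bool; exact: measurable_fun_ler. Qed.

Lemma mset_eq (f g : T -> R) : measurable_fun setT f -> measurable_fun setT g ->
  measurable [set t | f t = g t].
Proof.
move=> mf mg; rewrite (_ : [set t | _] = [set t | f t == g t]).
  by apply: mset_bool; exact: measurable_fun_eqr.
by apply/seteqP; split=> t /eqP.
Qed.

End indicator.
Arguments measurable_ind R {dT T P}.

Section gauss_frame.
Variable R : realType.

(** Turning the Gaussian vector into the frame preserves its law, and its coordinates along [E0] and
    along [E] are then independent Gaussian vectors. *)
Lemma integral_gm_frame d l r (E0 : 'M[R]_(l, d)) (E : 'M[R]_(r, d))
    (f : 'rV[R]_d -> \bar R) :
  (l + r)%N = d -> col_mx E0 E *m (col_mx E0 E)^T = 1%:M ->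
  measurable_fun setT f -> (forall x, 0 <= f x)%E ->
  (\int[gm R d]_x f x = \int[gm R l]_y \int[gm R r]_z f (y *m E0 + z *m E)%R)%E.
Proof.
move=> lr; subst d => QQ mf f0.
rewrite -(gm_orthogonal QQ mf f0).
have mfQ : measurable_fun setT (fun x => f (x *m col_mx E0 E)).
  by apply: (measurableT_comp mf); exact: measurable_mulmx_cst.
apply: (eq_trans (integral_gm_cat mfQ (fun=> f0 _))).
by apply: eq_integral => y _; apply: eq_integral => z _; rewrite mul_row_col.
Qed.

(** In a frame adapted to [z] the event says that one normal coordinate vanishes, and the normal law
    is dominated by Lebesgue measure. *)
Lemma gm_hyperplane0 d (z : 'rV[R]_d) : z != 0 ->
  gm R d [set x | inner z x = 0] = 0%E.
Proof.
move=> z0.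
have mH : measurable [set x : 'rV[R]_d | inner z x = 0].
  by apply: mset_eq => //; exact: measurable_inner.
have [l [r [E0 [E [rE lr QQ prE xE]]]]] := orthonormal_frame [:: z].
have {}rE : r = 1%N by rewrite rE /= z0.
subst r.
have zE : z *m E^T != 0.
  apply: contra_neq z0 => zE; rewrite [z]xE zE mul0mx addr0 -prE pr_mem//.
  by rewrite mem_head.
rewrite -(integral_ind _ mH) (integral_gm_frame lr QQ); last 2 first.
- exact: measurable_ind.
- by move=> x; exact: ind_ge0.
have m0 : measurable [set t : 'rV[R]_1 | t ord0 ord0 = 0].
  by apply: mset_eq => //; exact: measurable_entry.
have g10 : (\int[gm R 1]_t ind R (t ord0 ord0 = 0%R) = 0)%E.
  have mi := measurable_ind R m0.
  rewrite (integral_gmS mi); last by move=> x; exact: ind_ge0.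
  transitivity (\int[normal_prob (0 : R) 1]_x ind R ([set 0%R : R] x))%E.
    apply: eq_integral => x _; rewrite integral_dirac// ?diracT ?mul1e; last first.
      by apply: (measurableT_comp mi); exact: (measurableT_comp (@measurable_consrv R 0)).
    apply: ind_iff; rewrite /consrv mxE; case: splitP => // j _.
    by rewrite [j]ord1 mxE mulr1n.

  have /null_content_dominatesP dom := normal_prob_dominates (0 : R) 1.
  have m1 : measurable [set t : measurableTypeR R | [set 0%R : R] t] by exact: measurable_set1.
  apply: (eq_trans (integral_ind _ m1)).
  by apply: (dom _ m1); exact: lebesgue_measure_set1.
rewrite -[RHS](integral0 (gm R l) setT); apply: eq_integral => y _.
rewrite -[RHS]g10; apply: eq_integral => t _; apply: ind_iff.
have -> : inner z (y *m E0 + t *m E) = t ord0 ord0 * (z *m E^T) ord0 ord0.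
  rewrite innerDr.
  have -> : inner z (y *m E0) = 0.
    move: QQ; rewrite tr_col_mx mul_col_row scalar_mx_block => /eq_block_mx[E00 _ _ _].
    have := pr_perp [:: z] (y *m E0).
    by rewrite prE -!mulmxA (mulmxA E0) E00 mul1mx /= andbT => /eqP.
  by rewrite add0r innerE trmx_mul mulmxA mxE big_ord1 mulrC [t^T _ _]mxE.
split=> [/eqP|->]; last by rewrite mul0r.
rewrite mulf_eq0 => /orP[/eqP //|/eqP zE0]; case/eqP: zE.
by rewrite [LHS]mx11_scalar zE0 raddf0.
Qed.

End gauss_frame.

(** * Lists of independent Gaussian vectors *)

Section iterated.
Variables (R : realType) (d : nat).
Notation vec := 'rV[R]_d.

(** Expectation over [n] independent Gaussian vectors, the head being the outermost variable. Lists
    rather than matrices fit the recursions of [pr], [rk] and [cell_sum]. *)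
Fixpoint IT n (f : seq vec -> \bar R) : \bar R :=
  if n is n'.+1 then (\int[gm R d]_u IT n' (fun s => f (u :: s)))%E else f [::].

Fixpoint all_meas dT (T : measurableType dT) (g : seq (T -> vec)) : Prop :=
  if g is h :: g' then measurable_fun setT h /\ all_meas g' else True.

(* [t |-> G t [h_1 t; ...; h_n t]] is measurable for all measurable [h_i],
   also after reindexing [t]: joint measurability without a measurable
   structure on lists. *)
Definition jmeas dT (T : measurableType dT) (G : T -> seq vec -> \bar R) : Prop :=
  forall dS (S : measurableType dS) (phi : S -> T) (g : seq (S -> vec)),
    measurable_fun setT phi -> all_meas g ->
    measurable_fun setT (fun s => G (phi s) [seq h s | h <- g]).

Lemma all_meas_comp dT (T : measurableType dT) dS (S : measurableType dS)
  (phi : S -> T) (g : seq (T -> vec)) : measurable_fun setT phi ->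
  all_meas g -> all_meas [seq h \o phi | h <- g].
Proof.
move=> mphi; elim: g => //= h g IH [mh /IH mg]; split=> //.
exact: measurableT_comp.
Qed.

Lemma all_meas_mask dT (T : measurableType dT) m (g : seq (T -> vec)) :
  all_meas g -> all_meas (mask m g).
Proof. by elim: g m => [|h g IH] [|[] m] //= [mh mg]; [split=> //|]; exact: IH. Qed.

Lemma all_meas_cst dT (T : measurableType dT) (s : seq vec) :
  all_meas [seq (fun _ : T => v) | v <- s].
Proof. by elim: s => //= v s IH; split. Qed.

Lemma map_cst (T : Type) (t : T) (s : seq vec) :
  [seq h t | h <- [seq (fun _ : T => v) | v <- s]] = s.
Proof. by rewrite -map_comp map_id. Qed.

Lemma eq_IT n f g : (forall s, size s = n -> f s = g s) -> IT n f = IT n g.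
Proof.
elim: n f g => [|n IH] f g fg /=; first exact: fg.
by apply: eq_integral => u _; apply: IH => s sn; apply: fg; rewrite /= sn.
Qed.

Lemma IT_ge0 n f : (forall s, 0 <= f s)%E -> (0 <= IT n f)%E.
Proof. by elim: n f => [|n IH] f f0 //=; apply: integral_ge0 => u _; exact: IH. Qed.

Lemma jmeas_cons dT (T : measurableType dT) (G : T -> seq vec -> \bar R) :
  jmeas G -> jmeas (fun p : T * vec => fun s => G p.1 (p.2 :: s)).
Proof.
move=> jG dS S phi g mphi mg.
apply: (jG _ _ (fst \o phi) ((snd \o phi) :: g)); first exact: measurableT_comp.
by split=> //; exact: measurableT_comp.
Qed.

Lemma jmeas_fix dT (T : measurableType dT) (G : T -> seq vec -> \bar R) (u : T) :
  jmeas G -> jmeas (fun _ : unit => G u).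
Proof. by move=> jG dS S phi g mphi mg; exact: (jG _ _ (fun=> u)). Qed.

Lemma jmeas_fixcons dT (T : measurableType dT) (G : T -> seq vec -> \bar R) (u : vec) :
  jmeas G -> jmeas (fun t s => G t (u :: s)).
Proof.
move=> jG dS S phi g mphi mg; by apply: (jG _ _ phi ((fun=> u) :: g)).
Qed.

Lemma measurable_IT dT (T : measurableType dT) n (G : T -> seq vec -> \bar R) :
  jmeas G -> (forall t s, 0 <= G t s)%E ->
  measurable_fun setT (fun t => IT n (G t)).
Proof.
elim: n dT T G => [|n IH] dT T G jG G0 /=.
  exact: (jG _ _ id [::]).
have := IH _ _ _ (jmeas_cons jG) (fun p s => G0 p.1 (p.2 :: s)).
move=> /(measurable_fun_fubini_tonelli_F (m2 := gm R d)); apply => p.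
exact: IT_ge0.
Qed.

Lemma measurable_IT_cons n (f : seq vec -> \bar R) :
  jmeas (fun _ : unit => f) -> (forall s, 0 <= f s)%E ->
  measurable_fun setT (fun u => IT n (fun s => f (u :: s))).
Proof.
move=> jf f0; apply: (measurable_IT n (G := fun u s => f (u :: s))) => //.
move=> dS S phi g mphi mg; by apply: (jf _ _ (fun=> tt) (phi :: g)).
Qed.

Lemma jmeas_cons1 (f : seq vec -> \bar R) u :
  jmeas (fun _ : unit => f) -> jmeas (fun _ : unit => fun s => f (u :: s)).
Proof. exact: jmeas_fixcons. Qed.

Lemma IT_swap dT (T : measurableType dT) (mu : {sigma_finite_measure set T -> \bar R})
    n (G : T -> seq vec -> \bar R) :
  jmeas G -> (forall t s, 0 <= G t s)%E ->
  (\int[mu]_t IT n (G t) = IT n (fun s => \int[mu]_t G t s))%E.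
Proof.
elim: n G => [|n IH] G jG G0 //=.
have mG := measurable_IT n (jmeas_cons jG) (fun p s => G0 p.1 (p.2 :: s)).
have E := fubini_tonelli (m1 := mu) (m2 := gm R d) _ mG
  (fun p => IT_ge0 n (fun s => G0 p.1 (p.2 :: s))).
apply: (eq_trans E) => {E}; apply: eq_integral => u _.
by apply: (IH (fun t s => G t (u :: s))) => //; exact: jmeas_fixcons.
Qed.

Lemma ITZl n (c : \bar R) (f : seq vec -> \bar R) :
  jmeas (fun _ : unit => f) -> (forall s, 0 <= f s)%E -> (0 <= c)%E ->
  IT n (fun s => c * f s)%E = (c * IT n f)%E.
Proof.
elim: n f => [|n IH] f jf f0 c0 //=.
rewrite -ge0_integralZl//; last 2 first.
- exact: measurable_IT_cons.
- by move=> u _; exact: IT_ge0.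
by apply: eq_integral => u _; apply: IH => //; exact: jmeas_cons1.
Qed.

Lemma ITD n (f g : seq vec -> \bar R) :
  jmeas (fun _ : unit => f) -> (forall s, 0 <= f s)%E ->
  jmeas (fun _ : unit => g) -> (forall s, 0 <= g s)%E ->
  IT n (fun s => f s + g s)%E = (IT n f + IT n g)%E.
Proof.
elim: n f g => [|n IH] f g jf f0 jg g0 //=.
rewrite -ge0_integralD//; first last.
- exact: measurable_IT_cons.
- by move=> u _; exact: IT_ge0.
- exact: measurable_IT_cons.
- by move=> u _; exact: IT_ge0.
by apply: eq_integral => u _; apply: IH => //; exact: jmeas_cons1.
Qed.

Lemma IT_le n (f g : seq vec -> \bar R) :
  jmeas (fun _ : unit => f) -> (forall s, 0 <= f s)%E ->
  jmeas (fun _ : unit => g) -> (forall s, f s <= g s)%E ->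
  (IT n f <= IT n g)%E.
Proof.
elim: n f g => [|n IH] f g jf f0 jg fg //=.
have g0 s : (0 <= g s)%E by apply: le_trans (fg s).
apply: ge0_le_integral => //.
- by move=> u _; exact: IT_ge0.
- exact: measurable_IT_cons.
- exact: measurable_IT_cons.
by move=> u _; apply: IH => //; exact: jmeas_cons1.
Qed.

Lemma IT_orthogonal n (Q : 'M[R]_d) (f : seq vec -> \bar R) : Q *m Q^T = 1%:M ->
  jmeas (fun _ : unit => f) -> (forall s, 0 <= f s)%E ->
  IT n (fun s => f [seq v *m Q | v <- s]) = IT n f.
Proof.
move=> QQ; elim: n f => [|n IH] f jf f0 //=.
have mI := measurable_IT_cons n jf f0.
have I0 u : (0 <= IT n (fun s => f (u :: s)))%E by apply: IT_ge0.
apply: (eq_trans _ (gm_orthogonal QQ mI I0)).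
apply: eq_integral => u _.
by apply: (IH (fun s => f (u *m Q :: s))) => //; exact: jmeas_cons1.
Qed.

End iterated.

Section measurable_inv.
Variable R : realType.

Lemma measurable_invr : measurable_fun [set: R] (@GRing.inv R).
Proof.
rewrite -(setvU [set (0 : R)]); apply/measurable_funU => //.
  exact: measurableC.
split; last exact: measurable_fun_set1.
rewrite (_ : ~` [set 0] = [set x | x != 0]); last by apply/seteqP; split=> x /eqP.
apply: open_continuous_measurable_fun; first exact: open_neq.
by move=> x; rewrite inE => x0; exact: inv_continuous.
Qed.

End measurable_inv.

Section measurable_lists.
Variables (R : realType) (d : nat) (dT : measure_display) (T : measurableType dT).
Notation vec := 'rV[R]_d.

Lemma measurable_pr (g : seq (T -> vec)) (f : T -> vec) :
  all_meas g -> measurable_fun setT f ->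
  measurable_fun setT (fun t => pr [seq h t | h <- g] (f t)).
Proof.
elim: g f => [|h g IH] f //= [mh mg] mf.
have mh' := IH h mg mh.
apply: measurable_addmx; first exact: IH.
apply: measurable_oppmx; apply: measurable_scalemx => //.
apply: measurable_funM; first exact: measurable_inner.
by apply: measurableT_comp; [exact: measurable_invr|exact: measurable_inner].
Qed.

Lemma measurable_rk (g : seq (T -> vec)) : all_meas g ->
  measurable_fun setT (fun t => rk [seq h t | h <- g]).
Proof.
elim: g => [_|h g IH [mh mg]]; first exact: measurable_cst.
rewrite /=; apply: measurable_fun_addn; last exact: IH.
rewrite (_ : (fun t => _) = (fun t => if pr [seq h t | h <- g] (h t) != 0 then 1%N else 0%N)).
  apply: measurable_fun_ifT => //; apply: measurable_neg.
  rewrite (_ : (fun t => _) = (fun t => inner (pr [seq h t | h <- g] (h t))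
     (pr [seq h t | h <- g] (h t)) == 0)); last by apply/funext => t; rewrite inner_eq0.
  by apply: measurable_fun_eqr => //; apply: measurable_inner; exact: measurable_pr.
by apply/funext => t; case: (_ != 0).
Qed.

Lemma mset_rk (g : seq (T -> vec)) k : all_meas g ->
  measurable [set t | rk [seq h t | h <- g] = k].
Proof.
move=> mg; rewrite (_ : [set t | _] = [set t | rk [seq h t | h <- g] == k]).
  by apply: mset_bool; apply: measurable_fun_eqn => //; exact: measurable_rk.
by apply/seteqP; split=> t /eqP.
Qed.

End measurable_lists.

(** * Gram-Schmidt matrices and reflections *)

Section gram_schmidt.
Variables (R : realType) (d : nat).
Notation vec := 'rV[R]_d.
Implicit Types (s : seq vec) (x y z : vec) (Q : 'M[R]_d).

Lemma measurable_enorm dT (T : measurableType dT) (f : T -> vec) :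
  measurable_fun setT f -> measurable_fun setT (fun t => enorm (f t)).
Proof.
move=> mf; have msqrt : measurable_fun [set: R] (@Num.sqrt R).
  by apply: continuous_measurable_fun; exact: sqrt_continuous.
exact: (measurableT_comp msqrt (measurable_inner mf mf)).
Qed.

Lemma enorm_sqr x : enorm x ^+ 2 = inner x x.
Proof. by rewrite sqr_sqrtr// inner_ge0. Qed.

Lemma enorm_eq0 x : (enorm x == 0) = (x == 0).
Proof. by rewrite -sqrf_eq0 enorm_sqr inner_eq0. Qed.

Lemma enorm_ge0 x : 0 <= enorm x. Proof. exact: sqrtr_ge0. Qed.

Lemma enormZ c x : 0 <= c -> enorm (c *: x) = c * enorm x.
Proof.
move=> c0; apply/eqP; rewrite -(@eqrXn2 _ 2) ?enorm_ge0 ?mulr_ge0 ?enorm_ge0//.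
by rewrite exprMn !enorm_sqr innerZl innerZr mulrA.
Qed.

Lemma inner_orth Q x y : Q *m Q^T = 1%:M -> inner (x *m Q) (y *m Q) = inner x y.
Proof. by move=> QQ; rewrite !innerE trmx_mul mulmxA -(mulmxA x) QQ mulmx1. Qed.

Lemma pr_orth Q s x : Q *m Q^T = 1%:M ->
  pr [seq v *m Q | v <- s] (x *m Q) = pr s x *m Q.
Proof.
move=> QQ; elim: s x => //= w s IH x.
by rewrite !IH !inner_orth// mulmxBl scalemxAl.
Qed.

Lemma rk_orth Q s : Q *m Q^T = 1%:M -> rk [seq v *m Q | v <- s] = rk s.
Proof.
move=> QQ; elim: s => //= w s ->; congr (nat_of_bool (~~ _) + _)%N.
by rewrite pr_orth// -inner_eq0 inner_orth// inner_eq0.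
Qed.

Lemma rk_size s : (rk s <= size s)%N.
Proof. by elim: s => //= w s IH; case: (_ != 0); rewrite ?add1n ?add0n ?ltnS ?leqW. Qed.

Fixpoint gs s : seq vec :=
  if s is w :: s' then let y := pr s' w in (enorm y)^-1 *: y :: gs s' else [::].

Lemma size_gs s : size (gs s) = size s.
Proof. by elim: s => //= w s ->. Qed.

Lemma gs_orth Q s : Q *m Q^T = 1%:M -> gs [seq v *m Q | v <- s] = [seq v *m Q | v <- gs s].
Proof.
move=> QQ; elim: s => //= w s ->; rewrite pr_orth// -scalemxAl.
by rewrite /enorm inner_orth.
Qed.

Lemma perp_gs s z : perp s z -> perp (gs s) z.
Proof.
elim: s => //= w s IH /andP[/eqP wz sz]; rewrite IH// andbT.
by rewrite innerZl inner_pr// wz mulr0.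
Qed.

Lemma gs_orthonormal s i j : rk s = size s -> (i < size s)%N -> (j < size s)%N ->
  inner (nth 0 (gs s) i) (nth 0 (gs s) j) = (i == j)%:R.
Proof.
elim: s i j => //= w s IH i j rks.
have [y0 rks'] : pr s w != 0 /\ rk s = size s.
  have := rk_size s; case: (_ != 0) rks => /= rks.
    by split=> //; apply/eqP; rewrite -eqSS -rks add1n.
  by rewrite add0n in rks; rewrite rks ltnn.
have yn : enorm (pr s w) != 0 by rewrite enorm_eq0.
have yj k : (k < size s)%N -> inner (nth 0 (gs s) k) (pr s w) = 0.
  move=> ks; have /perpP := perp_gs (pr_perp s w).
  by apply; apply: mem_nth; rewrite size_gs.
case: i j => [|i] [|j] //= is_ js.
- by rewrite innerZl innerZr -enorm_sqr; field.
- by rewrite innerZl innerC yj// mulr0.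
- by rewrite innerZr yj// mulr0.
- by rewrite IH.
Qed.

Lemma measurable_gs dT (T : measurableType dT) (g : seq (T -> vec)) i : all_meas g ->
  measurable_fun setT (fun t => nth 0 (gs [seq h t | h <- g]) i).
Proof.
elim: g i => [|h g IH] i /=; first by move=> _; rewrite nth_nil.
move=> [mh mg]; case: i => [|i] /=; last exact: IH.
have mpr := measurable_pr mg mh.
apply: measurable_scalemx => //; apply: measurableT_comp; first exact: measurable_invr.
exact: measurable_enorm.
Qed.

(** The orthonormal vectors are the columns, so [x *m gs_mx s] lists the inner products of [x] with
    them. For [d] independent Gaussian vectors this is almost surely orthogonal and serves as a
    random rotation. *)
Definition gs_mx s : 'M[R]_d := \matrix_(i, j) (nth 0 (gs s) j) 0 i.

Lemma gs_mxP s : rk s = d -> size s = d -> gs_mx s *m (gs_mx s)^T = 1%:M.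
Proof.
move=> rs ss; apply: mulmx1C; apply/matrixP => i j; rewrite !mxE.
have is_ : (i < size s)%N by rewrite ss.
have js : (j < size s)%N by rewrite ss.
rewrite -(gs_orthonormal _ is_ js) ?rs ?ss//.
by apply: eq_bigr => k _; rewrite !mxE.
Qed.

Lemma row_gs_mx s x j : (x *m gs_mx s) 0 j = inner x (nth 0 (gs s) j).
Proof. by rewrite mxE; apply: eq_bigr => k _; rewrite !mxE. Qed.

(** Householder reflection; it is the identity for [h = 0], so that [reflection_swap] also covers
    [x = y]. *)
Definition reflection (h : vec) : 'M[R]_d := 1%:M - (2 / inner h h) *: (h^T *m h).

Lemma mul_reflection h x : x *m reflection h = x - (2 / inner h h * inner x h) *: h.
Proof.
rewrite mulmxBr mulmx1 -scalemxAr mulmxA [x *m _]mx11_scalar -innerE.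
by rewrite mul_scalar_mx scalerA.
Qed.

Lemma tr_reflection h : (reflection h)^T = reflection h.
Proof. by rewrite /reflection linearB linearZ /= trmx_mul trmxK trmx1. Qed.

Lemma reflectionK h : reflection h *m (reflection h)^T = 1%:M.
Proof.
rewrite tr_reflection; apply/row_matrixP => i; rewrite row1 rowE mulmxA.
set x := delta_mx 0 i; rewrite !mul_reflection innerBl innerZl.
have [->|h0] := eqVneq h 0; first by rewrite !scaler0 !subr0.
rewrite -addrA -opprD -scalerDl.
rewrite [X in x - X *: h](_ : _ = 0) ?scale0r ?subr0//.
by field; rewrite inner_eq0.
Qed.

Lemma reflection_swap x y : inner x x = inner y y -> x *m reflection (x - y) = y.
Proof.
move=> xy; rewrite mul_reflection; have [->|h0] := eqVneq x y.
  by rewrite subrr scaler0 subr0.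
rewrite (_ : _ * _ = 1) ?scale1r ?subKr//.
have hh : inner (x - y) (x - y) = 2 * inner x (x - y).
  by rewrite innerBl !innerBr -xy (innerC y x); ring.
have : inner (x - y) (x - y) != 0 by rewrite inner_eq0 subr_eq0.
by rewrite hh mulf_eq0 negb_or => /andP[_ x0]; field.
Qed.

End gram_schmidt.

Section null_sets.
Variables (R : realType) (dT : measure_display) (T : measurableType dT).

Lemma eq_integral_null (mu : {measure set T -> \bar R}) (N : T -> Prop) (f g : T -> \bar R) :
  measurable [set t | N t] -> mu [set t | N t] = 0%E ->
  measurable_fun setT f -> measurable_fun setT g ->
  (forall t, ~ N t -> f t = g t) ->
  (\int[mu]_t f t = \int[mu]_t g t)%E.
Proof.
move=> mN N0 mf mg fg; apply: ae_eq_integral => //.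
exists [set t | N t]; split=> // t /= nfg; apply: contrapT => nN; apply: nfg => _.
exact: fg.
Qed.

Lemma integral_ind_ae (mu : probability T R) (N P : T -> Prop) :
  measurable [set t | N t] -> mu [set t | N t] = 0%E ->
  measurable [set t | P t] -> (forall t, ~ N t -> P t) ->
  (\int[mu]_t ind R (P t) = 1)%E.
Proof.
move=> mN N0 mP NP; rewrite -[RHS](probability_setT mu) -[RHS]mul1e -integral_cst//.
apply: (eq_integral_null mN N0) => //; first exact: measurable_ind.
by move=> t /NP; exact: ind_true.
Qed.

Lemma mset_eq0 d (f : T -> 'rV[R]_d) : measurable_fun setT f ->
  measurable [set t | f t = 0].
Proof.
move=> mf; rewrite (_ : [set t | _] = [set t | inner (f t) (f t) = 0]).
  by apply: mset_eq => //; exact: measurable_inner.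
by apply/seteqP; split=> t /=; [move=> ->; rewrite inner0l|move/eqP; rewrite inner_eq0 => /eqP].
Qed.

End null_sets.

(** * Isotropic laws agree on conic sets *)

Section isotropic.
Variables (R : realType) (m : nat).
Notation vec := 'rV[R]_m.

Lemma jmeas_rk k : jmeas (fun (_ : unit) (s : seq vec) => ind R (rk s = k)).
Proof. by move=> dS S phi g mphi mg; apply: measurable_ind; exact: mset_rk. Qed.

(** For a fixed independent tail of length below [m] there is a nonzero [z] orthogonal to it, and
    the head can depend on the tail only by being orthogonal to [z], a null event. [IT_swap] makes
    the head the innermost variable. *)
Lemma IT_full_rank n : (n <= m)%N ->
  IT n (fun s : seq vec => ind R (rk s = n)) = 1%E.
Proof.
elim: n => [|n IH] nm; first by rewrite /= ind_true.
rewrite -(IH (ltnW nm)) /=.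
have jG : jmeas (fun u (s : seq vec) => ind R (rk (u :: s) = n.+1)).
  move=> dS S phi g mphi mg; apply: measurable_ind.
  exact: (@mset_rk _ _ _ _ (phi :: g)).
apply: (eq_trans (IT_swap (gm R m) n jG (fun _ _ => ind_ge0 _ _))).
apply: eq_IT => s sn.
have [rn|rn] := eqVneq (rk s) n; last first.
  rewrite [RHS]ind_false; last exact/eqP.
  rewrite -[RHS](integral0 (gm R m) setT); apply: eq_integral => u _.
  rewrite ind_false//= => rus.
  have rls : (rk s < n)%N by rewrite ltn_neqAle rn -sn rk_size.
  have : (n < n)%N; last by rewrite ltnn.
  by rewrite -[X in (X <= _)%N]rus; case: (_ != 0); rewrite ?add0n ?add1n// ltnW.
rewrite [RHS]ind_true//.
have [z z0 zs] : exists2 z : vec, z != 0 & perp s z by apply: perp_lt; rewrite rn.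
apply: (@integral_ind_ae _ _ _ _ (fun u : vec => inner z u = 0)).
- by apply: mset_eq => //; exact: measurable_inner.
- exact: gm_hyperplane0.
- have := @mset_rk R m _ vec (id :: [seq (fun _ : vec => v) | v <- s]) n.+1.
  rewrite (_ : [set t | _] = [set t | rk (t :: s) = n.+1]); last first.
    by apply/seteqP; split=> t /=; rewrite map_cst.
  by apply; split=> //; exact: all_meas_cst.
move=> u zu /=; rewrite rn (_ : pr s u != 0)//.
apply: contra_notN zu => /eqP us; have := inner_pr u zs.
by rewrite us inner0l innerC.
Qed.

Variable B : set vec.
Hypotheses (mB : measurable B) (cB : conic B).

Let G (x : vec) (s : seq vec) := ind R (rk s = m /\ B (x *m gs_mx s)).

Let G_ge0 x s : (0 <= G x s)%E. Proof. exact: ind_ge0. Qed.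

Let jG : jmeas G.
Proof.
move=> dS S phi g mphi mg; apply: measurable_ind; apply: mset_and; first exact: mset_rk.
have mf : measurable_fun setT (fun t => phi t *m gs_mx [seq h t | h <- g]).
  apply/measurable_mxP => i j; rewrite (ord1 i).
  under eq_fun do rewrite row_gs_mx.
  by apply: measurable_inner => //; exact: measurable_gs.
by rewrite -[X in measurable X]setTI; exact: (mf measurableT B mB).
Qed.

(** A reflection exchanging [x] and [y] can be applied to the whole list, whose law it preserves;
    the inner products that make up [G] then contain [y] in the place of [x]. *)
Let IT_G_eq x y : x != 0 -> inner x x = inner y y -> IT m (G x) = IT m (G y).
Proof.
move=> x0 xy; set H := reflection (x - y).
have HH : H *m H^T = 1%:M by exact: reflectionK.
rewrite -(@IT_orthogonal R m m H (G x) HH); last 2 first.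
- exact: jmeas_fix.
- exact: G_ge0.
apply: eq_IT => s sm; apply: ind_iff; rewrite rk_orth//.
suff -> : x *m gs_mx [seq v *m H | v <- s] = y *m gs_mx s by [].
apply/rowP => j; rewrite !row_gs_mx gs_orth// (nth_map 0) ?size_gs ?sm//.
by rewrite -(reflection_swap xy) -/H !innerE -mulmxA trmx_mul tr_reflection.
Qed.

Let IT_GZ c x : 0 < c -> IT m (G (c *: x)) = IT m (G x).
Proof.
move=> c0; apply: eq_IT => s _; apply: ind_iff; rewrite -scalemxAl.
split=> -[rs Bx]; split=> //; last exact: cB.
rewrite -[x *m _]scale1r -(mulVf (lt0r_neq0 c0)) -scalerA.
by apply: cB => //; rewrite invr_gt0.
Qed.

Lemma gs_cone_const x y : x != 0 -> y != 0 -> IT m (G x) = IT m (G y).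
Proof.
move=> x0 y0; have xg0 : 0 < enorm x by rewrite lt_def enorm_eq0 x0 enorm_ge0.
have yg0 : 0 < enorm y by rewrite lt_def enorm_eq0 y0 enorm_ge0.
rewrite -(@IT_GZ (enorm x / enorm y) y) ?divr_gt0//.
apply: IT_G_eq => //; rewrite -!enorm_sqr enormZ ?divfK ?lt0r_neq0//.
by rewrite divr_ge0 ?enorm_ge0.
Qed.

(** By isotropy [h t] may be turned by any orthogonal matrix, hence by a random one, without
    changing the probability. After exchanging the integrals, the inner one is the same for every
    nonzero [h t]. The value [IT m (G x0)] involves neither [mu] nor [h], so any two such laws give
    [B] the same probability. *)
Lemma isotropic_cone dT (T : measurableType dT) (mu : probability T R) (h : T -> vec) x0 :
  measurable_fun setT h -> mu [set t | h t = 0] = 0%E ->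
  (forall Q : 'M[R]_m, Q *m Q^T = 1%:M ->
    (\int[mu]_t ind R (B (h t *m Q)) = \int[mu]_t ind R (B (h t)))%E) ->
  x0 != 0 -> (\int[mu]_t ind R (B (h t)))%E = IT m (G x0).
Proof.
move=> mh h0 iso x00; set c := (\int[mu]_t _)%E.
have c0 : (0 <= c)%E by apply: integral_ge0 => t _; exact: ind_ge0.
rewrite -[c]mule1 -(IT_full_rank (leqnn m)) -ITZl//; last 2 first.
- exact: jmeas_rk.
- by move=> s; exact: ind_ge0.
have jGh : jmeas (fun t => G (h t)).
  by move=> dS S phi g mphi mg; apply: (jG (phi := h \o phi)) => //; exact: measurableT_comp.
transitivity (IT m (fun s => \int[mu]_t G (h t) s)%E).
  apply: eq_IT => s sm; have [rs|rs] := eqVneq (rk s) m.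
    rewrite ind_true// mule1 /c -(iso (gs_mx s)) ?gs_mxP//.
    by apply: eq_integral => t _; apply: ind_iff; split=> [|[]].
  rewrite ind_false ?mule0; last exact/eqP.
  rewrite -[LHS](integral0 mu setT); apply: eq_integral => t _.
  by rewrite /G ind_false// => -[/eqP]; rewrite (negbTE rs).
rewrite -(IT_swap mu m jGh)//.
have mz := mset_eq0 mh.
transitivity (\int[mu]_t cst (IT m (G x0)) t)%E.
  apply: (eq_integral_null mz h0) => //; first exact: measurable_IT.
  by move=> t /eqP ht; exact: gs_cone_const.
by rewrite integral_cst// -[RHS]mule1; congr (_ * _)%E; exact: probability_setT.
Qed.

End isotropic.

Section isotropic_laws.
Variable (R : realType).

Lemma measurable_set_comp dT (T : measurableType dT) m (f : T -> 'rV[R]_m) (B : set 'rV[R]_m) :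
  measurable_fun setT f -> measurable B -> measurable [set t | B (f t)].
Proof. by move=> mf mB; rewrite -[X in measurable X]setTI; exact: mf. Qed.

Lemma gm_zero m : (0 < m)%N -> gm R m [set x | x = 0] = 0%E.
Proof.
move=> m0; have e0 : delta_mx 0 (Ordinal m0) != 0 :> 'rV[R]_m.
  apply: contraNneq (oner_neq0 R) => /rowP/(_ (Ordinal m0)); by rewrite !mxE !eqxx => /eqP.
have := gm_hyperplane0 e0; set H := [set x | _] => H0.
apply/eqP; rewrite -measure_le0 -H0 le_measure// ?inE.
- exact: mset_eq0.
- by apply: mset_eq => //; exact: measurable_inner.
- by move=> x ->; exact: inner0r.
Qed.

(** Both [h x y] and [x] are isotropic and almost surely nonzero, so [isotropic_cone] with one
    reference vector evaluates the two sides. *)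
Lemma isotropic_pair_cone m (B : set 'rV[R]_m) (h : 'rV[R]_m -> 'rV[R]_m -> 'rV[R]_m) :
  (0 < m)%N -> measurable B -> conic B ->
  measurable_fun setT (fun p : 'rV[R]_m * 'rV[R]_m => h p.1 p.2) ->
  (forall Q : 'M[R]_m, Q *m Q^T = 1%:M -> forall x y, h (x *m Q) (y *m Q) = h x y *m Q) ->
  (\int[gm R m]_x \int[gm R m]_y ind R (h x y = 0%R) = 0)%E ->
  (\int[gm R m]_x \int[gm R m]_y ind R (B (h x y)) = \int[gm R m]_x ind R (B x))%E.
Proof.
move=> m0 mB cB mh hQ h0.
have [x0 x00] : exists x0 : 'rV[R]_m, x0 != 0.
  exists (delta_mx 0 (Ordinal m0)).
  apply: contraNneq (oner_neq0 R) => /rowP/(_ (Ordinal m0)); by rewrite !mxE !eqxx => /eqP.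
have mid : measurable_fun [set: 'rV[R]_m] id by [].
rewrite (isotropic_cone mB cB (mu := gm R m) mid (gm_zero m0) _ x00); last first.
  move=> Q QQ; apply: (gm_orthogonal QQ) => //; first exact: measurable_ind.
  by move=> x; exact: ind_ge0.
have fub (P : 'rV[R]_m -> Prop) : measurable [set x | P x] ->
    (\int[gm R m]_x \int[gm R m]_y ind R (P (h x y)) =
     \int[(gm R m \x gm R m)]_p ind R (P (h p.1 p.2)))%E.
  move=> mP; apply/esym.
  apply: (fubini_tonelli1 (m1 := gm R m) (m2 := gm R m)) => [|p]; last exact: ind_ge0.
  by apply: measurable_ind; exact: measurable_set_comp mP.
have mz : measurable [set x : 'rV[R]_m | x = 0] by exact: mset_eq0.
rewrite (fub B)//.
apply: (isotropic_cone mB cB (mu := [the probability _ _ of (gm R m \x gm R m)%E]) mh _ _ x00).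
  rewrite -h0 (fub (eq^~ 0))// integral_ind//.
  exact: (measurable_set_comp mh mz).
move=> Q QQ; have mBQ : measurable [set x | B (x *m Q)].
  by apply: measurable_set_comp => //; exact: measurable_mulmxr.
apply: (eq_trans (esym (fub _ mBQ))); apply: (eq_trans _ (fub B mB)).
have mG := measurable_ind R (measurable_set_comp mh mB).
have mF := measurable_fun_fubini_tonelli_F (m2 := gm R m) _ mG (fun p => ind_ge0 R _).
have F0 x : (0 <= \int[gm R m]_y ind R (B (h x y)))%E.
  by apply: integral_ge0 => y _; exact: ind_ge0.
apply: (eq_trans _ (gm_orthogonal QQ mF F0)).
apply: eq_integral => x _.
have mGx : measurable_fun setT (fun y => ind R (B (h (x *m Q) y))).
  exact: (measurableT_comp mG (pair1_measurable (x *m Q))).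
apply: (eq_trans _ (gm_orthogonal QQ mGx (fun=> ind_ge0 R _))).
by apply: eq_integral => y _; rewrite hQ.
Qed.

(* The projection of [x] along an independent [v] is isotropic and almost surely
   nonzero, so only its direction matters for the conic set [B]. *)
Lemma gm_cone_projection m (B : set 'rV[R]_m) : (1 < m)%N -> measurable B -> conic B ->
  (\int[gm R m]_v \int[gm R m]_x ind R (B (pr [:: v] x)) = \int[gm R m]_x ind R (B x))%E.
Proof.
move=> m1 mB cB; apply: (@isotropic_pair_cone m B (fun v x => pr [:: v] x)) => //.
- exact: ltnW.
- exact: (@measurable_pr _ _ _ _ [:: fst] snd).
- by move=> Q QQ v x; exact: (@pr_orth _ _ Q [:: v]).
rewrite -[RHS](integral0 (gm R m) setT); apply: eq_integral => v _.
have [z z0 vz] : exists2 z : 'rV[R]_m, z != 0 & perp [:: v] z.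
  by apply: perp_lt; apply: leq_ltn_trans m1; exact: rk_size.
have mz : measurable [set x : 'rV[R]_m | pr [:: v] x = 0].
  by apply: mset_eq0; exact: (@measurable_pr _ _ _ 'rV[R]_m [:: (fun=> v)] id).
rewrite integral_ind//; apply/eqP; rewrite -measure_le0 -(gm_hyperplane0 z0).
rewrite le_measure ?inE//; first by apply: mset_eq => //; exact: measurable_inner.
by move=> x /= x0; rewrite innerC -(inner_pr x vz) /= x0 inner0l.
Qed.

(** A linear combination of independent Gaussian vectors is isotropic, and the conic set [B] does
    not see its scale. *)
Lemma gm_cone_combination m (B : set 'rV[R]_m) (c : R) : measurable B -> conic B ->
  (\int[gm R m]_u \int[gm R m]_x ind R (B (x - c *: u)%R) = \int[gm R m]_x ind R (B x))%E.
Proof.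
(* In dimension 0 there is no nonzero reference vector, but all vectors coincide. *)
case: m B => [|m] B mB cB.
  transitivity (\int[gm R 0]_u cst (ind R (B 0%R)) u)%E.
    apply: eq_integral => u _.
    transitivity (\int[gm R 0]_u cst (ind R (B 0%R)) u)%E.
      by apply: eq_integral => x _; rewrite [_ - _]thinmx0.
    rewrite integral_cst// -[RHS]mule1; congr (_ * _)%E.
    exact: (@probability_setT _ _ _ (gm R 0)).
  by apply: eq_integral => u _; rewrite [u]thinmx0.
apply: (@isotropic_pair_cone m.+1 B (fun u x => x - c *: u)) => //.
- apply: measurable_addmx => //; apply: measurable_oppmx; apply: measurable_scalemx => //.
- by move=> Q QQ u x; rewrite mulmxBl scalemxAl.
set n := m.+1.
have e0 : delta_mx 0 ord0 != 0 :> 'rV[R]_n.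
  apply: contraNneq (oner_neq0 R) => /rowP/(_ ord0); by rewrite !mxE !eqxx => /eqP.
(* If [x = c *: u], the first coordinates already agree, which puts the joint vector of [u] and [x]
   on the hyperplane orthogonal to [z]. *)
pose z := row_mx (- c *: delta_mx 0 ord0) (delta_mx 0 ord0) : 'rV[R]_(n + n).
have z0 : z != 0.
  by apply: contra_neq e0 => /(congr1 rsubmx); rewrite row_mxKr raddf0.
have mz : measurable [set w | inner z w = 0].
  by apply: mset_eq => //; exact: measurable_inner.
have mi := measurable_ind R mz.
have H0 : (\int[gm R n]_u \int[gm R n]_x ind R (inner z (row_mx u x) = 0%R) = 0)%E.
  rewrite -(gm_hyperplane0 z0) -(integral_ind _ mz).
  by apply/esym; exact: (integral_gm_cat mi (fun=> ind_ge0 R _)).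
have mh : measurable_fun setT (fun p : 'rV[R]_n * 'rV[R]_n => p.2 - c *: p.1).
  apply: measurable_addmx => //; apply: measurable_oppmx; exact: measurable_scalemx.
have mi0 := measurable_ind R (mset_eq0 mh).
have mir : measurable_fun setT (fun p : 'rV[R]_n * 'rV[R]_n => ind R (inner z (row_mx p.1 p.2) = 0)).
  by apply: (measurableT_comp mi); exact: measurable_row_mx.
apply/eqP; rewrite eq_le; apply/andP; split; last first.
  by apply: integral_ge0 => u _; apply: integral_ge0 => x _; exact: ind_ge0.
rewrite -[leRHS]H0; apply: ge0_le_integral => //.
- by move=> u _; apply: integral_ge0 => x _; exact: ind_ge0.
- exact: (measurable_fun_fubini_tonelli_F (m2 := gm R n) _ mi0 (fun=> ind_ge0 R _)).
- exact: (measurable_fun_fubini_tonelli_F (m2 := gm R n) _ mir (fun=> ind_ge0 R _)).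
move=> u _; apply: ge0_le_integral => //.
- by move=> x _; exact: ind_ge0.
- exact: (measurableT_comp mi0 (pair1_measurable u)).
- exact: (measurableT_comp mir (pair1_measurable u)).
move=> x _; apply: ind_le => /eqP; rewrite subr_eq0 => /eqP ->.
rewrite innerE tr_row_mx mul_row_col -scalemxAl linearZ /= -scalemxAr.
by rewrite -scalerDl addNr scale0r mxE.
Qed.

End isotropic_laws.

(** * Metric projection on a polyhedral cone *)

Section cones.
Variables (R : realType) (d : nat).
Notation vec := 'rV[R]_d.
Implicit Types (a s : seq vec) (u v w x y z p q : vec).

Definition cone a : set vec := [set x | all (fun v => inner v x <= 0) a].

Lemma coneP a x : cone a x <-> forall v, v \in a -> inner v x <= 0.
Proof. by split=> /allP. Qed.

Lemma coneD a x y : cone a x -> cone a y -> cone a (x + y).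
Proof.
move=> /coneP ax /coneP ay; apply/coneP => v va.
by rewrite innerDr -[leRHS]addr0 lerD ?ax ?ay.
Qed.

Lemma coneZ a t x : 0 <= t -> cone a x -> cone a (t *: x).
Proof.
by move=> t0 /coneP ax; apply/coneP => v va; rewrite innerZr mulr_ge0_le0 ?ax.
Qed.

(** The constraints inactive at [p] have slack, and being finitely many they leave a common step
    size; the active ones are preserved by the hypothesis on [z]. *)
Lemma cone_perturb a p z : cone a p ->
  (forall v, v \in a -> inner v p = 0 -> inner v z <= 0) ->
  exists2 e : R, 0 < e & forall t, 0 <= t <= e -> cone a (p + t *: z).
Proof.
elim: a => [|v a IH] /=; first by move=> _ _; exists 1.
move=> /andP[vp ap] H.
have [e e0 He] := IH ap (fun w wa => H w (@mem_behead _ (v :: a) _ wa)).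
have Hv := H v (mem_head v a).
have [vp0|vp0] := eqVneq (inner v p) 0.
  exists e => // t /[dup] t01 /He; rewrite /cone /= => ->; rewrite andbT.
  by rewrite innerDr innerZr vp0 add0r mulr_ge0_le0 ?Hv//; case/andP: t01.
have vp1 : 0 < - inner v p by rewrite oppr_gt0 lt_neqAle vp0.
have n1 : 0 < 1 + `|inner v z| by rewrite ltr_pwDl.
exists (Num.min e (- inner v p / (1 + `|inner v z|))).
  by rewrite lt_min e0 divr_gt0.
move=> t /andP[t0]; rewrite le_min => /andP[te tv].
rewrite /cone /= He ?t0 ?te// andbT innerDr innerZr.
move: tv; rewrite ler_pdivlMr// => tv.
rewrite -lerBrDl sub0r; apply: le_trans tv.
by rewrite ler_wpM2l// (le_trans (ler_norm _))// lerDr.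
Qed.

(** Moreau's characterisation of the nearest point of a convex cone: the residual belongs to the
    polar cone and is orthogonal to the point. *)
Definition isproj (C : set vec) x p :=
  [/\ C p, forall z, C z -> inner (x - p) z <= 0 & inner (x - p) p = 0].

Lemma isproj_dist C x p z : isproj C x p -> C z ->
  inner (x - p) (x - p) + inner (p - z) (p - z) <= inner (x - z) (x - z).
Proof.
move=> [Cp Cle xp] Cz; have h := Cle _ Cz.
have xpz : inner (x - p) (p - z) = - inner (x - p) z by rewrite innerBr xp sub0r.
have -> : x - z = (x - p) + (p - z) by rewrite subrKA.
move: (x - p) (p - z) xpz h => X Y XY h; rewrite innerDl !innerDr (innerC Y X) XY.
lra.
Qed.

Lemma isproj_unique C x p q : isproj C x p -> isproj C x q -> p = q.
Proof.
move=> pp pq; have [Cp _ _] := pp; have [Cq _ _] := pq.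
have h1 := isproj_dist pp Cq; have h2 := isproj_dist pq Cp.
apply/eqP; rewrite -subr_eq0 -inner_eq0 eq_le inner_ge0 andbT.
by have := inner_ge0 (q - p); lra.
Qed.

(** Induction on the constraints, with [s] collecting those that have become equalities. If the
    projection found without [u] violates [u], the true one lies on the hyperplane of [u], so [u]
    moves to [s]. *)
Lemma isproj_exists a s x : exists p, isproj (cone a `&` perp s) x p.
Proof.
elim: a s => [|u a IH] s.
  exists (pr s x); split; first by split=> //; exact: pr_perp.
    by move=> z [_ /(pr_res x) ->].
  exact/pr_res/pr_perp.
have [p [[ap sp] Hp xp]] := IH s.
have [up|up] := lerP (inner u p) 0.
  exists p; split=> //; first by split=> //; rewrite /cone /= up.
  by move=> z [/andP[_ az] sz]; apply: Hp.
have [q [[aq sq] Hq xq]] := IH (u :: s).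
have /andP[/eqP uq sq'] := sq.
exists q; split=> //; first by split=> //; rewrite /cone /= uq lexx.
move=> z [/andP[uz az] sz].
(* This multiple of [p] carries [z] to the hyperplane of [u], where the optimality of [q] applies.
   The added term has the right sign because [inner (x - q) p] is at least the squared distance from
   [p] to [q]. *)
pose t := - inner u z / inner u p.
have t0 : 0 <= t by rewrite divr_ge0 ?oppr_ge0// ltW.
have := Hq (z + t *: p); rewrite innerDr innerZr => Hz.
have {}Hz : inner (x - q) z + t * inner (x - q) p <= 0.
  apply: Hz; split; first by apply: coneD => //; exact: coneZ.
  apply/andP; split; last by apply: perpD => //; exact: perpZ.
  by rewrite innerDr innerZr /t divfK ?subrr// lt0r_neq0.
have xqp : 0 <= inner (x - q) p.
  have h1 : inner (x - p) q <= 0 by apply: Hp.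
  have := inner_ge0 (p - q); move: h1 xp xq.
  rewrite !innerBl !innerBr (innerC q p); lra.
have := mulr_ge0 t0 xqp; lra.
Qed.

Lemma isproj_cone_exists a x : exists p, isproj (cone a) x p.
Proof.
have [p [[ap _] Hp xp]] := isproj_exists a [::] x.
by exists p; split=> // z az; apply: Hp.
Qed.

Definition act a p := [seq v <- a | inner v p == 0].

Lemma mem_act a p v : (v \in act a p) = (inner v p == 0) && (v \in a).
Proof. exact: mem_filter. Qed.

Lemma perp_act a p : perp (act a p) p.
Proof. by apply/perpP => v; rewrite mem_act => /andP[/eqP]. Qed.

(** Near [p] only the active constraints matter, so the residual is nonpositive on both [y] and
    [- y] for every [y] orthogonal to them. *)
Lemma isproj_pr_act a x p : isproj (cone a) x p -> p = pr (act a p) x.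
Proof.
move=> [ap Hp xp]; apply: pr_unique; first exact: perp_act.
move=> z /perpP zp.
have le0 y : perp (act a p) y -> inner (x - p) y <= 0.
  move=> /perpP yp; have [v va vp|e e0 He] := @cone_perturb a p y ap.
    by rewrite yp// mem_act vp eqxx.
  have := Hp _ (He e _); rewrite lexx ltW//= innerDr xp add0r innerZr => /(_ isT).
  by rewrite pmulr_rle0.
apply/eqP; rewrite eq_le le0; last exact/perpP.
by rewrite -oppr_le0 -innerNr le0//; apply: perpN; exact/perpP.
Qed.

(* The metric projection of [x] on [cone a] lies in [A] and in the relative
   interior of a [k]-face; the face is described by its active constraints. *)
Definition ev a k (A : set vec) x :=
  exists p, [/\ isproj (cone a) x p, A p & (rk (act a p) + k)%N = d].

Lemma ev_isproj a k A x p : isproj (cone a) x p ->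
  ev a k A x <-> A p /\ (rk (act a p) + k)%N = d.
Proof.
move=> pp; split=> [[q [pq Aq rq]]|[Ap rp]]; last by exists p.
by rewrite (isproj_unique pp pq).
Qed.

Lemma act_mask a p : exists m : (size a).-tuple bool,
  act a p = mask m a /\ forall i : 'I_(size a), tnth m i = (inner (nth 0 a i) p == 0).
Proof.
have sm : size [seq inner v p == 0 | v <- a] == size a by rewrite size_map.
exists (Tuple sm); split; first by rewrite /act filter_mask.
by move=> i; rewrite (tnth_nth false) /= (nth_map 0).
Qed.

Lemma act_maskP a p (m : (size a).-tuple bool) :
  (forall i : 'I_(size a), tnth m i = (inner (nth 0 a i) p == 0)) -> act a p = mask m a.
Proof.
move=> mE; have [m' [-> m'E]] := act_mask a p; congr mask.
by congr val; apply: eq_from_tnth => i; rewrite mE m'E.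
Qed.

(** Serves measurability: the projection is one of the finitely many points [pr (mask m a) x],
    namely the feasible one nearest to [x]. *)
Lemma ev_mask a k A x : ev a k A x <->
  exists m : (size a).-tuple bool, [/\ cone a (pr (mask m a) x), A (pr (mask m a) x),
    exists m' : (size a).-tuple bool,
      (forall i : 'I_(size a), tnth m' i = (inner (nth 0 a i) (pr (mask m a) x) == 0)) /\
      (rk (mask m' a) + k)%N = d &
    forall m' : (size a).-tuple bool, cone a (pr (mask m' a) x) ->
      inner (x - pr (mask m a) x) (x - pr (mask m a) x) <=
      inner (x - pr (mask m' a) x) (x - pr (mask m' a) x)].
Proof.
have [q pq] := isproj_cone_exists a x; have [mq [mqa mqi]] := act_mask a q.
have qE : q = pr (mask mq a) x by rewrite -mqa; exact: isproj_pr_act.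
rewrite (ev_isproj k A pq); split=> [[Aq rq]|[m [am Am [m' [m'i rm']] min]]].
  exists mq; rewrite -qE; split=> //; first by case: pq.
    by exists mq; split=> //; rewrite -mqa.
  move=> m' am'; apply: le_trans (isproj_dist pq am').
  by rewrite lerDl inner_ge0.
have /min : cone a (pr (mask mq a) x) by rewrite -qE; case: pq.
rewrite -qE => le1; have le2 := isproj_dist pq am.
have : inner (q - pr (mask m a) x) (q - pr (mask m a) x) == 0.
  by rewrite eq_le inner_ge0 andbT; lra.
rewrite inner_eq0 subr_eq0 => /eqP qm; rewrite -qm in Am m'i.
by split=> //; rewrite (act_maskP m'i).
Qed.

End cones.

Section measurable_ev.
Variables (R : realType) (d : nat).
Notation vec := 'rV[R]_d.

Lemma mset_cone dT (T : measurableType dT) (g : seq (T -> vec)) (f : T -> vec) :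
  all_meas g -> measurable_fun setT f ->
  measurable [set t | cone [seq h t | h <- g] (f t)].
Proof.
move=> + mf; elim: g => [_|h g IH [mh mg]] /=.
  by rewrite (_ : [set t | _] = setT)//; apply/seteqP; split.
rewrite (_ : [set t | _] =
    [set t | inner (h t) (f t) <= 0 /\ cone [seq h t | h <- g] (f t)]).
  apply: mset_and; last exact: IH.
  by apply: mset_le => //; exact: measurable_inner.
by apply/seteqP; split=> t /=; rewrite /cone /= => /andP.
Qed.

Lemma all_meas_nth dT (T : measurableType dT) (g : seq (T -> vec)) i :
  all_meas g -> measurable_fun setT (fun t => nth 0 [seq h t | h <- g] i).
Proof.
elim: g i => [|h g IH] i.
  move=> _; rewrite (_ : (fun t => _) = cst 0) //.
  by apply/funext => t; rewrite nth_nil.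
by move=> [mh mg]; case: i => [|i] //=; exact: IH.
Qed.

Lemma mset_ev dT (T : measurableType dT) (g : seq (T -> vec)) (f : T -> vec) k (A : set vec) :
  measurable A -> all_meas g -> measurable_fun setT f ->
  measurable [set t | ev [seq h t | h <- g] k A (f t)].
Proof.
move=> mA mg mf.
have mpr m : measurable_fun setT (fun t => pr (mask m [seq h t | h <- g]) (f t)).
  under eq_fun do rewrite -map_mask.
  by apply: measurable_pr => //; exact: all_meas_mask.
(* The condition [k <= d] guards the truncated subtraction [d - k]. *)
rewrite (_ : [set t | _] = [set t | exists m : (size g).-tuple bool,
    cone [seq h t | h <- g] (pr (mask m [seq h t | h <- g]) (f t)) /\
    A (pr (mask m [seq h t | h <- g]) (f t)) /\
    (exists m' : (size g).-tuple bool,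
      (forall i : 'I_(size g), tnth m' i =
        (inner (nth 0 [seq h t | h <- g] i) (pr (mask m [seq h t | h <- g]) (f t)) == 0)) /\
      rk (mask m' [seq h t | h <- g]) = (d - k)%N /\ (k <= d)%N) /\
    forall m' : (size g).-tuple bool,
      cone [seq h t | h <- g] (pr (mask m' [seq h t | h <- g]) (f t)) ->
      inner (f t - pr (mask m [seq h t | h <- g]) (f t)) (f t - pr (mask m [seq h t | h <- g]) (f t)) <=
      inner (f t - pr (mask m' [seq h t | h <- g]) (f t)) (f t - pr (mask m' [seq h t | h <- g]) (f t))]).
  have mdist m : measurable_fun setT (fun t =>
      inner (f t - pr (mask m [seq h t | h <- g]) (f t)) (f t - pr (mask m [seq h t | h <- g]) (f t))).
    by apply: measurable_inner; apply: measurable_addmx => //; exact: measurable_oppmx.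
  apply: mset_exists => m; apply: mset_and; first exact: mset_cone.
  apply: mset_and; first exact: measurable_set_comp.
  apply: mset_and; last first.
    apply: mset_forall => m'; apply: mset_imply; first exact: mset_cone.
    exact: mset_le.
  apply: mset_exists => m'; apply: mset_and.
    apply: mset_forall => i; case: (tnth m' i).
      rewrite (_ : [set t | _] = [set t | inner (nth 0 [seq h t | h <- g] i)
          (pr (mask m [seq h t | h <- g]) (f t)) = 0]).
        by apply: mset_eq => //; apply: measurable_inner => //; exact: all_meas_nth.
      by apply/seteqP; split=> t /=; [move/esym/eqP|move/eqP/esym].
    rewrite (_ : [set t | _] = [set t | ~ inner (nth 0 [seq h t | h <- g] i)
        (pr (mask m [seq h t | h <- g]) (f t)) = 0]).
      by apply/mset_not/mset_eq => //; apply: measurable_inner => //; exact: all_meas_nth.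
    by apply/seteqP; split=> t /=; [move/esym/eqP|move/eqP/negbTE ->].
  apply: mset_and.
    under eq_set do rewrite -map_mask.
    by apply: mset_rk; exact: all_meas_mask.
  have [kd|kd] := leqP k d.
    by rewrite (_ : [set t | _] = setT)//; apply/seteqP; split.
  by rewrite (_ : [set t | _] = set0)//; apply/seteqP; split.
apply/seteqP; split=> t /=; rewrite ev_mask size_map.
  move=> [m [am Am [m' [m'i rm]] min]]; exists m; do 2!split=> //.
  split=> //; exists m'; split=> //; split; lia.
move=> [m [am [Am [[m' [m'i [rm kd]]] min]]]]; exists m; split=> //.
by exists m'; split=> //; lia.
Qed.

Definition Psi (a : seq vec) k (A : set vec) : \bar R :=
  (\int[gm R d]_x ind R (ev a k A x))%E.

Lemma Psi_ge0 a k A : (0 <= Psi a k A)%E.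
Proof. by apply: integral_ge0 => x _; exact: ind_ge0. Qed.

Lemma measurable_Psi dT (T : measurableType dT) (g : seq (T -> vec)) k (A : set vec) :
  measurable A -> all_meas g ->
  measurable_fun setT (fun t => Psi [seq h t | h <- g] k A).
Proof.
move=> mA mg.
have mE : measurable_fun setT (fun p : T * vec => ind R (ev [seq h p.1 | h <- g] k A p.2)).
  apply: measurable_ind.
  have := @mset_ev _ _ [seq h \o fst | h <- g] snd k A mA (all_meas_comp measurable_fst mg).
  rewrite (_ : [set t | _] = [set t | ev [seq h t.1 | h <- g] k A t.2]); first exact.
  by apply/seteqP; split=> t /=; rewrite -map_comp.
exact: (measurable_fun_fubini_tonelli_F (m2 := gm R d) _ mE (fun=> ind_ge0 R _)).
Qed.

End measurable_ev.

(** * Cutting a cone by a random hyperplane *)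

Section hyperplane_sections.
Variables (R : realType) (d : nat).
Notation vec := 'rV[R]_d.
Implicit Types (a s : seq vec) (u v w x y z p q : vec) (A : set vec).

(** Every [z] of the half cone reaches the hyperplane by adding a nonnegative multiple of [p], and
    [x - q] has a nonnegative inner product with [p]. *)
Lemma isproj_halfspace a u x p q : isproj (cone a) x p -> 0 < inner u p ->
  isproj (cone a `&` [set z | inner u z = 0]) x q -> isproj (cone (u :: a)) x q.
Proof.
move=> [ap Hp xp] up [[aq /= uq] Hq xq]; split=> //.
  by rewrite /cone /= uq lexx.
move=> z /andP[uz az]; pose t := - inner u z / inner u p.
have t0 : 0 <= t by rewrite divr_ge0 ?oppr_ge0// ltW.
have /Hq : (cone a `&` [set z | inner u z = 0]) (z + t *: p).
  split; first by apply: coneD => //; exact: coneZ.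
  by rewrite /= innerDr innerZr /t divfK ?subrr// lt0r_neq0.
rewrite innerDr innerZr => Hz.
have xqp : 0 <= inner (x - q) p.
  have h1 : inner (x - p) q <= 0 by apply: Hp.
  have := inner_ge0 (p - q); move: h1 xp xq.
  rewrite !innerBl !innerBr (innerC q p); lra.
have := mulr_ge0 t0 xqp; lra.
Qed.

Lemma cone_pm a u : cone (u :: - u :: a) = cone a `&` [set z | inner u z = 0].
Proof.
apply/seteqP; split=> z; rewrite /cone /= innerNl oppr_le0.
  by move=> /and3P[u1 u2 az]; split=> //; apply/eqP; rewrite eq_le u1.
by move=> [az ->]; rewrite lexx.
Qed.

Lemma pr_pm s u x : pr (u :: - u :: s) x = pr (u :: s) x.
Proof.
apply: eq_pr => z /=; by rewrite innerNl oppr_eq0 andbA andbb.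
Qed.

Lemma rk_N u s : rk (- u :: s) = rk (u :: s).
Proof. by rewrite /= prN oppr_eq0. Qed.

Lemma rk_pm u s : rk (u :: - u :: s) = rk (u :: s).
Proof.
have e : pr (- u :: s) u = 0.
  have := @pr_mem _ _ (- u :: s) (- u) (mem_head _ _).
  by rewrite prN => /eqP; rewrite oppr_eq0 => /eqP.
transitivity (nat_of_bool (pr (- u :: s) u != 0)%R + rk (- u :: s)%R)%N; first by [].
by rewrite e eqxx rk_N.
Qed.

Lemma act_cons0 a u q : inner u q = 0 -> act (u :: a) q = u :: act a q.
Proof. by move=> uq; rewrite /act /= uq eqxx. Qed.

Lemma act_consN a u q : inner u q != 0 -> act (u :: a) q = act a q.
Proof. by move=> uq; rewrite /act /= (negbTE uq). Qed.

Lemma ev_pm_sym a u k A x : ev (- u :: u :: a) k A x <-> ev (u :: - u :: a) k A x.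
Proof.
have [p pp] := isproj_cone_exists (u :: - u :: a) x.
have pp' : isproj (cone (- u :: u :: a)) x p.
  rewrite -{2}[u]opprK cone_pm (_ : [set z | _] = [set z | inner u z = 0]) -?cone_pm//.
  by apply/seteqP; split=> z /=; rewrite innerNl => /eqP; rewrite ?oppr_eq0 => /eqP //; move=> ->; rewrite oppr0.
have up : inner u p = 0 by case: pp; rewrite cone_pm => -[].
have up' : inner (- u) p = 0 by rewrite innerNl up oppr0.
rewrite (ev_isproj _ _ pp) (ev_isproj _ _ pp') !act_cons0//.
by rewrite rk_pm -{2}[u]opprK rk_pm rk_N.
Qed.

(** The half cone containing [p] keeps it as projection, with the same active constraints; for the
    other half the projection falls on the section. *)
Lemma ev_split_neg a u k A x p : isproj (cone a) x p -> inner u p < 0 ->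
  (ev (u :: a) k A x <-> ev a k A x) /\
  (ev (- u :: a) k A x <-> ev (u :: - u :: a) k A x).
Proof.
move=> pp up; have [ap Hp xp] := pp; split.
  have pp' : isproj (cone (u :: a)) x p.
    split=> //; first by rewrite /cone /= ltW.
    by move=> z /andP[_ az]; apply: Hp.
  by rewrite (ev_isproj _ _ pp) (ev_isproj _ _ pp') act_consN// lt_eqF.
have [q qq] := isproj_cone_exists (u :: - u :: a) x.
have qq' : isproj (cone (- u :: a)) x q.
  apply: (isproj_halfspace pp); first by rewrite innerNl oppr_gt0.
  rewrite (_ : [set z | _] = [set z | inner u z = 0]) -?cone_pm//.
  by apply/seteqP; split=> z /=; rewrite innerNl => /eqP; rewrite ?oppr_eq0 => /eqP //; move=> ->; rewrite oppr0.
have uq : inner u q = 0 by case: qq; rewrite cone_pm => -[].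
have uq' : inner (- u) q = 0 by rewrite innerNl uq oppr0.
by rewrite (ev_isproj _ _ qq) (ev_isproj _ _ qq') !act_cons0// rk_pm rk_N.
Qed.

Lemma ev_split a u k A x p : isproj (cone a) x p -> inner u p != 0 ->
  (ind R (ev (u :: a) k A x) + ind R (ev ((- u)%R :: a) k A x) =
   ind R (ev a k A x) + ind R (ev (u :: (- u)%R :: a) k A x))%E.
Proof.
move=> pp; rewrite neq_lt => /orP[up|up].
  by have [/ind_iff -> /ind_iff ->] := ev_split_neg k A pp up.
have up' : inner (- u) p < 0 by rewrite innerNl oppr_lt0.
have [/ind_iff -> ] := ev_split_neg k A pp up'.
rewrite {1}opprK => /ind_iff ->; rewrite addeC opprK.
by rewrite (ind_iff _ (ev_pm_sym _ _ _ _ _)).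
Qed.

(** If [x] projects to the apex of the larger cone, it does so for the smaller one, where all
    constraints are active and rank [d] means face dimension 0. This settles the case in which every
    hyperplane passes through the projection. *)
Lemma ev_vertex b a k A x : (0 < k)%N -> rk b = d -> (forall z, cone b z -> cone a z) ->
  isproj (cone a) x 0 -> ~ ev b k A x.
Proof.
move=> k0 rb ba [_ H0 _] [q [qq _ rq]].
have q0 : q = 0.
  apply: (isproj_unique qq); split; last by rewrite inner0r.
    by apply/coneP => v _; rewrite inner0r.
  by move=> z /ba; exact: H0.
have ab : act b q = b.
  by rewrite q0 /act; apply/all_filterP/allP => v _; rewrite inner0r.
by move: rq; rewrite ab rb; lia.
Qed.

Lemma rk_consd u a : rk a = d -> rk (u :: a) = d.
Proof. by move=> ra; have := rk_le (u :: a); rewrite /= ra; case: (_ != 0); lia. Qed.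

(** For [x] with projection [p != 0], almost every [u] has [inner u p != 0], so [u] is integrated
    first. The apex is treated apart: for [rk a = d] all four events are false there; for [rk a < d]
    the cone contains a line, and [x] projects to 0 only if it is orthogonal to that line, a null
    event. *)
Lemma integral_ev_split a k A : (0 < k)%N -> measurable A ->
  (\int[gm R d]_u (Psi (u :: a) k A + Psi ((- u)%R :: a) k A) =
   Psi a k A + \int[gm R d]_u Psi (u :: (- u)%R :: a) k A)%E.
Proof.
move=> k0 mA.
have mev (g : seq (vec * vec -> vec)) : all_meas g ->
    measurable_fun setT (fun t : vec * vec => ind R (ev [seq h t | h <- g] k A t.2)).
  by move=> mg; apply: measurable_ind; exact: mset_ev.
pose ca := [seq (fun _ : vec * vec => v) | v <- a].
have mca : all_meas ca by exact: all_meas_cst.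
have mN : measurable_fun setT (fun t : vec * vec => - t.1) by exact: measurable_oppmx.
have m1 : measurable_fun setT (fun t : vec * vec => ind R (ev (t.1 :: a) k A t.2)).
  have := mev (fst :: ca) (conj measurable_fst mca).
  by under eq_fun do rewrite /= map_cst.
have m2 : measurable_fun setT (fun t : vec * vec => ind R (ev ((- t.1)%R :: a) k A t.2)).
  have := mev ((fun t => - t.1) :: ca) (conj mN mca).
  by under eq_fun do rewrite /= map_cst.
have m3 : measurable_fun setT (fun t : vec * vec => ind R (ev a k A t.2)).
  by have := mev ca mca; under eq_fun do rewrite /= map_cst.
have m4 : measurable_fun setT (fun t : vec * vec => ind R (ev (t.1 :: (- t.1)%R :: a) k A t.2)).
  have := mev (fst :: (fun t => - t.1) :: ca) (conj measurable_fst (conj mN mca)).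
  by under eq_fun do rewrite /= map_cst.
pose F (t : vec * vec) := (ind R (ev (t.1 :: a) k A t.2) + ind R (ev ((- t.1)%R :: a) k A t.2))%E.
pose G (t : vec * vec) := (ind R (ev a k A t.2) + ind R (ev (t.1 :: (- t.1)%R :: a) k A t.2))%E.
have mF : measurable_fun setT F by exact: emeasurable_funD.
have mG : measurable_fun setT G by exact: emeasurable_funD.
have F0 t : (0 <= F t)%E by rewrite adde_ge0// ind_ge0.
have G0 t : (0 <= G t)%E by rewrite adde_ge0// ind_ge0.
have i0 (P : vec -> Prop) (x : vec) : setT x -> (0 <= ind R (P x))%E by move=> _; exact: ind_ge0.
have mx (H : vec * vec -> \bar R) u : measurable_fun setT H ->
    measurable_fun setT (fun x => H (u, x)).
  by move=> mH; exact: (measurableT_comp mH (pair1_measurable u)).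
have mu (H : vec * vec -> \bar R) x : measurable_fun setT H ->
    measurable_fun setT (fun u => H (u, x)).
  by move=> mH; exact: (measurableT_comp mH (pair2_measurable x)).
transitivity (\int[gm R d]_u \int[gm R d]_x F (u, x))%E.
  apply: eq_integral => u _.
  by rewrite (ge0_integralD _ measurableT (i0 _) (mx _ u m1) (i0 _) (mx _ u m2)).
transitivity (\int[gm R d]_u \int[gm R d]_x G (u, x))%E; last first.
  transitivity (\int[gm R d]_u (Psi a k A + Psi (u :: (- u)%R :: a) k A))%E.
    apply: eq_integral => u _.
    by rewrite (ge0_integralD _ measurableT (i0 _) (mx _ u m3) (i0 _) (mx _ u m4)).
  rewrite ge0_integralD//.
  - rewrite integral_cst//; congr (_ + _)%E; rewrite -[RHS]mule1; congr (_ * _)%E.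
    exact: (@probability_setT _ _ _ (gm R d)).
  - by move=> u _; exact: Psi_ge0.
  - by move=> u _; exact: Psi_ge0.
  - exact: (measurable_fun_fubini_tonelli_F (m2 := gm R d) _ m4 (fun=> ind_ge0 R _)).
have fubF := fubini_tonelli (m1 := gm R d) (m2 := gm R d) F mF F0.
have fubG := fubini_tonelli (m1 := gm R d) (m2 := gm R d) G mG G0.
apply: (eq_trans fubF); apply: (eq_trans _ (esym fubG)) => {fubF fubG}.
have good x p : isproj (cone a) x p -> p != 0 \/ rk a = d ->
    (\int[gm R d]_u F (u, x) = \int[gm R d]_u G (u, x))%E.
  move=> pp; have [p0|p0] := eqVneq p 0.
    rewrite p0 in pp => -[//|ra]; apply: eq_integral => u _.
    have sub b : (forall z, cone b z -> cone a z) -> rk b = d -> ind R (ev b k A x) = 0%E.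
      by move=> ba rb; apply: ind_false; exact: (ev_vertex k0 rb ba pp).
    rewrite /F /G /= !sub//.
    - by move=> z /and3P[_ _].
    - exact/rk_consd/rk_consd.
    - by move=> z /andP[_].
    - exact/rk_consd.
    - by move=> z /andP[_].
    - exact/rk_consd.
  move=> _; apply: (@eq_integral_null _ _ _ _ (fun u => inner p u = 0)).
  - by apply: mset_eq => //; exact: measurable_inner.
  - exact: gm_hyperplane0.
  - exact: mu.
  - exact: mu.
  by move=> u /eqP pu; rewrite /F /G /=; apply: (ev_split k A pp); rewrite innerC.
have [ra|ra] := eqVneq (rk a) d.
  apply: eq_integral => x _; have [p pp] := isproj_cone_exists a x.
  by apply: (good x p pp); right.
have [z z0 az] : exists2 z, z != 0 & perp a z by apply: perp_lt; rewrite ltn_neqAle ra rk_le.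
apply: (@eq_integral_null _ _ _ _ (fun x => inner z x = 0)).
- by apply: mset_eq => //; exact: measurable_inner.
- exact: gm_hyperplane0.
- exact: (measurable_fun_fubini_tonelli_G (m1 := gm R d) _ mF F0).
- exact: (measurable_fun_fubini_tonelli_G (m1 := gm R d) _ mG G0).
move=> x zx; have [p pp] := isproj_cone_exists a x.
apply: (good x p pp); left; apply: contra_notN zx => /eqP p0.
have [_ Hp _] := pp; rewrite p0 subr0 in Hp.
have le0 y : perp a y -> inner x y <= 0.
  by move=> /perpP ay; apply: Hp; apply/coneP => v /ay ->.
by apply/eqP; rewrite innerC eq_le le0// -oppr_le0 -innerNr le0//; exact: perpN.
Qed.

End hyperplane_sections.

(** * Faces of a hyperplane section and their mean contribution *)

Section crofton.
Variables (R : realType) (d : nat).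
Notation vec := 'rV[R]_d.
Implicit Types (a s : seq vec) (u v w x y z p q : vec) (A : set vec).

Definition polar a n := forall z, cone a z -> inner n z <= 0.

Lemma polarP a n : polar a n <-> isproj (cone a) n 0.
Proof.
split=> [pn|[_ + _]]; last by rewrite subr0.
split; rewrite ?subr0 ?inner0r//.
by apply/coneP => v _; rewrite inner0r.
Qed.

(** Polarity means that the projection is 0, which is detected by comparing distances to finitely
    many candidates; the quantifier over the cone disappears and measurability becomes visible. *)
Lemma polar_dist a n : polar a n <->
  forall m : (size a).-tuple bool, cone a (pr (mask m a) n) ->
    inner n n <= inner (n - pr (mask m a) n) (n - pr (mask m a) n).
Proof.
split=> [/polarP pn m cm|H].
  have := isproj_dist pn cm; rewrite subr0 => h; apply: le_trans h.
  by rewrite lerDl inner_ge0.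
apply/polarP; have [p pp] := isproj_cone_exists a n; have [m [am _]] := act_mask a p.
have pE : p = pr (mask m a) n by rewrite -am; exact: isproj_pr_act.
have := H m; rewrite -pE => /(_ (let: And3 h _ _ := pp in h)) le1.
have c0 : cone a 0 by apply/coneP => v _; rewrite inner0r.
have := isproj_dist pp c0; rewrite !subr0 => le2.
have : inner p p == 0 by rewrite eq_le inner_ge0 andbT; lra.
by rewrite inner_eq0 => /eqP p0; rewrite -p0.
Qed.

Lemma measurable_pr_cst s : measurable_fun [set: vec] (pr s).
Proof.
have := @measurable_pr R d _ vec [seq (fun _ : vec => v) | v <- s] id (all_meas_cst _ _).
move=> /(_ (@measurable_id _ _ _)); apply: eq_measurable_fun => t _ /=.
by rewrite map_cst.
Qed.

Lemma mset_cone_cst dT (T : measurableType dT) a (f : T -> vec) :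
  measurable_fun setT f -> measurable [set t | cone a (f t)].
Proof.
have := @mset_cone R d _ T [seq (fun _ : T => v) | v <- a] f (all_meas_cst _ _).
move=> + mf => /(_ mf); rewrite (_ : [set t | _] = [set t | cone a (f t)])//.
by apply/seteqP; split=> t /=; rewrite map_cst.
Qed.

Lemma conic_polar a : conic [set n | polar a n].
Proof. by move=> t n t0 pn z /pn nz; rewrite innerZl pmulr_rle0. Qed.

Lemma mset_polar a : measurable [set n : vec | polar a n].
Proof.
rewrite (_ : [set n | _] = [set n | forall m : (size a).-tuple bool,
  cone a (pr (mask m a) n) ->
  inner n n <= inner (n - pr (mask m a) n) (n - pr (mask m a) n)]).
  have mpr (m : seq bool) : measurable_fun [set: vec] (pr (mask m a)).
    exact: measurable_pr_cst.
  apply: mset_forall => m; apply: mset_imply.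
    exact: mset_cone_cst.
  apply: mset_le; apply: measurable_inner => //; apply: measurable_addmx => //;
  exact: measurable_oppmx.
by apply/seteqP; split=> n /polar_dist.
Qed.

(* [q] lies in [A] and in the relative interior of the face of [cone a] whose
   active constraints are selected by the mask [m]. *)
Definition relint a A (m : (size a).-tuple bool) q :=
  [/\ A q, cone a q & forall i : 'I_(size a), tnth m i = (inner (nth 0 a i) q == 0)].

Arguments relint : clear implicits.

Lemma relint_act a A m q : relint a A m q -> act a q = mask m a.
Proof. by move=> [_ _ /act_maskP]. Qed.

Lemma relint_unique a A (m m' : (size a).-tuple bool) q :
  relint a A m q -> relint a A m' q -> m = m'.
Proof. by move=> [_ _ mi] [_ _ mi']; apply: eq_from_tnth => i; rewrite mi mi'. Qed.

Lemma conic_relint a A (m : (size a).-tuple bool) : conic A -> conic [set q | relint a A m q].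
Proof.
move=> cA t q t0 [Aq aq qi]; split; first exact: cA.
  by apply: coneZ => //; exact: ltW.
by move=> i; rewrite qi innerZr mulf_eq0 (gt_eqF t0).
Qed.

Lemma mset_relint a A (m : (size a).-tuple bool) : measurable A ->
  measurable [set q | relint a A m q].
Proof.
move=> mA; rewrite (_ : [set q | _] = [set q | A q /\ (cone a q /\
  forall i : 'I_(size a), tnth m i = (inner (nth 0 a i) q == 0))]); last first.
  by apply/seteqP; split=> q /= => [[Aq aq qi]|[Aq [aq qi]]].
apply: mset_and => //; apply: mset_and.
  exact: mset_cone_cst.
apply: mset_forall => i; case: (tnth m i).
  rewrite (_ : [set t | _] = [set t | inner (nth 0 a i) t = 0]).
    by apply: mset_eq => //; exact: measurable_inner.
  by apply/seteqP; split=> t /=; [move/esym/eqP|move/eqP/esym].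
rewrite (_ : [set t | _] = [set t | ~ inner (nth 0 a i) t = 0]).
  by apply/mset_not/mset_eq => //; exact: measurable_inner.
by apply/seteqP; split=> t /=; [move/esym/eqP|move/eqP/negbTE ->].
Qed.

(** Once the face is fixed, the event splits into a condition on the component of [x] in its hull
    and one on the component in the complement. *)
Lemma isproj_relint a A (m : (size a).-tuple bool) x q :
  isproj (cone a) x q /\ relint a A m q <->
  [/\ q = pr (mask m a) x, relint a A m q & polar a (x - q)].
Proof.
split=> [[qq rq]|[qE rq pq]].
  split=> //; last by case: qq.
  by rewrite -(relint_act rq); exact: isproj_pr_act.
split=> //; split=> //; first by case: rq.
by rewrite qE pr_res ?pr_perp.
Qed.

Lemma ev_relint a k A x : ev a k A x <-> exists m : (size a).-tuple bool,
  [/\ (rk (mask m a) + k)%N = d, relint a A m (pr (mask m a) x) &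
    polar a (x - pr (mask m a) x)].
Proof.
split=> [[q [qq Aq rq]]|[m [rm rq pq]]].
  have [m [am mi]] := act_mask a q; exists m; rewrite -am.
  have rq' : relint a A m q by split=> //; case: qq.
  by rewrite -(isproj_pr_act qq); split=> //; case: qq.
have [qq _] : isproj (cone a) x (pr (mask m a) x) /\ relint a A m (pr (mask m a) x).
  exact/isproj_relint.
exists (pr (mask m a) x); split=> //; first by case: rq.
by rewrite (relint_act rq).
Qed.

(** Coefficient of [x] along the part of [u] orthogonal to [s]; it is 0 when that part vanishes. *)
Definition pmcoef s u x := inner x (pr s u) / inner (pr s u) (pr s u).

Lemma pr_cons s u x : pr (u :: s) x = pr s x - pmcoef s u x *: pr s u.
Proof. by []. Qed.

(** The residual is [n + c *: u] with [n] orthogonal to the hull of the face. On the section the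
    multiple of [u] disappears, and a direction in [cone a] can be made tangent to the section by a
    multiple of [v], which does not affect its product with [n]. So optimality on the section says
    that [n] is polar to the whole cone. *)
Lemma isproj_pm_relint a A (m : (size a).-tuple bool) u x q :
  pr (mask m a) u != 0 ->
  isproj (cone (u :: - u :: a)) x q /\ relint a A m q <->
  [/\ q = pr (u :: mask m a) x, relint a A m q &
   polar a (x - pr (mask m a) x - pmcoef (mask m a) u x *: (u - pr (mask m a) u))].
Proof.
move=> v0; set J := mask m a; set v := pr J u in v0 *; set c := pmcoef J u x.
set n := x - pr J x - c *: (u - v).
have nq : x - pr (u :: J) x = n + c *: u.
  rewrite pr_cons -/c -/v /n scalerBr !opprB -[RHS]addrA subrK.
  by rewrite addrA addrAC.
have nperp z : perp J z -> inner n z = 0.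
  by move=> Jz; rewrite innerBl innerZl !pr_res// mulr0 subrr.
have vJ : perp J v by exact: pr_perp.
have uv : inner u v = inner v v by rewrite -(inner_pr u vJ).
split=> [[qq rq]|[qE rq pn]].
  have aq := relint_act rq.
  have [] := qq; rewrite cone_pm => -[cq /= uq] Hq xq.
  have qE : q = pr (u :: J) x.
    by rewrite (isproj_pr_act qq) !act_cons0 ?innerNl ?uq ?oppr0// aq pr_pm.
  split=> // z az.
  (* [v] is orthogonal to the active constraints, so [z'] is as admissible at [q] as [z], and it is
     tangent to the hyperplane of [u]. *)
  pose z' := z + (- inner u z / inner u v) *: v.
  have uz' : inner u z' = 0.
    by rewrite innerDr innerZr divfK ?subrr// uv inner_eq0.
  have [w wa wq|e e0 He] := @cone_perturb _ _ a q z' cq.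
    have Jw : w \in J by rewrite /J -aq mem_act wq eqxx.
    rewrite innerDr innerZr; have /perpP/(_ _ Jw) -> := vJ.
    by rewrite mulr0 addr0; have /coneP := az; exact.
  have : inner (x - q) (q + e *: z') <= 0.
    apply: Hq; split; first by apply: He; rewrite lexx ltW.
    by rewrite /= innerDr innerZr uq uz' mulr0 addr0.
  rewrite innerDr innerZr xq add0r pmulr_rle0// qE nq innerDl innerZl uz' mulr0 addr0.
  by rewrite innerDr innerZr (nperp v vJ) mulr0 addr0.
have /andP[/eqP uq _] := pr_perp (u :: J) x.
split=> //; split=> //.
- by rewrite cone_pm; split; [case: rq|rewrite qE].
- by rewrite cone_pm => z [az uz]; rewrite qE nq innerDl innerZl uz mulr0 addr0; exact: pn.
- by rewrite qE pr_res// pr_perp.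
Qed.

(** For [u] outside the spans of the proper active families, the rank of the active constraints
    grows by one, so a k-face of the section comes from a (k+1)-face. Rank [d] is excluded because
    [k > 0]. *)
Lemma ev_pm_relint a k A u x : (0 < k)%N ->
  (forall m : (size a).-tuple bool, (rk (mask m a) < d)%N -> pr (mask m a) u != 0) ->
  ev (u :: - u :: a) k A x <-> exists m : (size a).-tuple bool,
  [/\ (rk (mask m a) + k.+1)%N = d, relint a A m (pr (u :: mask m a) x) &
    polar a (x - pr (mask m a) x - pmcoef (mask m a) u x *: (u - pr (mask m a) u))].
Proof.
move=> k0 gu; split=> [[q [qq Aq rq]]|[m [rm rq pq]]].
  have [m [am mi]] := act_mask a q; exists m.
  have uq : inner u q = 0 by case: qq; rewrite cone_pm => -[].
  move: rq; rewrite !act_cons0 ?innerNl ?uq ?oppr0// rk_pm am => rq.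
  have rq' : relint a A m q by split=> //; case: qq; rewrite cone_pm => -[].
  have rd : (rk (mask m a) < d)%N.
    rewrite ltn_neqAle rk_le andbT; apply/eqP => rd.
    by move: rq; rewrite rk_consd//; lia.
  have /(isproj_pm_relint A) H := gu m rd.
  have [<- _ pn] := (H x q).1 (conj qq rq').
  by split=> //; move: rq; rewrite /= (gu m rd); lia.
have rd : (rk (mask m a) < d)%N by lia.
have /(isproj_pm_relint A) H := gu m rd.
have [qq _] := (H x _).2 (And3 erefl rq pq).
exists (pr (u :: mask m a) x); split=> //; first by case: rq.
have /andP[/eqP uq _] := pr_perp (u :: mask m a) x.
rewrite !act_cons0 ?innerNl ?uq ?oppr0// rk_pm (relint_act rq) /= (gu m rd); lia.
Qed.

Lemma ind_exists_unique (I : finType) (P : I -> Prop) :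
  (forall i j, P i -> P j -> i = j) -> ind R (exists i, P i) = (\sum_i ind R (P i))%E.
Proof.
move=> uP; have [[i Pi]|nP] := pselect (exists i, P i).
  rewrite ind_true; last by exists i.
  rewrite (bigD1 i)//= ind_true// big1 ?adde0// => j ji.
  by rewrite ind_false// => Pj; rewrite (uP _ _ Pj Pi) eqxx in ji.
rewrite ind_false// big1// => i _; rewrite ind_false// => Pi; apply: nP.
by exists i.
Qed.

End crofton.
Arguments relint {R d} a A m q.

Section crofton_integral.
Variables (R : realType) (d : nat).
Notation vec := 'rV[R]_d.

Lemma frame_blocks l r (E0 : 'M[R]_(l, d)) (E : 'M[R]_(r, d)) :
  col_mx E0 E *m (col_mx E0 E)^T = 1%:M ->
  [/\ E0 *m E0^T = 1%:M, E0 *m E^T = 0, E *m E0^T = 0 & E *m E^T = 1%:M].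
Proof.
by rewrite tr_col_mx mul_col_row scalar_mx_block => /eq_block_mx[-> -> -> ->].
Qed.

(** In a frame adapted to [J] write u = (v, w) and x = (y, z). The event asks for the residual of y
    along v in [B'] and for z - c w in [N'], with c a function of v and y. For fixed v and y,
    [gm_cone_combination] frees the second probability from c; then [gm_cone_projection] evaluates
    the first. *)
Lemma crofton_product (J : seq vec) (B N : set vec) :
  (rk J + 1 < d)%N -> measurable B -> conic B -> measurable N -> conic N ->
  (\int[gm R d]_u \int[gm R d]_x
     ind R (B (pr (u :: J) x) /\
            N (x - pr J x - pmcoef J u x *: (u - pr J u))%R) =
   \int[gm R d]_x ind R (B (pr J x) /\ N (x - pr J x)%R))%E.
Proof.
move=> rJ mB cB mN cN.
have [l [r [E0 [E [rE lr QQ prE xE]]]]] := orthonormal_frame J.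
have [E00 E0E EE0 EE] := frame_blocks QQ.
have l1 : (1 < l)%N by lia.
pose B' := [set y : 'rV[R]_l | B (y *m E0)].
pose N' := [set z : 'rV[R]_r | N (z *m E)].
have mB' : measurable B' by apply: measurable_set_comp => //; exact: measurable_mulmx_cst.
have mN' : measurable N' by apply: measurable_set_comp => //; exact: measurable_mulmx_cst.
have cB' : conic B' by move=> t y t0 By; rewrite /B' /= -scalemxAl; exact: cB.
have cN' : conic N' by move=> t y t0 By; rewrite /N' /= -scalemxAl; exact: cN.
have prJ y z : pr J (y *m E0 + z *m E) = y *m E0.
  by rewrite prE mulmxDl -(mulmxA y) -(mulmxA z) E00 EE0 mulmx1 mulmx0 addr0.
have inn y z v : inner (y *m E0 + z *m E) (v *m E0) = inner y v.
  by rewrite !innerE trmx_mul mulmxA mulmxDl -(mulmxA y) -(mulmxA z) E00 EE0 mulmx1 mulmx0 addr0.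
have inn0 y v : inner (y *m E0) (v *m E0) = inner y v.
  by have := inn y 0 v; rewrite mul0mx addr0.
have mpr : measurable_fun setT (pr J) by exact: measurable_pr_cst.
have mP : measurable_fun setT (fun p : vec * vec => pr (p.1 :: J) p.2).
  have := @measurable_pr R d _ (vec * vec)%type (fst :: [seq (fun _ => v) | v <- J]) snd
    (conj measurable_fst (all_meas_cst _ _)) measurable_snd.
  by apply: eq_measurable_fun => t _ /=; rewrite map_cst.
have mp1 : measurable_fun setT (fun p : vec * vec => pr J p.1) by exact: measurableT_comp.
have mp2 : measurable_fun setT (fun p : vec * vec => pr J p.2) by exact: measurableT_comp.
have msub dT (T : measurableType dT) n (f g : T -> 'rV[R]_n) :
    measurable_fun setT f -> measurable_fun setT g -> measurable_fun setT (fun t => f t - g t).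
  by move=> mf mg; apply: measurable_addmx => //; exact: measurable_oppmx.
have mn : measurable_fun setT (fun p : vec * vec =>
    p.2 - pr J p.2 - pmcoef J p.1 p.2 *: (p.1 - pr J p.1)).
  apply: (@msub); first exact: (@msub).
  apply: measurable_scalemx; last exact: (@msub).
  apply: measurable_funM; first exact: measurable_inner.
  by apply: measurableT_comp; [exact: measurable_invr|exact: measurable_inner].
pose H (p : vec * vec) := ind R (B (pr (p.1 :: J) p.2) /\
  N (p.2 - pr J p.2 - pmcoef J p.1 p.2 *: (p.1 - pr J p.1))).
have mH : measurable_fun setT H.
  by apply: measurable_ind; apply: mset_and; exact: measurable_set_comp.
have H0 p : (0 <= H p)%E by exact: ind_ge0.
have HE v w y z : H (v *m E0 + w *m E, y *m E0 + z *m E) =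
    (ind R (B' (pr [:: v] y)) * ind R (N' (z - pmcoef [::] v y *: w)%R))%E.
  rewrite -ind_and /H /= /pmcoef /= !prJ inn inn0; apply: ind_iff.
  rewrite /B' /N' /= !mulmxBl -!scalemxAl.
  by rewrite !(addrAC _ (_ *m E)) !subrr !add0r (addrC (- (_ *: (w *m E)))).
pose gB := (\int[gm R l]_y ind R (B' y))%E.
pose gN := (\int[gm R r]_z ind R (N' z))%E.
have gN0 : (0 <= gN)%E by apply: integral_ge0 => z _; exact: ind_ge0.
transitivity (gN * gB)%E; last first.
  have mR : measurable_fun setT (fun x => ind R (B (pr J x) /\ N (x - pr J x))).
    apply: measurable_ind; apply: mset_and; apply: measurable_set_comp => //.
    exact: (@msub).
  rewrite (integral_gm_frame lr QQ mR (fun=> ind_ge0 R _)).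
  rewrite -ge0_integralZl//; last 2 first.
  - exact: measurable_ind.
  - by move=> y _; exact: ind_ge0.
  apply: eq_integral => y _; rewrite muleC -ge0_integralZl//; last 3 first.
  - exact: measurable_ind.
  - by move=> z _; exact: ind_ge0.
  - exact: ind_ge0.
  apply: eq_integral => z _; rewrite -ind_and; apply: ind_iff.
  by rewrite prJ addrAC subrr add0r.
have mF := measurable_fun_fubini_tonelli_F (m2 := gm R d) _ mH H0.
have F0 u : (0 <= \int[gm R d]_x H (u, x))%E by apply: integral_ge0.
apply: (eq_trans (integral_gm_frame lr QQ mF F0)).
have mpv := @measurable_pr R l _ ('rV[R]_l * 'rV[R]_l)%type [:: fst] snd
  (conj measurable_fst I) measurable_snd.
have mBv := measurable_ind R (measurable_set_comp mpv mB').
rewrite /gB -(gm_cone_projection l1 mB' cB') -ge0_integralZl//; last 2 first.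
- exact: (measurable_fun_fubini_tonelli_F (m2 := gm R l) _ mBv (fun=> ind_ge0 R _)).
- by move=> v _; apply: integral_ge0 => y _; exact: ind_ge0.
apply: eq_integral => v _.
pose K (p : 'rV[R]_r * 'rV[R]_l) :=
  (\int[gm R r]_z H (v *m E0 + p.1 *m E, p.2 *m E0 + z *m E)%R)%E.
have mK3 : measurable_fun setT (fun q : 'rV[R]_r * 'rV[R]_l * 'rV[R]_r =>
    H (v *m E0 + q.1.1 *m E, q.1.2 *m E0 + q.2 *m E)).
  apply: (measurableT_comp mH); apply/measurable_fun_pair; apply: measurable_addmx => //;
    apply: measurable_mulmx_cst => //; exact: measurableT_comp.
have mK : measurable_fun setT K.
  exact: (measurable_fun_fubini_tonelli_F (m2 := gm R r) _ mK3 (fun=> H0 _)).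
have K0 p : (0 <= K p)%E by apply: integral_ge0.
transitivity (\int[gm R r]_w \int[gm R l]_y K (w, y))%E.
  apply: eq_integral => w _.
  exact: (integral_gm_frame lr QQ (measurableT_comp mH (pair1_measurable _)) (fun=> H0 _)).
(* After this exchange [v] and [y], which determine the coefficient, are fixed while [w] and [z] are
   integrated. *)
apply: (eq_trans (fubini_tonelli (m1 := gm R r) (m2 := gm R l) K mK K0)).
have mBvv := measurableT_comp mBv (pair1_measurable v).
rewrite -ge0_integralZl//; last by move=> y _; exact: ind_ge0.
apply: eq_integral => y _.
have mw dT (T : measurableType dT) (f g : T -> 'rV[R]_r) :
    measurable_fun setT f -> measurable_fun setT g ->
    measurable_fun setT (fun t => ind R (N' (f t - pmcoef [::] v y *: g t))).
  move=> mf mg; apply: measurable_ind; apply: measurable_set_comp => //.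
  by apply: (@msub) => //; exact: measurable_scalemx.
have mN2 := mw _ ('rV[R]_r * 'rV[R]_r)%type snd fst measurable_snd measurable_fst.
rewrite muleC /gN -(gm_cone_combination (pmcoef [::] v y) mN' cN').
rewrite -ge0_integralZl//; last 3 first.
- exact: (measurable_fun_fubini_tonelli_F (m2 := gm R r) _ mN2 (fun=> ind_ge0 R _)).
- by move=> w _; apply: integral_ge0 => z _; exact: ind_ge0.
- exact: ind_ge0.
apply: eq_integral => w _; rewrite -ge0_integralZl//; last 3 first.
- exact: (mw _ _ id (cst w)).
- by move=> z _; exact: ind_ge0.
- exact: ind_ge0.
by apply: eq_integral => z _; rewrite HE.
Qed.

Lemma null_exists dT (T : measurableType dT) (mu : {measure set T -> \bar R})
    (I : finType) (P : I -> T -> Prop) :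
  (forall i, measurable [set t | P i t]) -> (forall i, mu [set t | P i t] = 0%E) ->
  mu [set t | exists i, P i t] = 0%E.
Proof.
move=> mP P0; have mi i := measurable_ind R (mP i).
apply/eqP; rewrite eq_le measure_ge0 andbT -(integral_ind mu (mset_exists mP)).
apply: (@le_trans _ _ (\int[mu]_t \sum_i ind R (P i t))%E).
  apply: ge0_le_integral => //.
  - by move=> t _; exact: ind_ge0.
  - exact/measurable_ind/mset_exists.
  - exact: emeasurable_sum.
  move=> t _; have [[i Pi]|nP] := pselect (exists i, P i t); last first.
    by rewrite ind_false// sume_ge0// => i _; exact: ind_ge0.
  rewrite (bigD1 i)//= ind_true; last by exists i.
  by rewrite ind_true// leeDl// sume_ge0// => j _; exact: ind_ge0.
rewrite ge0_integral_sum//; last by move=> i t _; exact: ind_ge0.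
by rewrite big1// => i _; rewrite integral_ind.
Qed.

Lemma gm_pr_eq0 (J : seq vec) : (rk J < d)%N -> gm R d [set u | pr J u = 0] = 0%E.
Proof.
move=> /perp_lt[z z0 Jz]; apply/eqP; rewrite -measure_le0 -(gm_hyperplane0 z0).
rewrite le_measure ?inE//.
- by apply: mset_eq0; exact: measurable_pr_cst.
- by apply: mset_eq => //; exact: measurable_inner.
- by move=> x /= x0; rewrite innerC -(inner_pr x Jz) x0 inner0l.
Qed.

(** Both sides are sums over masks, at most one of which can hold; the term of a (k+1)-face on the
    right and that of its section on the left are equated by [crofton_product]. *)
Lemma integral_Psi_pm (a : seq vec) k (A : set vec) :
  (0 < k)%N -> measurable A -> conic A ->
  (\int[gm R d]_u Psi (u :: (- u)%R :: a) k A = Psi a k.+1 A)%E.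
Proof.
move=> k0 mA cA.
pose T := (size a).-tuple bool.
pose K (m : T) := (rk (mask m a) + k.+1)%N = d.
pose H (m : T) (p : vec * vec) := ind R (K m /\ (relint a A m (pr (p.1 :: mask m a) p.2) /\
  polar a (p.2 - pr (mask m a) p.2 -
     pmcoef (mask m a) p.1 p.2 *: (p.1 - pr (mask m a) p.1)))).
pose G (m : T) (x : vec) := ind R (K m /\ (relint a A m (pr (mask m a) x) /\
  polar a (x - pr (mask m a) x))).
have mrel (m : T) := mset_relint m mA.
have mpr (m : T) : measurable_fun setT (pr (mask m a)) by exact: measurable_pr_cst.
have msub dT (S : measurableType dT) n (f g : S -> 'rV[R]_n) :
    measurable_fun setT f -> measurable_fun setT g -> measurable_fun setT (fun t => f t - g t).
  by move=> mf mg; apply: measurable_addmx => //; exact: measurable_oppmx.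
have mcst dT (S : measurableType dT) (P : Prop) : measurable [set _ : S | P].
  have [p|p] := pselect P.
    by rewrite (_ : [set _ | _] = setT)//; apply/seteqP; split.
  by rewrite (_ : [set _ | _] = set0)//; apply/seteqP; split.
have mG m : measurable_fun setT (G m).
  apply: measurable_ind; apply: mset_and; first exact: mcst.
  apply: mset_and; first exact: (measurable_set_comp _ (mrel m)).
  by apply: (measurable_set_comp _ (mset_polar a)); exact: (@msub).
have mH m : measurable_fun setT (H m).
  have mp1 : measurable_fun setT (fun p : vec * vec => pr (mask m a) p.1) by exact: measurableT_comp.
  have mp2 : measurable_fun setT (fun p : vec * vec => pr (mask m a) p.2) by exact: measurableT_comp.
  apply: measurable_ind; apply: mset_and; first exact: mcst.
  apply: mset_and.
    apply: (measurable_set_comp _ (mrel m)).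
    have := @measurable_pr R d _ (vec * vec)%type (fst :: [seq (fun _ => v) | v <- mask m a]) snd
      (conj measurable_fst (all_meas_cst _ _)) measurable_snd.
    by apply: eq_measurable_fun => t _ /=; rewrite map_cst.
  apply: (measurable_set_comp _ (mset_polar a)); apply: (@msub); first exact: (@msub).
  apply: measurable_scalemx; last exact: (@msub).
  apply: measurable_funM; first exact: measurable_inner.
  by apply: measurableT_comp; [exact: measurable_invr|exact: measurable_inner].
have H0 m p : (0 <= H m p)%E by exact: ind_ge0.
have G0 m p : (0 <= G m p)%E by exact: ind_ge0.
have PsiE : Psi a k.+1 A = (\sum_(m : T) \int[gm R d]_x G m x)%E.
  rewrite -ge0_integral_sum//; apply: eq_integral => x _.
  rewrite -ind_exists_unique; last first.
    move=> m m' [Km [Rm Pm]] [Km' [Rm' Pm']].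
    have [qm _] := (isproj_relint A m x _).2 (And3 erefl Rm Pm).
    have [qm' _] := (isproj_relint A m' x _).2 (And3 erefl Rm' Pm').
    by rewrite -(isproj_unique qm qm') in Rm'; exact: relint_unique Rm Rm'.
  apply: ind_iff; rewrite ev_relint.
  by split=> [[m [? ? ?]]|[m [? [? ?]]]]; exists m.
(* Outside this null event [u] lies in no span of a subfamily of rank below [d], as [ev_pm_relint]
   requires. *)
pose N (u : vec) := exists m : T, (rk (mask m a) < d)%N /\ pr (mask m a) u = 0.
have mN : measurable [set u | N u].
  apply: mset_exists => m; apply: mset_and; first exact: mcst.
  exact: mset_eq0.
have N0 : gm R d [set u | N u] = 0%E.
  apply: null_exists => m; first by apply: mset_and; [exact: mcst|exact: mset_eq0].
  have [rd|rd] := boolP (rk (mask m a) < d)%N.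
    by rewrite -[RHS](gm_pr_eq0 rd); congr (gm R d _); apply/seteqP; split=> [u []|u].
  by rewrite -[RHS](measure0 (gm R d)); congr (gm R d _); apply/seteqP; split=> [u []|u].
transitivity (\int[gm R d]_u \sum_(m : T) \int[gm R d]_x H m (u, x))%E.
  have mHi m := measurable_fun_fubini_tonelli_F (m2 := gm R d) _ (mH m) (H0 m).
  apply: (eq_integral_null mN N0).
  - have := @measurable_Psi R d _ vec (id :: -%R :: [seq (fun _ => v) | v <- a]) k A mA
      (conj (@measurable_id _ _ _) (conj (measurable_oppmx (@measurable_id _ _ _)) (all_meas_cst _ _))).
    by apply: eq_measurable_fun => u _ /=; rewrite map_cst.
  - exact: emeasurable_sum.
  move=> u nu; rewrite -ge0_integral_sum//; last first.
    by move=> m; exact: (measurableT_comp (mH m) (pair1_measurable u)).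
  have gu (m : T) : (rk (mask m a) < d)%N -> pr (mask m a) u != 0.
    by move=> rd; apply/eqP => u0; apply: nu; exists m.
  apply: eq_integral => x _; rewrite -ind_exists_unique; last first.
    move=> m m' [Km [Rm Pm]] [Km' [Rm' Pm']].
    have gm_ : pr (mask m a) u != 0 by apply: gu; move: Km; rewrite /K; lia.
    have gm' : pr (mask m' a) u != 0 by apply: gu; move: Km'; rewrite /K; lia.
    have [qm _] := (@isproj_pm_relint _ _ a A m u x _ gm_).2 (And3 erefl Rm Pm).
    have [qm' _] := (@isproj_pm_relint _ _ a A m' u x _ gm').2 (And3 erefl Rm' Pm').
    apply: (relint_unique Rm).
    by move: (isproj_unique qm qm') Rm' => /= ->.
  apply: ind_iff; rewrite (ev_pm_relint _ _ _ gu)//.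
  by split=> [[m [? ? ?]]|[m [? [? ?]]]]; exists m.
rewrite PsiE ge0_integral_sum//; last first.
- by move=> m u _; apply: integral_ge0.
- by move=> m; exact: (measurable_fun_fubini_tonelli_F (m2 := gm R d) _ (mH m) (H0 m)).
apply: eq_bigr => m _; have [Km|Km] := pselect (K m); last first.
  transitivity (\int[gm R d]_u cst (0 : \bar R) u)%E.
    apply: eq_integral => u _; rewrite -[RHS](integral0 (gm R d) setT).
    by apply: eq_integral => x _; rewrite /H ind_false// => -[].
  by apply: eq_integral => u _; rewrite /G ind_false// => -[].
have rJ : (rk (mask m a) + 1 < d)%N.
  by apply: leq_trans (eq_leq Km); rewrite -addnS leq_add2l.
have := crofton_product rJ (mrel m) (@conic_relint _ _ a A m cA) (mset_polar a) (@conic_polar _ _ a).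
move=> E; transitivity (\int[gm R d]_u \int[gm R d]_x ind R
     (relint a A m (pr (u :: mask m a) x) /\
      polar a (x - pr (mask m a) x - pmcoef (mask m a) u x *: (u - pr (mask m a) u))%R))%E.
  apply: eq_integral => u _; apply: eq_integral => x _; apply: ind_iff.
  by split=> [[]|].
apply: (eq_trans E); apply: eq_integral => x _; apply: ind_iff.
by split=> [|[]].
Qed.

End crofton_integral.

(** * Summing over the cells of n hyperplanes *)

Section signed_sum.
Variables (R : realType) (d : nat).
Notation vec := 'rV[R]_d.
Implicit Types (a us : seq vec) (A : set vec).

(* The sum of [Psi] over the intersections of [cone a] with the closed cells
   cut out by the hyperplanes orthogonal to the vectors of [us]. *)
Fixpoint cell_sum us a k A : \bar R :=
  if us is u :: us' then (cell_sum us' (u :: a) k A + cell_sum us' ((- u)%R :: a) k A)%E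
  else Psi a k A.

Lemma cell_sum_ge0 us a k A : (0 <= cell_sum us a k A)%E.
Proof.
by elim: us a => [|u us IH] a /=; [exact: Psi_ge0|rewrite adde_ge0].
Qed.

Lemma measurable_cell_sum dT (T : measurableType dT) (g h : seq (T -> vec)) k A :
  measurable A -> all_meas g -> all_meas h ->
  measurable_fun setT (fun t => cell_sum [seq f t | f <- g] [seq f t | f <- h] k A).
Proof.
move=> mA; elim: g h => [|f g IH] h; first by move=> _; exact: measurable_Psi.
move=> [mf mg] mh; apply: emeasurable_funD; first exact: (IH (f :: h)).
apply: (IH ((fun t => - f t) :: h)) => //; split=> //; exact: measurable_oppmx.
Qed.

Lemma measurable_Psi_cons a k A : measurable A ->
  measurable_fun setT (fun u : vec => Psi (u :: a) k A).
Proof.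
move=> mA; have := @measurable_Psi R d _ vec (id :: [seq (fun _ => v) | v <- a]) k A mA
  (conj (@measurable_id _ _ _) (all_meas_cst _ _)).
by apply: eq_measurable_fun => u _ /=; rewrite map_cst.
Qed.

Lemma measurable_Psi_consN a k A : measurable A ->
  measurable_fun setT (fun u : vec => Psi ((- u)%R :: a) k A).
Proof.
move=> mA; apply: (measurableT_comp (measurable_Psi_cons a k mA)).
exact: measurable_oppmx.
Qed.

Lemma jmeas_cell_sum a k A : measurable A ->
  jmeas (fun (_ : unit) us => cell_sum us a k A).
Proof.
move=> mA dS S phi g _ mg.
have := @measurable_cell_sum _ S g [seq (fun _ => v) | v <- a] k A mA mg (all_meas_cst _ _).
by apply: eq_measurable_fun => t _ /=; rewrite map_cst.
Qed.

Lemma pascal_ereal n (P : nat -> \bar R) : (forall s, 0 <= P s)%E ->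
  (\sum_(s < n.+1) ('C(n, s))%:R%:E * (P s + P s.+1) =
   \sum_(s < n.+2) ('C(n.+1, s))%:R%:E * P s)%E.
Proof.
move=> P0; have c0 m s : (0 <= ('C(m, s))%:R%:E :> \bar R)%E by rewrite lee_fin.
under eq_bigr do rewrite ge0_muleDr//.
rewrite big_split /= [RHS]big_ord_recl /= bin0.
under [in RHS]eq_bigr do rewrite /bump /= add1n binS natrD EFinD ge0_muleDl//.
rewrite [in RHS]big_split /= addeA; congr (_ + _)%E.
rewrite big_ord_recl [in RHS]big_ord_recr /= (@bin_small n n.+1)// mul0e adde0 bin0.
by congr (_ + _)%E; apply: eq_bigr => i _; rewrite /bump /= add1n.
Qed.

(** The induction varies [a]: with the first vector [u] fixed, the hypothesis applies to [u :: a]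
    and [- u :: a]; integrating over [u] replaces order k + s by the orders k + s and k + s + 1, and
    Pascal's rule collects the coefficients. *)
Lemma IT_cell_sum n a k A : (0 < k)%N -> measurable A -> conic A ->
  IT n (fun us => cell_sum us a k A) =
  (\sum_(s < n.+1) ('C(n, s))%:R%:E * Psi a (k + s) A)%E.
Proof.
move=> + mA cA; elim: n a k => [|n IH] a k k0.
  by rewrite big_ord1 bin0 mul1e addn0.
apply: (eq_trans _ (pascal_ereal n (P := fun s => Psi a (k + s) A) (fun s => Psi_ge0 _ _ _))).
rewrite /=.
have c0 m s : (0 <= ('C(m, s))%:R%:E :> \bar R)%E by rewrite lee_fin.
transitivity (\int[gm R d]_u \sum_(s < n.+1) ('C(n, s))%:R%:E *
   (Psi (u :: a) (k + s) A + Psi ((- u)%R :: a) (k + s) A))%E.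
  apply: eq_integral => u _; rewrite ITD; last 4 first.
  - exact: jmeas_cell_sum.
  - by move=> s; exact: cell_sum_ge0.
  - exact: jmeas_cell_sum.
  - by move=> s; exact: cell_sum_ge0.
  rewrite !IH// -big_split /=; apply: eq_bigr => s _.
  exact: (esym (ge0_muleDr _ (Psi_ge0 _ _ _) (Psi_ge0 _ _ _))).
have mPD s : measurable_fun setT (fun u : vec =>
    (Psi (u :: a) (k + s) A + Psi ((- u)%R :: a) (k + s) A)%E).
  by apply: emeasurable_funD; [exact: measurable_Psi_cons|exact: measurable_Psi_consN].
have PD0 s (u : vec) : (0 <= Psi (u :: a) (k + s) A + Psi ((- u)%R :: a) (k + s) A)%E.
  by rewrite adde_ge0// Psi_ge0.
rewrite ge0_integral_sum//; last 2 first.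
- by move=> s; apply: measurable_funeM.
- by move=> s u _; rewrite mule_ge0.
apply: eq_bigr => s _; rewrite ge0_integralZl//.
have ks : (0 < k + s)%N by rewrite addn_gt0 k0.
by rewrite integral_ev_split// integral_Psi_pm// addnS.
Qed.

Lemma Psi_gt a k A : (d < k)%N -> Psi a k A = 0%E.
Proof.
move=> dk; rewrite -[RHS](integral0 (gm R d) setT); apply: eq_integral => x _.
by rewrite ind_false// => -[p [_ _ rp]]; lia.
Qed.

End signed_sum.

(** * Curvature measures as projection probabilities *)

Section subspaces.
Variables (R : realType) (d : nat).
Notation vec := 'rV[R]_d.
Implicit Types (a s J : seq vec) (u v w x y z p q : vec).

Lemma projE J x : Defs.proj [set z | perp J z] x = pr J x.
Proof.
apply: xget_unique => [|p [Jp Hp]]; last exact: pr_unique.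
by split=> [|y]; [exact: pr_perp|exact: pr_res].
Qed.

Lemma orth_perp J y : orth [set z | perp J z] y <-> pr J y = 0.
Proof.
split=> [oy|Jy x Jx]; last by rewrite -(inner_pr y Jx) Jy inner0l.
apply/eqP; rewrite -inner_eq0 inner_pr ?pr_perp//; apply/eqP/oy; exact: pr_perp.
Qed.

Lemma proj_orthE J x : Defs.proj (orth [set z | perp J z]) x = x - pr J x.
Proof.
have Ox : orth [set z | perp J z] (x - pr J x).
  by rewrite orth_perp prB (pr_id (pr_perp _ _)) subrr.
apply: xget_unique => [|p [Jp Hp]].
  split=> // y oy; rewrite opprB addrC subrK innerC; exact/oy/pr_perp.
apply/eqP; rewrite -subr_eq0 -inner_eq0; apply/eqP.
have oD : orth [set z | perp J z] (p - (x - pr J x)).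
  by move=> z zJ; rewrite innerBl (Jp z zJ) (Ox z zJ) subrr.
have := Hp _ oD.
have -> : x - p = pr J x - (p - (x - pr J x)).
  by rewrite opprB addrA addrC [pr J x + _]addrC subrK addrC.
rewrite innerBl => /eqP; rewrite subr_eq0 => /eqP <-.
by rewrite innerC; exact/oD/pr_perp.
Qed.

Lemma lin_hull_range n (v : 'I_n -> vec) x :
  lin_hull (range v) x <-> exists c : 'rV[R]_n, x = c *m \matrix_i v i.
Proof.
have mE (c : 'rV[R]_n) : c *m \matrix_i v i = \sum_i c 0 i *: v i.
  by rewrite mulmx_sum_row; apply: eq_bigr => i _; rewrite rowK.
split=> [[m [c [w [vw ->]]]]|[c ->]].
  have H i : exists j : 'I_n, v j = w i by have [j _ <-] := vw i; exists j.
  pose f i := projT1 (cid (H i)).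
  exists (\sum_i c i *: delta_mx 0 (f i)); rewrite mulmx_suml.
  apply: eq_bigr => i _; rewrite -scalemxAl -rowE rowK; congr (_ *: _).
  by rewrite /f; case: cid.
exists n, (c 0), v; split; first by move=> i; exists i.
exact: mE.
Qed.

(** A free family spanning the complement has the same row space as the frame [E0], hence as many
    members as [E0] has rows. *)
Lemma has_dim_perp J k : has_dim [set x | perp J x] k <-> (rk J + k)%N = d.
Proof.
have [l [r [E0 [E [rE lr QQ prE xE]]]]] := orthonormal_frame J.
have [E00 E0E EE0 EE] := frame_blocks QQ.
have lE : l = \rank E0.
  apply/eqP; rewrite eqn_leq rank_leq_row andbT.
  by have := mxrankM_maxl E0 E0^T; rewrite E00 mxrank1.
have perpE x : perp J x <-> (x <= E0)%MS.
  split=> [Jx|/submxP[D ->]].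
    by rewrite -(pr_id Jx) prE submxMl.
  have <- : pr J (D *m E0) = D *m E0 by rewrite prE -(mulmxA D) E00 mulmx1.
  exact: pr_perp.
suff : has_dim [set x | perp J x] k <-> k = l by move=> ->; lia.
split=> [[v [vfree vL]]|kl].
  pose V := \matrix_i v i.
  have VE0 : (V == E0)%MS.
    apply/andP; split; apply/row_subP => i.
      rewrite rowK; apply/perpE; change ([set x | perp J x] (v i)).
      rewrite vL; apply/lin_hull_range; exists (delta_mx 0 i).
      by rewrite -rowE rowK.
    have : [set x | perp J x] (row i E0) by apply/perpE; exact: row_sub.
    by rewrite vL => /lin_hull_range[c ->]; exact: submxMl.
  rewrite lE -(eqmx_rank VE0); apply/esym/eqP.
  change (row_free V); rewrite -kermx_eq0; apply/rowV0P => c /sub_kermxP cV.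
  apply/rowP => i; rewrite mxE; apply: (vfree (c 0)).
  transitivity (c *m V); last exact: cV.
  by rewrite mulmx_sum_row; apply: eq_bigr => j _; rewrite rowK.
subst k; exists (fun i => row i E0); split.
  move=> c c0 i.
  have c1 : (\row_j c j) *m E0 = 0.
    by rewrite mulmx_sum_row -[RHS]c0; apply: eq_bigr => j _; rewrite mxE.
  have : (\row_j c j) *m E0 *m E0^T = 0 by rewrite c1 mul0mx.
  by rewrite -mulmxA E00 mulmx1 => /rowP/(_ i); rewrite !mxE.
have rowE0 : \matrix_i row i E0 = E0 by apply/row_matrixP => i; rewrite rowK.
apply/seteqP; split=> x /=.
  by move=> /perpE/submxP[c ->]; apply/lin_hull_range; exists c; rewrite rowE0.
by move=> /lin_hull_range[c]; rewrite rowE0 => ->; apply/perpE; exact: submxMl.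
Qed.

Lemma gauss_exp_row (f : vec -> \bar R) : measurable_fun setT f ->
  (forall x, 0 <= f x)%E -> @gauss_exp R 1 d f = (\int[gm R d]_x f x)%E.
Proof.
move=> mf f0; rewrite -gauss_iterE// /gauss_exp mul1n.
apply: eq_gauss_iter => s _; congr f; apply/matrixP => i j; rewrite !mxE.
by rewrite (ord1 i) mul0n.
Qed.

Lemma gamma_perp J (B : set vec) : measurable [set x | B (pr J x)] ->
  gamma [set z | perp J z] B = (\int[gm R d]_x ind R (B (pr J x)))%E.
Proof.
move=> mB; rewrite /gamma -gauss_exp_row; last 2 first.
- exact: measurable_ind.
- by move=> x; exact: ind_ge0.
by congr gauss_exp; apply/funext => x; rewrite indE /= projE.
Qed.

Lemma gamma_orth_perp J (B : set vec) : measurable [set x | B (x - pr J x)] ->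
  gamma (orth [set z | perp J z]) B = (\int[gm R d]_x ind R (B (x - pr J x)%R))%E.
Proof.
move=> mB; rewrite /gamma -gauss_exp_row; last 2 first.
- exact: measurable_ind.
- by move=> x; exact: ind_ge0.
by congr gauss_exp; apply/funext => x; rewrite indE /= proj_orthE.
Qed.

Lemma measurable_res J : measurable_fun [set: vec] (fun x => x - pr J x).
Proof.
apply: measurable_addmx => //; apply: measurable_oppmx.
exact: measurable_pr_cst.
Qed.

(** The two components of a Gaussian vector are functions of its independent coordinates along [E0]
    and along [E]. *)
Lemma gm_perp_indep J (B N : set vec) : measurable B -> measurable N ->
  ((\int[gm R d]_x ind R (B (pr J x))) * (\int[gm R d]_x ind R (N (x - pr J x)%R)) =
   \int[gm R d]_x ind R (B (pr J x) /\ N (x - pr J x)%R))%E.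
Proof.
move=> mB mN.
have [l [r [E0 [E [rE lr QQ prE xE]]]]] := orthonormal_frame J.
have [E00 E0E EE0 EE] := frame_blocks QQ.
have prJ (y : 'rV[R]_l) (z : 'rV[R]_r) : pr J (y *m E0 + z *m E) = y *m E0.
  by rewrite prE mulmxDl -(mulmxA y) -(mulmxA z) E00 EE0 mulmx1 mulmx0 addr0.
have m1 := measurable_ind R (measurable_set_comp (@measurable_pr_cst R d J) mB).
have m2 := measurable_ind R (measurable_set_comp (measurable_res J) mN).
have m3 := measurable_ind R (mset_and (measurable_set_comp (@measurable_pr_cst R d J) mB)
  (measurable_set_comp (measurable_res J) mN)).
rewrite (integral_gm_frame lr QQ m1 (fun=> ind_ge0 R _)).
rewrite (integral_gm_frame lr QQ m2 (fun=> ind_ge0 R _)).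
rewrite (integral_gm_frame lr QQ m3 (fun=> ind_ge0 R _)).
pose gN := (\int[gm R r]_z ind R (N (z *m E)))%E.
have gN0 : (0 <= gN)%E by apply: integral_ge0 => z _; exact: ind_ge0.
have cint n (c : \bar R) : (0 <= c)%E -> (\int[gm R n]_x cst c x = c)%E.
  move=> c0; rewrite integral_cst// -[RHS]mule1; congr (_ * _)%E.
  exact: (@probability_setT _ _ _ (gm R n)).
have mB0 : measurable_fun setT (fun y : 'rV[R]_l => ind R (B (y *m E0))).
  by apply/measurable_ind/measurable_set_comp => //; exact: measurable_mulmx_cst.
have mN0 : measurable_fun setT (fun z : 'rV[R]_r => ind R (N (z *m E))).
  by apply/measurable_ind/measurable_set_comp => //; exact: measurable_mulmx_cst.
transitivity ((\int[gm R l]_y ind R (B (y *m E0))) * gN)%E.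
  congr (_ * _)%E.
    apply: eq_integral => y _; rewrite -[RHS](cint r) ?ind_ge0//.
    by apply: eq_integral => z _; rewrite prJ.
  apply: (eq_trans _ (cint l gN gN0)); apply: eq_integral => y _.
  by apply: eq_integral => z _; rewrite prJ addrAC subrr add0r.
rewrite -ge0_integralZr//; last by move=> y _; exact: ind_ge0.
apply: eq_integral => y _; rewrite -ge0_integralZl//; last 2 first.
- by move=> z _; exact: ind_ge0.
- exact: ind_ge0.
by apply: eq_integral => z _; rewrite prJ addrAC subrr add0r ind_and.
Qed.

End subspaces.

(** * Faces described by masks of active constraints *)

Section faces.
Variables (R : realType) (d : nat).
Notation vec := 'rV[R]_d.
Implicit Types (a s J : seq vec) (u v w x y z p q : vec) (A F : set vec).

Lemma inner_prC s x y : inner (pr s x) y = inner x (pr s y).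
Proof.
by rewrite -(inner_pr x (pr_perp s y)) innerC -(inner_pr y (pr_perp s x)) innerC.
Qed.

(** With redundant constraints several masks cut out the same face; requiring a point whose active
    constraints are exactly those of the mask leaves one mask per face. *)
Definition realized a (m : (size a).-tuple bool) :=
  exists2 p, cone a p & forall i : 'I_(size a), tnth m i = (inner (nth 0 a i) p == 0).

Definition mface a (m : (size a).-tuple bool) : set vec :=
  cone a `&` [set x | perp (mask m a) x].

Arguments realized : clear implicits.
Arguments mface : clear implicits.

(** The sum of the chosen constraints is a supporting vector: its terms are nonpositive on the cone,
    so it vanishes exactly where all of them do. *)
Lemma cone_sum_face a J : {subset J <= a} -> face (cone a) (cone a `&` [set x | perp J x]).
Proof.
move=> Ja; exists (\sum_(v <- J) v).
have innS x : inner (\sum_(v <- J) v) x = \sum_(v <- J) inner v x.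
  by elim/big_rec2: _ => [|i y1 y2 _ <-]; rewrite ?inner0l ?innerDl.
split=> [x /coneP ax|].
  rewrite innS big_seq_cond; apply: sumr_le0 => v /andP[vJ _]; exact/ax/Ja.
apply/seteqP; split=> x [ax /= Jx]; split=> //=.
  by rewrite innS big_seq_cond big1// => v /andP[vJ _]; move/perpP: Jx; exact.
apply/allP => v vJ; move: Jx; rewrite innS => /eqP.
rewrite -oppr_eq0 -sumrN big_seq_cond psumr_eq0; last first.
  by move=> w /andP[wJ _]; rewrite oppr_ge0; move/coneP: ax; apply; exact: Ja.
by move=> /allP/(_ v vJ); rewrite vJ oppr_eq0.
Qed.

(** Adding up, for each constraint that does not vanish on [F], a point where it is strict leaves
    active only the constraints vanishing on all of [F]. *)
Lemma relint_point a (b : seq vec) F : {subset b <= a} -> F `<=` cone a -> F 0 ->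
  (forall x y, F x -> F y -> F (x + y)) ->
  exists2 p, F p & forall v, v \in b -> inner v p = 0 -> forall x, F x -> inner v x = 0.
Proof.
move=> + Fa F0 FD; elim: b => [|w b IH] ba; first by exists 0.
have [p Fp Hp] := IH (fun v vb => ba v (@mem_behead _ (w :: b) v vb)).
have wa : w \in a by apply: ba; rewrite mem_head.
have [[x Fx wx]|nx] := pselect (exists2 x, F x & inner w x <> 0); last first.
  exists p => // v; rewrite inE => /orP[/eqP ->|]; last exact: Hp.
  by move=> _ x Fx; apply: contrapT => wx; apply: nx; exists x.
exists (p + x); first exact: FD.
have le0 v y : v \in a -> F y -> inner v y <= 0 by move=> va /Fa /coneP; exact.
move=> v; rewrite inE => /orP[/eqP ->|vb]; rewrite innerDr => vpx y Fy.
  by exfalso; apply: wx; have := le0 _ _ wa Fp; have := le0 _ _ wa Fx; lra.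
have va : v \in a by apply: ba; rewrite inE vb orbT.
apply: (Hp v) => //.
by have := le0 _ _ va Fp; have := le0 _ _ va Fx; lra.
Qed.

(** The mask is the active set of a relatively interior point [p]. If [x] satisfies these
    equalities, [p - e x] stays in the cone for small e, which forces the supporting functional to
    vanish at [x]. *)
Lemma face_mface a F : face (cone a) F -> exists2 m, realized a m & F = mface a m.
Proof.
move=> [y [Hy FE]].
have [||||p Fp Hp] := @relint_point a a F.
- by [].
- by rewrite FE => x [].
- by rewrite FE; split; [apply/coneP => v _; rewrite inner0r|rewrite /= inner0r].
- rewrite FE => x z [ax /= yx] [az /= yz]; split; first exact: coneD.
  by rewrite /= innerDr yx yz addr0.
have ap : cone a p by move: Fp; rewrite FE => -[].
have yp : inner y p = 0 by move: Fp; rewrite FE => -[].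
have [m [am mi]] := act_mask a p; exists m; first by exists p.
rewrite /mface -am; apply/seteqP; split=> x.
  move=> Fx; split; first by move: Fx; rewrite FE => -[].
  by apply/perpP => v; rewrite mem_act => /andP[/eqP vp va]; apply: Hp.
move=> [ax /perpP /= Jx]; rewrite FE; split=> //=; apply/eqP; rewrite eq_le Hy//=.
have [v va vp|e e0 He] := @cone_perturb _ _ a p (- x) ap.
  by rewrite innerNr Jx ?oppr0// mem_act vp eqxx.
have := Hy _ (He e _); rewrite lexx ltW// => /(_ isT).
by rewrite innerDr innerZr yp add0r innerNr mulrN oppr_le0 pmulr_rge0.
Qed.

(** Every [x] orthogonal to the active constraints is a multiple of the difference of two points of
    the face, [p + e *: x] and [p]. *)
Lemma lin_hull_mface a m : realized a m -> lin_hull (mface a m) = [set x | perp (mask m a) x].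
Proof.
move=> [p ap mi]; have am := act_maskP mi.
apply/seteqP; split=> x /=.
  move=> [n [c [v [vF ->]]]]; apply/perpP => w wJ; rewrite inner_sumr big1// => i _.
  by have [_ /perpP/(_ w wJ) ->] := vF i; rewrite mulr0.
move=> Jx.
have [v va vp|e e0 He] := @cone_perturb _ _ a p x ap.
  by move/perpP: Jx => -> //; rewrite -am mem_act vp eqxx.
have pF : mface a m p by split=> //=; rewrite -am; exact: perp_act.
have qF : mface a m (p + e *: x).
  split; first by apply: He; rewrite lexx ltW.
  by apply: perpD; [case: pF|exact: perpZ].
exists 2%N, (fun i : 'I_2 => if i == ord0 then e^-1 else - e^-1),
  (fun i : 'I_2 => if i == ord0 then p + e *: x else p); split.
  by move=> i; case: ifP.
rewrite big_ord_recl big_ord1 /= scalerDr scalerA mulVf ?lt0r_neq0// scale1r.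
by rewrite scaleNr addrAC subrr add0r.
Qed.

Lemma mface_inj a m m' : realized a m -> realized a m' -> mface a m = mface a m' -> m = m'.
Proof.
move=> [p ap mi] [p' ap' mi'] FE; have am := act_maskP mi; have am' := act_maskP mi'.
apply: eq_from_tnth => i.
have imp b b' q q' (H : forall j : 'I_(size a), tnth b j = (inner (nth 0 a j) q == 0))
    (aq : cone a q) (H' : forall j : 'I_(size a), tnth b' j = (inner (nth 0 a j) q' == 0)) :
    mface a b = mface a b' -> tnth b' i -> tnth b i.
  move=> E; rewrite H' H => i0.
  have : mface a b' q by rewrite -E; split=> //=; rewrite -(act_maskP H); exact: perp_act.
  move=> [_ /perpP /= /(_ (nth 0 a i))]; rewrite -(act_maskP H') mem_act i0 mem_nth//.
  by move=> /(_ isT) ->.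
by apply/idP/idP; [exact: (imp m' m p' p)|exact: (imp m m' p p')].
Qed.

Lemma normal_cone_mface a m x : normal_cone (cone a) (mface a m) (x - pr (mask m a) x) <->
  polar a (x - pr (mask m a) x).
Proof.
split=> [[]|pn] //; split=> // z [_ /= Jz]; exact: pr_res.
Qed.

Lemma kfaces_cone a k : kfaces (cone a) k =
  mface a @` [set m | realized a m /\ (rk (mask m a) + k)%N = d].
Proof.
apply/seteqP; split=> F.
  move=> [/face_mface[m rm FE] dF]; exists m => //; split=> //.
  by move: dF; rewrite FE lin_hull_mface// => /has_dim_perp.
move=> [m [rm rk_m] <-]; split; last by rewrite lin_hull_mface//; exact/has_dim_perp.
by apply: cone_sum_face => v /mem_mask.
Qed.

Lemma mset_mface a m : measurable (mface a m).
Proof.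
apply: mset_and; first exact: mset_cone_cst.
rewrite (_ : [set x | _] = [set x | x - pr (mask m a) x = 0]).
  by apply: mset_eq0; exact: measurable_res.
apply/seteqP; split=> x /= => [Jx|/eqP]; first by rewrite pr_id// subrr.
by rewrite subr_eq0 => /eqP ->; exact: pr_perp.
Qed.

(* Only the faces containing [pr J x] in their relative interior matter, since
   the relative boundary of a face is a null set of its linear hull. *)
Lemma integral_mface a m A : measurable A -> realized a m ->
  (\int[gm R d]_x ind R ((mface a m `&` A) (pr (mask m a) x) /\ polar a (x - pr (mask m a) x)%R) =
   \int[gm R d]_x ind R (relint a A m (pr (mask m a) x) /\ polar a (x - pr (mask m a) x)%R))%E.
Proof.
move=> mA [p ap mi]; have am := act_maskP mi.
have mpr := @measurable_pr_cst R d (mask m a).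
have mpol := measurable_set_comp (measurable_res (mask m a)) (mset_polar a).
(* The exceptional event: a constraint outside the mask vanishes at the projection. Being nonzero at
   [p], it cuts the hull in a hyperplane. *)
pose P (i : 'I_(size a)) x := tnth m i = false /\ inner (nth 0 a i) (pr (mask m a) x) = 0.
have mP i : measurable [set x | P i x].
  apply: mset_and; last by apply: mset_eq => //; exact: measurable_inner.
  case: (tnth m i).
    by rewrite (_ : [set _ | _] = set0)//; apply/seteqP; split.
  by rewrite (_ : [set _ | _] = setT)//; apply/seteqP; split.
apply: (@eq_integral_null _ _ _ _ (fun x => exists i, P i x)).
- exact: mset_exists.
- apply: null_exists => // i; have [mi1|mi0] := boolP (tnth m i).
    rewrite -[RHS](measure0 (gm R d)); congr (gm R d _).
    by apply/seteqP; split=> // x [] /=; rewrite mi1.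
  have v0 : pr (mask m a) (nth 0 a i) != 0.
    move: mi0; rewrite mi; apply: contra_neq => v0.
    have <- := @inner_pr _ _ (mask m a) (nth 0 a i) p; last by rewrite -am; exact: perp_act.
    by rewrite v0 inner0l.
  rewrite -(gm_hyperplane0 v0); congr (gm R d _); apply/seteqP; split=> x /=.
    by move=> [_ <-]; rewrite inner_prC.
  by rewrite inner_prC => h; split; first exact: negbTE.
- apply/measurable_ind/mset_and => //; apply: (measurable_set_comp mpr).
  by apply: measurableI => //; exact: mset_mface.
- apply/measurable_ind/mset_and => //.
  exact: (measurable_set_comp mpr (mset_relint m mA)).
move=> x nP; apply: ind_iff; split=> [[[[ax _] Ax] px]|[[Ax ax qi] px]]; split=> //.
  split=> // i; apply/idP/eqP => [mi1|q0].
    have /perpP := pr_perp (mask m a) x; apply; rewrite -am mem_act mem_nth// andbT.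
    by rewrite -mi.
  by apply: contrapT => /negP/negbTE mi0; apply: nP; exists i.
by split=> //; split=> //=; exact: pr_perp.
Qed.

Lemma fsbig_finType (I : finType) (M : set I) (F : I -> \bar R) :
  (\sum_(i \in M) F i = \sum_i if i \in M then F i else 0)%E.
Proof.
rewrite -big_mkcond /= [RHS]bigfs ?index_enum_uniq//; last first.
  by move=> i _ /negP[]; exact: mem_index_enum.
by apply: eq_fsbigl; apply/seteqP; split=> i /=; rewrite inE.
Qed.

(** Independence turns the product for each face into the probability of one event. Faces correspond
    to realized masks, the other masks have empty relative interior, and the events of distinct
    masks are disjoint. *)
Lemma curv_cone a k A : measurable A -> curv (cone a) k A = Psi a k A.
Proof.
move=> mA; pose T := (size a).-tuple bool.
pose M := [set m : T | realized a m /\ (rk (mask m a) + k)%N = d].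
pose G (m : T) (x : vec) := ind R (relint a A m (pr (mask m a) x) /\
  polar a (x - pr (mask m a) x)).
rewrite /curv kfaces_cone fsbig_image; last first.
  by move=> m m' /set_mem[rm _] /set_mem[rm' _]; exact: mface_inj.
transitivity (\sum_(m \in M) \int[gm R d]_x G m x)%E.
  apply: eq_fsbigr => m /set_mem[rm _].
  have mpr := @measurable_pr_cst R d (mask m a).
  have mF : measurable (mface a m `&` A).
    by apply: measurableI => //; exact: mset_mface.
  have mN : measurable [set x | normal_cone (cone a) (mface a m) (x - pr (mask m a) x)].
    rewrite (_ : [set x | _] = [set x | polar a (x - pr (mask m a) x)]).
      exact: (measurable_set_comp (measurable_res _) (mset_polar a)).
    by apply/seteqP; split=> x /normal_cone_mface.
  rewrite lin_hull_mface// gamma_perp; last exact: (measurable_set_comp mpr mF).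
  rewrite gamma_orth_perp//.
  under [X in (_ * X)%E]eq_integral do rewrite (ind_iff _ (normal_cone_mface _ _)).
  by rewrite (gm_perp_indep _ mF (mset_polar a)) integral_mface.
pose G' (m : T) x := ind R ((rk (mask m a) + k)%N = d /\
  (relint a A m (pr (mask m a) x) /\ polar a (x - pr (mask m a) x))).
have mG (m : T) : measurable_fun setT (G m).
  apply/measurable_ind/mset_and.
    exact: (measurable_set_comp (@measurable_pr_cst R d _) (mset_relint m mA)).
  exact: (measurable_set_comp (measurable_res _) (mset_polar a)).
have G'E (m : T) : (rk (mask m a) + k)%N = d -> G' m = G m.
  by move=> rm; apply/funext => x; apply: ind_iff; split=> [[]|].
have G'0 (m : T) : (rk (mask m a) + k)%N <> d -> G' m = cst 0%E.
  by move=> rm; apply/funext => x; apply: ind_false => -[].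
transitivity (\sum_(m : T) \int[gm R d]_x G' m x)%E.
  rewrite fsbig_finType; apply: eq_bigr => m _; case: ifPn => mM.
    by move: mM; rewrite inE => -[_ rm]; rewrite G'E.
  rewrite -[LHS](integral0 (gm R d) setT); apply: eq_integral => x _.
  rewrite /G' ind_false// => -[rm [rel pol]]; move: mM; rewrite notin_setE; apply.
  by split=> //; case: rel => _ aq qi; exists (pr (mask m a) x).
rewrite -ge0_integral_sum//; last 2 first.
- move=> m; have [rm|rm] := pselect ((rk (mask m a) + k)%N = d); first by rewrite G'E.
  by rewrite G'0.
- by move=> m x _; exact: ind_ge0.
apply: eq_integral => x _; rewrite -ind_exists_unique; last first.
  move=> m m' [_ [Rm Pm]] [_ [Rm' Pm']].
  have [qm _] := (isproj_relint A m x _).2 (And3 erefl Rm Pm).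
  have [qm' _] := (isproj_relint A m' x _).2 (And3 erefl Rm' Pm').
  apply: (relint_unique Rm).
  by move: (isproj_unique qm qm') Rm' => /= ->.
apply: ind_iff; rewrite ev_relint.
by split=> [[m [? [? ?]]]|[m [? ? ?]]]; exists m.
Qed.

End faces.

(** * Schlaefli cones *)

Section interpolation.
Variables (R : realType).

(** Linear independence as solvability, a form that passes to a hyperplane and yields the perturbing
    direction in [genpos_empty_cell]. *)
Definition interp d (s : seq 'rV[R]_d) := forall c : nat -> R,
  exists y, forall i, (i < size s)%N -> inner (nth 0 s i) y = c i.

Lemma interpP d (s : seq 'rV[R]_d) : rk s = size s <-> interp s.
Proof.
split.
  elim: s => [|w s IH] rks c; first by exists 0.
  have [y0 rs] : pr s w != 0 /\ rk s = size s.
    have := rk_size s; move: rks => /=; case: (_ != 0) => /= rks h; split=> //; lia.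
  have [y yc] := IH rs (fun i => c i.+1).
  have pp : inner w (pr s w) != 0 by rewrite -(inner_pr w (pr_perp s w)) inner_eq0.
  exists (y + ((c 0%N - inner w y) / inner w (pr s w)) *: pr s w) => -[|i] /= is_.
    by rewrite innerDr innerZr divfK// addrC subrK.
  have /perpP/(_ _ (mem_nth 0 is_)) p0 := pr_perp s w.
  by rewrite innerDr innerZr yc// p0 mulr0 addr0.
elim: s => [//|w s IH] Is /=.
have -> : rk s = size s.
  by apply: IH => c; have [y yc] := Is (fun i => c i.-1); exists y => i is_; exact: (yc i.+1).
rewrite (_ : pr s w != 0)//; have [y yc] := Is (fun i => (i == 0%N)%:R).
apply: contra_eq_neq (yc 0%N isT) => /= w0.
have ys : perp s y.
  by apply/perpP => v vs; have := yc (index v s).+1; rewrite /= ltnS index_mem nth_index// => ->.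
by rewrite -(inner_pr w ys) w0 inner0l eq_sym oner_eq0.
Qed.

Definition genpos d (us : seq 'rV[R]_d) :=
  forall s, subseq s us -> (size s <= d)%N -> rk s = size s.

Lemma genpos_sub d (s us : seq 'rV[R]_d) : subseq s us -> genpos us -> genpos s.
Proof. by move=> ss H t ts; apply: H; exact: subseq_trans ss. Qed.

(** Prescribing the value 0 on [u] forces the solution into the hyperplane, where it is read in the
    coordinates of [E0]. *)
Lemma genpos_section d l (u : 'rV[R]_d) (us : seq 'rV[R]_d) (E0 : 'M[R]_(l, d)) :
  l.+1 = d -> genpos (u :: us) ->
  (forall x, inner u x = 0 -> exists y, x = y *m E0) ->
  genpos [seq v *m E0^T | v <- us].
Proof.
move=> ld gp uE s /subseqP[m sm ->]; rewrite -map_mask size_map => sl.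
have sub : subseq (u :: mask m us) (u :: us) by rewrite /= eqxx mask_subseq.
have : rk (u :: mask m us) = size (u :: mask m us) by apply: gp => //; apply: leq_trans (eq_leq ld).
move=> /interpP H; rewrite -(size_map (fun v => v *m E0^T)); apply/interpP => c.
have [x xc] := H (fun i => if i is i'.+1 then c i' else 0).
have [y xy] := uE x (xc 0%N isT); exists y => i; rewrite size_map => is_.
rewrite (nth_map 0)// -(xc i.+1)//= xy !innerE trmx_mul mulmxA //.
Qed.

End interpolation.

(** * Counting cells by sign vectors *)

Section sign_vectors.
Variable R : realType.

Fixpoint sgns n : seq (seq bool) :=
  if n is n'.+1 then map (cons true) (sgns n') ++ map (cons false) (sgns n') else [:: [::]].

Fixpoint sg d (e : seq bool) (us : seq 'rV[R]_d) : seq 'rV[R]_d :=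
  if us is u :: us' then (if head true e then u else - u) :: sg (behead e) us' else [::].

Lemma mem_sgns n e : (e \in sgns n) = (size e == n).
Proof.
elim: n e => [|n IH] e; first by case: e.
rewrite /= mem_cat; case: e => [|b e].
  by apply/negbTE; rewrite negb_or; apply/andP; split; apply/mapP => -[].
rewrite /= eqSS -IH; apply/orP/idP => [[/mapP[e' ? [_ ->]]|/mapP[e' ? [_ ->]]] //|ee].
by case: b; [left|right]; apply/mapP; exists e.
Qed.

Lemma uniq_sgns n : uniq (sgns n).
Proof.
elim: n => //= n IH; rewrite cat_uniq !map_inj_uniq ?IH ?andbT//=; last 2 first.
- by move=> ? ? [].
- by move=> ? ? [].
by apply/hasPn => e /mapP[e' _ ->]; apply/mapP => -[].
Qed.

Definition ocell d (s : seq 'rV[R]_d) : set 'rV[R]_d :=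
  [set x | all (fun v => inner v x < 0) s].

Definition realizable d (us : seq 'rV[R]_d) (e : seq bool) : bool :=
  `[< exists x, ocell (sg e us) x >].

Lemma ocell_perturb d (s : seq 'rV[R]_d) z y :
  (forall v, v \in s -> inner v z <= 0) ->
  (forall v, v \in s -> inner v z = 0 -> inner v y < 0) ->
  exists2 e : R, 0 < e & forall t, 0 < t <= e -> ocell s (z + t *: y).
Proof.
elim: s => [|v s IH] H1 H2; first by exists 1 => // t _; exact: isT.
have [|e e0 He] := IH (fun w ws => H1 w (@mem_behead _ (v :: s) w ws)).
  by move=> w ws; apply: H2; rewrite inE ws orbT.
have vz := H1 v (mem_head v s); have vy := H2 v (mem_head v s).
have [vz0|vz0] := eqVneq (inner v z) 0.
  exists e => // t /[dup] t01 /He; rewrite /ocell /= => ->; rewrite andbT.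
  by rewrite innerDr innerZr vz0 add0r pmulr_rlt0 ?vy//; case/andP: t01.
have vz1 : 0 < - inner v z by rewrite oppr_gt0 lt_neqAle vz0.
have n1 : 0 < 1 + `|inner v y| by rewrite ltr_pwDl.
exists (Num.min e (- inner v z / (1 + `|inner v y|))).
  by rewrite lt_min e0 divr_gt0.
move=> t /andP[t0]; rewrite le_min => /andP[te tv].
rewrite /ocell /= He ?t0 ?te// andbT innerDr innerZr.
move: tv; rewrite ler_pdivlMr// => tv.
have : t * inner v y < t * (1 + `|inner v y|).
  by rewrite ltr_pM2l// (le_lt_trans (ler_norm _))// ltrDr.
lra.
Qed.

Lemma ocell_convex d (s : seq 'rV[R]_d) x y (t t' : R) :
  0 <= t -> 0 <= t' -> 0 < t + t' -> ocell s x -> ocell s y -> ocell s (t *: x + t' *: y).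
Proof.
move=> t0 t0' tt /allP sx /allP sy; apply/allP => v vs; rewrite innerDr !innerZr.
have := sx v vs; have := sy v vs.
have [t1|t1] := ltP 0 t; first by move=> ? ?; nra.
have t'1 : 0 < t' by lra.
by move=> ? ?; nra.
Qed.

(** A cell on which [u] takes both signs meets its hyperplane by convexity; conversely a point of
    the open cell on the hyperplane can be moved to either side. So the cell counts twice exactly
    when the hyperplane meets it. *)
Lemma sgns_split d (u : 'rV[R]_d) us e : u != 0 ->
  (realizable (u :: us) (true :: e) + realizable (u :: us) (false :: e) =
   realizable us e + `[< exists x, inner u x = 0%R /\ ocell (sg e us) x >])%N.
Proof.
move=> u0; have uu : 0 < inner u u by rewrite inner_gt0.
have [[x [ux sx]]|nH] := pselect (exists x, inner u x = 0 /\ ocell (sg e us) x).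
  have He : realizable us e by apply/asboolT; exists x.
  have pert (y : 'rV[R]_d) : exists2 t, 0 < t & ocell (sg e us) (x + t *: y).
    have [||t t0 Ht] := @ocell_perturb d (sg e us) x y.
    - by move=> v vs; rewrite ltW//; move/allP: sx; exact.
    - by move=> v vs vx; move/allP: sx => /(_ v vs); rewrite vx ltxx.
    by exists t => //; apply: Ht; rewrite t0 lexx.
  have Ht : realizable (u :: us) (true :: e).
    have [t t0 st] := pert (- u); apply/asboolT; exists (x + t *: - u).
    rewrite /ocell /= -/(ocell _ _) st andbT innerDr innerZr ux add0r innerNr.
    by rewrite mulrN oppr_lt0 mulr_gt0.
  have Hf : realizable (u :: us) (false :: e).
    have [t t0 st] := pert u; apply/asboolT; exists (x + t *: u).
    rewrite /ocell /= -/(ocell _ _) st andbT innerDr innerZr innerNl ux oppr0 add0r innerNl.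
    by rewrite mulrN oppr_lt0 mulr_gt0.
  by rewrite Ht Hf He asboolT//; exists x.
rewrite (asboolF nH) addn0.
have nboth : ~ (realizable (u :: us) (true :: e) /\ realizable (u :: us) (false :: e)).
  move=> [/asboolP[x /andP[ux sx]] /asboolP[y /andP[uy sy]]]; apply: nH.
  rewrite innerNl oppr_lt0 in uy.
  (* Positive weights for which the values of [u] cancel. *)
  exists (inner u y *: x + (- inner u x) *: y); split.
    by rewrite innerDr !innerZr; ring.
  by apply: ocell_convex => //; lra.
have [/asboolP[x sx]|nr] := boolP (realizable us e).
  have : inner u x != 0 by apply: contra_notN nH => /eqP ux; exists x.
  rewrite neq_lt => /orP[ux|ux].
    have Ht : realizable (u :: us) (true :: e).
      by apply/asboolT; exists x; rewrite /ocell /= ux.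
    by rewrite Ht; case: (boolP (realizable _ (false :: e))) => // Hf; case: nboth.
  have Hf : realizable (u :: us) (false :: e).
    by apply/asboolT; exists x; rewrite /ocell /= innerNl oppr_lt0 ux.
  by rewrite Hf; case: (boolP (realizable _ (true :: e))) => // Ht; case: nboth.
have nrb b : realizable (u :: us) (b :: e) = false.
  apply/negbTE; apply: contra nr => /asboolP[x /andP[_ sx]].
  by apply/asboolT; exists x.
by rewrite !nrb.
Qed.

Lemma sg_map d l (E : 'M[R]_(d, l)) e (us : seq 'rV[R]_d) :
  sg e [seq v *m E | v <- us] = [seq v *m E | v <- sg e us].
Proof. by elim: us e => //= u us IH e; rewrite IH; case: ifP; rewrite ?mulNmx. Qed.

(* Deletion and restriction: the cells of [us] split by the hyperplane of [u] are
   the cells of the arrangement induced by [us] on that hyperplane. *)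
Lemma count_realizable n d (us : seq 'rV[R]_d) : size us = n.+1 -> genpos us ->
  count (realizable us) (sgns n.+1) = C_nd n.+1 d.
Proof.
elim: n d us => [|n IH] d us sz gp.
all: case: us sz gp => [//|u us] [sz] gp.
all: have [d0|d0] := posnP d.
(* In dimension 0 an open cell would require 0 < 0, and [C_nd] is an empty sum. *)
1,3: subst d; rewrite /C_nd big_ord0 muln0; apply/eqP; rewrite -leqn0 leqNgt -has_count;
  apply/hasPn => e _; apply/asboolPn => -[x /andP[+ _]];
  by rewrite /inner big_ord0 ltxx.
all: have u0 : u != 0.
1,3: have : rk [:: u] = 1%N by apply: (gp [:: u]) => //=; rewrite eqxx sub0seq.
1,2: by rewrite /=; case: (_ != 0).
(* Without other hyperplanes the single cell is the whole space, which meets the hyperplane of [u]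
   at 0. *)
- move: sz => /size0nil ->; have := sgns_split [::] [::] u0; rewrite /= addn0 => ->.
  rewrite /realizable !asboolT; last 2 first.
  + by exists 0; rewrite inner0r.
  + by exists 0.
  by rewrite /C_nd -(prednK d0) big_ord_recl big1 ?addn0.
have cE : count (realizable (u :: us)) (sgns n.+2) =
    (count (realizable us) (sgns n.+1) +
     count (fun e => `[< exists x, inner u x = 0%R /\ ocell (sg e us) x >]) (sgns n.+1))%N.
  have -> : sgns n.+2 = map (cons true) (sgns n.+1) ++ map (cons false) (sgns n.+1) by [].
  rewrite count_cat !count_map; elim: (sgns n.+1) => // e S IHS /=.
  by rewrite addnACA IHS (sgns_split us e u0) addnACA.
have [l [r [E0 [E [rE lr QQ prE _]]]]] := orthonormal_frame [:: u].
have rl : l.+1 = d by move: rE; rewrite /= u0 /=; lia.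
have [E00 _ _ _] := frame_blocks QQ.
have uE x : inner u x = 0 -> exists y, x = y *m E0.
  move=> ux; exists (x *m E0^T); rewrite -prE pr_id//.
  by rewrite /perp /= ux eqxx.
rewrite cE IH//; last by apply: genpos_sub gp; exact: subseq_cons.
have -> : count (fun e => `[< exists x, inner u x = 0%R /\ ocell (sg e us) x >]) (sgns n.+1) =
    count (realizable [seq v *m E0^T | v <- us]) (sgns n.+1).
  apply: eq_count => e; rewrite /realizable sg_map; congr asbool; apply/propext.
  have cellE y : ocell [seq v *m E0^T | v <- sg e us] y <-> ocell (sg e us) (y *m E0).
    rewrite /ocell /= all_map; split=> /allP H; apply/allP => v /H /=;
    by rewrite !innerE trmx_mul mulmxA.
  split=> [[x [ux sx]]|[y /cellE sy]].
    by have [y xy] := uE x ux; exists y; apply/cellE; rewrite -xy.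
  exists (y *m E0); split=> //.
  have := pr_perp [:: u] (y *m E0).
  by rewrite prE -(mulmxA y) E00 mulmx1 /= andbT => /eqP.
rewrite IH ?size_map//; last exact: (genpos_section rl gp uE).
rewrite /C_nd /= -rl -mulnDr; congr (2 * _)%N.
rewrite big_ord_recl [RHS]big_ord_recl !bin0 -addnA; congr (_ + _)%N.
by rewrite -big_split; apply: eq_bigr => i _; rewrite /= binS.
Qed.

End sign_vectors.

Section signed_cells.
Variables (R : realType) (d : nat).
Notation vec := 'rV[R]_d.
Implicit Types (a s us : seq vec) (e : seq bool) (z : vec).

Lemma size_sg e us : size (sg e us) = size us.
Proof. by elim: us e => //= u us IH e; rewrite IH. Qed.

Lemma mask_sg m e us : size m = size us -> size e = size us ->
  mask m (sg e us) = sg (mask m e) (mask m us).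
Proof.
elim: us m e => [|u us IH] [|b m] [|c e] //= [sm] [se].
by case: b; rewrite /= IH.
Qed.

Lemma perp_sg e us : perp (sg e us) =1 perp us.
Proof.
elim: us e => //= u us IH e x; rewrite /perp /= -!/(perp _ _) IH.
by case: ifP => //; rewrite innerNl oppr_eq0.
Qed.

Lemma rk_sg e us : rk (sg e us) = rk us.
Proof.
elim: us e => //= u us IH e; rewrite IH (eq_pr (perp_sg (behead e) us)).
by case: ifP => //; rewrite prN oppr_eq0.
Qed.

Lemma genpos_sg e us : size e = size us -> genpos us -> genpos (sg e us).
Proof.
move=> se gp s /subseqP[m]; rewrite size_sg => sm ->.
rewrite mask_sg// rk_sg size_sg; apply: gp; exact: mask_subseq.
Qed.

(* If [z] is a nonzero point of the closed cone then, by general position, its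
   active constraints can be made strict simultaneously by a perturbation. *)
Lemma genpos_empty_cell s z :
  genpos s -> ~ (exists x, ocell s x) -> cone s z -> z = 0.
Proof.
move=> gp no sz; have subJ : subseq (act s z) s by exact: filter_subseq.
have [Jd|dJ] := leqP (size (act s z)) d.
  have /interpP H := gp _ subJ Jd; case: no; have [y yJ] := H (fun=> - 1).
  have [||t t0 Ht] := @ocell_perturb _ _ s z y.
  - exact/coneP.
  - move=> v vs vz; have vJ : v \in act s z by rewrite mem_act vz eqxx.
    by have := yJ (index v (act s z)); rewrite index_mem nth_index// => -> //; rewrite ltrN10.
  by exists (z + t *: y); apply: Ht; rewrite t0 lexx.
(* With more than [d] active constraints, any [d] of them have rank [d], and only 0 is orthogonal to
   them. *)
apply: (@perp_full _ _ (take d (act s z))).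
  have st : size (take d (act s z)) = d by rewrite size_takel// ltnW.
  by rewrite gp ?st//; apply: subseq_trans subJ; exact: take_subseq.
by apply/perpP => v /mem_take; rewrite mem_act => /andP[/eqP].
Qed.

(** No nonzero vector is orthogonal to [a], so the rank is [d] and the only face has dimension 0. *)
Lemma Psi_trivial a k A : (0 < k)%N -> (forall z, cone a z -> z = 0) -> Psi a k A = 0%E.
Proof.
move=> k0 a0; rewrite /Psi -[RHS](integral0 (gm R d) setT).
apply: eq_integral => x _; apply: ind_false => -[p [[ap _ _] _]].
rewrite (a0 p ap) (_ : act a 0 = a); last first.
  by apply/all_filterP/allP => v _; rewrite /= inner0r.
move=> rd; have [|z /eqP z0 /perpP az] := @perp_lt R d a; first lia.
by apply/z0/a0/coneP => v /az ->.
Qed.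

Lemma cone_cat s a : cone (s ++ a) = cone a `&` cone s.
Proof.
by apply/seteqP; split=> x; rewrite /cone /= all_cat; [case/andP|case=> -> ->].
Qed.

Lemma cell_sumE us a k A : measurable A ->
  cell_sum us a k A = (\sum_(e <- sgns (size us)) curv (cone a `&` cone (sg e us)) k A)%E.
Proof.
move=> mA; elim: us a => [|u us IH] a /=.
  by rewrite big_seq1 -cone_cat curv_cone.
rewrite big_cat !big_map !IH; congr (_ + _)%E; apply: eq_bigr => e _; congr curv.
  by rewrite -!cone_cat; apply/seteqP; split=> x; rewrite /cone /= !all_cat /= => /and3P[-> -> ->].
by rewrite -!cone_cat; apply/seteqP; split=> x; rewrite /cone /= !all_cat /= => /and3P[-> -> ->].
Qed.

Lemma cell_sum_genpos us a k A : measurable A -> (0 < k)%N -> genpos us ->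
  cell_sum us a k A =
  (\sum_(e <- [seq e <- sgns (size us) | realizable us e]) curv (cone a `&` cone (sg e us)) k A)%E.
Proof.
move=> mA k0 gp; rewrite cell_sumE// big_filter [RHS]big_mkcond /=.
apply: eq_big_seq => e; rewrite mem_sgns => /eqP se; case: ifPn => // /asboolPn ne.
rewrite -cone_cat curv_cone//; apply: Psi_trivial => // z.
by rewrite cone_cat => -[_]; exact/genpos_empty_cell/ne/genpos_sg.
Qed.

End signed_cells.

(** * Borel sets, closures and components of cells *)

Section topology.
Variables (R : realType) (d : nat).
Notation vec := 'rV[R]_d.

Lemma measurable_box (x : vec) (e : R) :
  measurable [set y : vec | forall i, `|x 0 i - y 0 i| < e].
Proof.
apply: mset_forall => i.
rewrite (_ : [set y | _] = (fun y : vec => y 0 i) @^-1` [set t | `|x 0 i - t| < e]) //.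
rewrite -[X in measurable X]setTI; apply: measurable_entry => //.
rewrite (_ : [set t | _] = ball (x 0 i) e) //; exact: measurable_ball.
Qed.

(** The boxes with rational centre and radius 1 / (j + 1) form a countable family, and those
    contained in [U] cover it. *)
Lemma measurable_open (U : set vec) : open U -> measurable U.
Proof.
move=> oU; pose e (j : nat) : R := j.+1%:R^-1.
pose B (p : 'rV[rat]_d * nat) : set vec :=
  [set y | forall i, `|(map_mx ratr p.1 : vec) 0 i - y 0 i| < e p.2].
pose F p : set vec := if `[< B p `<=` U >] then B p else set0.
suff -> : U = \bigcup_p F p.
  apply: countable_bigcupT_measurable => [|p]; first exact: countableP.
  by rewrite /F; case: asboolP => // _; exact: measurable_box.
apply/seteqP; split=> [x Ux|x [p _]]; last first.
  by rewrite /F; case: asboolP => // + Bx; exact.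
have : nbhs x U by exact: open_nbhs_nbhs.
move=> /nbhs_ballP[r /= r0 xU].
(* One radius for the distance from [x] to the rational centre, one from the centre to a point of
   the box. *)
have [j jr] : exists j, e j + e j <= r.
  have [j _ jr] := near_infty_natSinv_lt (PosNum (divr_gt0 r0 (ltr0Sn R 1))).
  exists j; have := jr j (leqnn j); rewrite /= /e; move: (_^-1) => w; lra.
have ej : 0 < e j by rewrite invr_gt0.
have H i : exists q : rat, `|ratr q - x 0 i| < e j.
  have [|q] := @rat_in_itvoo R (x 0 i - e j) (x 0 i + e j); first lra.
  by rewrite in_itv /= -ltr_distlC distrC => qx; exists q.
pose q : 'rV[rat]_d := \row_i projT1 (cid (H i)).
have qx i : `|(map_mx ratr q : vec) 0 i - x 0 i| < e j.
  by rewrite !mxE; case: cid.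
exists (q, j) => //; rewrite /F asboolT// => y By; apply: xU; split=> // i i'.
rewrite (ord1 i) -ball_normE /=; apply: lt_le_trans jr.
rewrite -(subrKA ((map_mx ratr q : vec) 0 i')); apply: le_lt_trans (ler_normD _ _) _.
by rewrite ltrD// distrC.
Qed.

Lemma measurable_borel (A : set vec) : borel_set A -> measurable A.
Proof.
apply: smallest_sub => [|U]; first exact: sigma_algebra_measurable.
exact: measurable_open.
Qed.

Lemma continuous_inner (v : vec) : continuous (inner v : vec -> R).
Proof.
rewrite /inner; apply: continuous_big; first exact: add_continuous.
by move=> i _ x; apply: (@cvgM _ _ (nbhs x)); [exact: cvg_cst|exact: coord_continuous].
Qed.

Lemma continuous_line (x y : vec) : continuous (fun t : R => x + t *: y).
Proof.
by move=> t; apply: cvgD; [exact: cvg_cst|apply: cvgZl; exact: cvg_id].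
Qed.

Lemma ocell_sub_cone (s : seq vec) : ocell s `<=` cone s.
Proof. by move=> x /allP sx; apply/coneP => v /sx/ltW. Qed.

(** A nonempty open cell is dense in its closed cone: adding a small multiple of one of its points
    makes every constraint strict. *)
Lemma closure_ocell (s : seq vec) y : ocell s y -> closure (ocell s) = cone s.
Proof.
move=> sy; apply/seteqP; split=> [x clx|x sx B Bx].
  apply/coneP => v vs; rewrite leNgt; apply/negP => vx.
  have [|z [/allP/(_ v vs) vz /= /(lt_trans vz)]] := clx (inner v @^-1` [set t | 0 < t]).
    by apply: continuous_inner; exact: lt_nbhsr.
  by rewrite ltxx.
have [||e e0 He] := @ocell_perturb _ _ s x y.
- exact/coneP.
- by move=> v vs _; move/allP: sy; exact.
have : nbhs (0 : R) [set t : R | B (x + t *: y)].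
  by apply: (@continuous_line x y 0); rewrite scale0r addr0.
move=> /nbhs_ballP[r /= r0 rB]; exists (x + (Num.min e (r / 2)) *: y); split.
  by apply: He; rewrite lt_min e0 divr_gt0//= ge_min lexx.
apply: rB; rewrite -ball_normE /= sub0r normrN ger0_norm.
  by rewrite gt_min; apply/orP; right; lra.
by rewrite le_min ltW//= divr_ge0// ltW.
Qed.

Lemma ocell_sg e (us : seq vec) x : size e = size us -> (forall v, v \in us -> inner v x != 0) ->
  ocell (sg e us) x <-> e = [seq inner v x < 0 | v <- us].
Proof.
elim: us e => [|u us IH] [|b e] //= [se] nz.
have ux := nz u (mem_head _ _).
have {}IH := IH _ se (fun v vs => nz v (@mem_behead _ (u :: us) v vs)).
rewrite /ocell /=; split.
  move=> /andP[bx /IH <-]; congr (_ :: _); case: b bx => [->//|].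
  by rewrite innerNl oppr_lt0 => ux0; rewrite ltNge ltW.
move=> [-> /IH ->]; rewrite andbT; case: ifPn => // ux0.
by rewrite innerNl oppr_lt0 lt_neqAle eq_sym ux leNgt.
Qed.

Lemma ocell_neq0 e (us : seq vec) x : ocell (sg e us) x -> forall v, v \in us -> inner v x != 0.
Proof.
elim: us e => [|u us IH] e //; rewrite /ocell /= => /andP[ux /IH{}IH] v.
rewrite inE => /predU1P[->|/IH//]; case: ifPn ux => _; first by move/lt_eqF ->.
by rewrite innerNl oppr_lt0 => /gt_eqF ->.
Qed.

Lemma cone_neq0 (s : seq vec) x : cone s x -> (forall v, v \in s -> inner v x != 0) -> ocell s x.
Proof.
by move=> /coneP sx nz; apply/allP => v vs; rewrite lt_neqAle nz ?sx.
Qed.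

(** On a component no inner product vanishes, so each keeps its sign by the intermediate value
    property; conversely, cells are convex and segments are connected. *)
Lemma component_ocell e (us : seq vec) x : size e = size us -> ocell (sg e us) x ->
  connected_component [set y | forall v, v \in us -> inner v y <> 0] x = ocell (sg e us).
Proof.
move=> se sx; have xn := ocell_neq0 sx; apply/seteqP; split=> y.
  set U := [set _ | _] => xy; have Uy : U y by exact: connected_component_sub xy.
  have yn v : v \in us -> inner v y != 0 by move=> /Uy/eqP.
  apply/ocell_sg => //; have /ocell_sg -> // := sx.
  apply/eq_in_map => v vs.
  have : is_interval [set inner v z | z in connected_component U x].
    apply/connected_intervalP/connected_continuous_connected.
      exact: component_connected.
    exact/continuous_subspaceT/continuous_inner.
  have Ux : U x by move=> w /xn/eqP.
  have Ix : [set inner v z | z in connected_component U x] (inner v x).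
    by exists x => //; exact: connected_component_refl.
  have Iy : [set inner v z | z in connected_component U x] (inner v y) by exists y.
  move=> itv; have n0 : ~ [set inner v z | z in connected_component U x] 0.
    by move=> [z /connected_component_sub/(_ v vs)].
  have := xn v vs; have := yn v vs; rewrite !neq_lt => /orP[yv|yv] /orP[xv|xv].
  - by rewrite xv yv.
  - by case: n0; apply: (itv _ _ Iy Ix); rewrite !ltW.
  - by case: n0; apply: (itv _ _ Ix Iy); rewrite !ltW.
  - by rewrite !ltNge !ltW.
move=> sy; pose S := [set x + t *: (y - x) | t in `[0 : R, 1]].
suff : S `<=` connected_component [set y | forall v, v \in us -> inner v y <> 0] x.
  apply; exists 1; first by rewrite /= in_itv /= ler01 lexx.
  by rewrite scale1r addrC subrK.
apply: connected_component_max.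
- by exists 0; [rewrite /= in_itv /= ler01 lexx|rewrite scale0r addr0].
- move=> _ [t + <-] v vs; rewrite /= in_itv /= => /andP[t0 t1]; apply/eqP.
  apply: (@ocell_neq0 e us) vs.
  rewrite scalerBr addrCA addrC -[X in X - _]scale1r -scalerBl.
  by apply: ocell_convex => //; lra.
- apply: connected_continuous_connected; first exact: segment_connected.
  exact/continuous_subspaceT/continuous_line.
Qed.

End topology.

(** * From Schlaefli cones to sign vectors *)

Section schlafli.
Variables (R : realType) (d : nat).
Notation vec := 'rV[R]_d.

Lemma schlafli_conesE n (u : 'I_n -> vec) (us := [seq u i | i <- enum 'I_n]) :
  schlafli_cones u =
  [set cone (sg e us) | e in [set` [seq e <- sgns n | realizable us e]]].
Proof.
have sus : size us = n by rewrite size_map size_enum_ord.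
have UE : [set x | forall i, inner (u i) x <> 0] = [set x | forall v, v \in us -> inner v x <> 0].
  apply/seteqP; split=> x /= H; first by move=> _ /mapP[i _ ->].
  by move=> i; apply/H/map_f; rewrite mem_enum.
rewrite /schlafli_cones UE; apply/seteqP; split=> D.
  move=> [x [Ux ->]]; pose e := [seq inner v x < 0 | v <- us].
  have se : size e = size us by rewrite size_map.
  have sx : ocell (sg e us) x by apply/ocell_sg => // v /Ux/eqP.
  exists e; last by rewrite (component_ocell se sx) (closure_ocell sx).
  by rewrite /= mem_filter mem_sgns se sus eqxx andbT; apply/asboolT; exists x.
move=> [e]; rewrite /= mem_filter mem_sgns => /andP[/asboolP[x sx] /eqP se] <-.
exists x; split; first by move=> v /(ocell_neq0 sx)/eqP.
by rewrite (component_ocell _ sx) ?sus// (closure_ocell sx).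
Qed.

(** A point of the open cell of [e] lies in the closed cone of [e'] and on no hyperplane, hence in
    the open cell of [e']; its signs determine both. *)
Lemma cone_sg_inj n us : size us = n ->
  set_inj [set` [seq e <- sgns n | realizable us e]] (fun e => cone (@sg R d e us)).
Proof.
move=> sus e e'; rewrite !in_setE /= !mem_filter !mem_sgns.
move=> /andP[/asboolP[x sx] /eqP se] /andP[_ /eqP se'] ee'.
have xn := ocell_neq0 sx; move: (sx) => /ocell_sg -> //; last by rewrite sus.
apply/esym/ocell_sg; rewrite ?sus//; apply: cone_neq0.
  by rewrite -ee'; exact: ocell_sub_cone.
move=> v; have : forall v, v \in us -> inner v x != 0 by [].
clear -v; elim: us e' => //= w us IH e' nz; rewrite inE => /predU1P[->|].
  by case: ifP => _; rewrite ?innerNl ?oppr_eq0 nz// mem_head.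
by apply: IH => z zs; rewrite nz// inE zs orbT.
Qed.

Lemma big_schlafli (T : Type) (idx : T) (op : Monoid.com_law idx) n (u : 'I_n -> vec)
    (us := [seq u i | i <- enum 'I_n]) (f : set vec -> T) :
  \big[op/idx]_(D \in schlafli_cones u) f D =
  \big[op/idx]_(e <- [seq e <- sgns n | realizable us e]) f (cone (sg e us)).
Proof.
rewrite schlafli_conesE fsbig_image; first by rewrite -fsbig_seq// filter_uniq// uniq_sgns.
by apply: cone_sg_inj; rewrite size_map size_enum_ord.
Qed.

Lemma general_positionP n (u : 'I_n -> vec) :
  general_position u <-> genpos [seq u i | i <- enum 'I_n].
Proof.
have setE (I : {set 'I_n}) : [set x | forall i, i \in I -> inner (u i) x = 0] =
    [set x | perp [seq u i | i <- enum I] x].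
  apply/seteqP; split=> x /= H.
    by apply/perpP => _ /mapP[i iI ->]; apply: H; rewrite mem_enum in iI.
  by move=> i iI; move/perpP: H; apply; rewrite map_f ?mem_enum.
split=> gp.
  move=> s /subseqP[m _ ->]; rewrite -map_mask size_map => sd.
  pose I := [set i in mask m (enum 'I_n)].
  have IE : mask m (enum 'I_n) = enum I.
    have := subseq_uniqP (enum_uniq 'I_n) (mask_subseq m (enum 'I_n)) => ->.
    by rewrite enumT [RHS]/enum_mem; apply: eq_filter => i; rewrite /= inE -enumT.
  move: sd; rewrite IE -cardE => Id; have := gp I Id.
  rewrite setE => /has_dim_perp rI; apply/eqP.
  by rewrite -(eqn_add2r (d - #|I|)) rI subnKC.
move=> I Id; rewrite setE; apply/has_dim_perp; rewrite gp ?size_map -?cardE ?subnKC//.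
by apply/map_subseq; rewrite enumT; exact: filter_subseq.
Qed.

(** The normalisation in [schlafli_exp]. Cones, cells and ranks do not change under positive
    factors, and the zero vector is fixed, so it drops out. *)
Definition unitv (v : vec) := (enorm v)^-1 *: v.

Lemma unitvE v : exists2 c : R, 0 < c & unitv v = c *: v.
Proof.
have [->|v0] := eqVneq v 0; first by exists 1; rewrite // /unitv !scaler0.
by exists (enorm v)^-1; rewrite // invr_gt0 lt_neqAle eq_sym enorm_eq0 v0 enorm_ge0.
Qed.

Lemma inner_unit_lt0 v x b :
  (inner (if b then unitv v else - unitv v) x < 0) = (inner (if b then v else - v) x < 0).
Proof.
by have [c c0 ->] := unitvE v; case: b; rewrite ?innerNl innerZl -?mulrN pmulr_rlt0.
Qed.

Lemma inner_unit_le0 v x b :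
  (inner (if b then unitv v else - unitv v) x <= 0) = (inner (if b then v else - v) x <= 0).
Proof.
by have [c c0 ->] := unitvE v; case: b; rewrite ?innerNl innerZl -?mulrN pmulr_rle0.
Qed.

Lemma cone_sg_unit e us : cone (sg e (map unitv us)) = cone (sg e us).
Proof.
apply/funext => x; congr is_true.
by elim: us e => //= u us IH e; rewrite IH inner_unit_le0.
Qed.

Lemma ocell_sg_unit e us : ocell (sg e (map unitv us)) = ocell (sg e us).
Proof.
apply/funext => x; congr is_true.
by elim: us e => //= u us IH e; rewrite IH inner_unit_lt0.
Qed.

Lemma perp_unit us : perp (map unitv us) =1 perp us.
Proof.
elim: us => //= u us IH x; rewrite /perp /= -!/(perp _ _) IH.
by have [c c0 ->] := unitvE u; rewrite innerZl mulf_eq0 gt_eqF.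
Qed.

Lemma rk_unit us : rk (map unitv us) = rk us.
Proof.
elim: us => //= u us IH; rewrite IH (eq_pr (perp_unit us)).
by have [c c0 ->] := unitvE u; rewrite prZ scaler_eq0 gt_eqF.
Qed.

Lemma genpos_unit us : genpos (map unitv us) <-> genpos us.
Proof.
split=> gp s; last first.
  by move=> /subseqP[m _ ->]; rewrite -map_mask rk_unit size_map => ?; apply: gp; rewrite ?mask_subseq.
move=> ss sd; rewrite -rk_unit gp ?size_map//; exact: map_subseq.
Qed.

(** In general position the number of cones is a constant, so the mean over the cones is a fixed
    multiple of [cell_sum]. *)
Lemma schlafli_mean n a k (A : set vec) (g : 'I_n -> vec)
    (gs := [seq g i | i <- enum 'I_n]) (u := fun i => unitv (g i)) :
  measurable A -> (0 < k)%N -> (0 < n)%N ->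
  (if `[< general_position u >] then
    ((((\sum_(D \in schlafli_cones u) 1)%N)%:R : R)^-1)%:E *
      (\sum_(D \in schlafli_cones u) curv (cone a `&` D) k A) else 0)%E =
  (if `[< genpos gs >] then ((C_nd n d)%:R^-1)%:E * cell_sum gs a k A else 0)%E.
Proof.
move=> mA k0 n0.
have uE : [seq u i | i <- enum 'I_n] = map unitv gs by rewrite /gs -map_comp.
have sgs : size gs = n by rewrite size_map size_enum_ord.
have E : `[< general_position u >] = `[< genpos gs >].
  by apply: asbool_equiv_eq; rewrite general_positionP uE; exact: genpos_unit.
rewrite E; case: asboolP => // gp; rewrite !big_schlafli uE; congr (_ * _)%E.
  congr (_%:R^-1)%:E; rewrite sum1_size size_filter.
  (* Here [n > 0] matters: without hyperplanes there is one cell, while [C_nd 0 d] is 2 for positive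
     [d]. *)
  have := @count_realizable R n.-1 d (map unitv gs).
  by rewrite size_map sgs prednK// => -> //; exact/genpos_unit.
rewrite cell_sum_genpos// sgs (eq_filter (a2 := realizable gs)).
  by apply: eq_bigr => e _; rewrite cone_sg_unit.
by move=> e; rewrite /realizable ocell_sg_unit.
Qed.

End schlafli.

(** * Almost sure general position *)

Section general_position_ae.
Variables (R : realType) (d : nat).
Notation vec := 'rV[R]_d.

(** The factor [f] may be unbounded; [+oo] times the indicator dominates the product and still
    integrates to 0. *)
Lemma IT_null n (P : seq vec -> Prop) (f : seq vec -> \bar R) :
  jmeas (fun (_ : unit) s => ind R (P s)) -> jmeas (fun _ : unit => f) ->
  (forall s, 0 <= f s)%E -> IT n (fun s => ind R (P s)) = 0%E ->
  IT n (fun s => ind R (P s) * f s)%E = 0%E.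
Proof.
move=> jP jf f0 P0; apply/eqP; rewrite eq_le; apply/andP; split; last first.
  by apply: IT_ge0 => s; rewrite mule_ge0// ind_ge0.
have <- : IT n (fun s => +oo * ind R (P s))%E = 0%E.
  by rewrite ITZl ?P0 ?mule0// => s; exact: ind_ge0.
apply: IT_le.
- move=> dS S phi g mphi mg.
  by apply: emeasurable_funM; [exact: (jP _ _ _ _ mphi)|exact: (jf _ _ _ _ mphi)].
- by move=> s; rewrite mule_ge0// ind_ge0.
- by move=> dS S phi g mphi mg; apply: measurable_funeM; exact: (jP _ _ _ _ mphi).
move=> s; have [p|p] := pselect (P s); last by rewrite ind_false// mul0e mule0.
by rewrite ind_true// mul1e mule1 leey.
Qed.

Lemma genpos_mask (us : seq vec) : genpos us <->
  forall m : (size us).-tuple bool, (size (mask m us) <= d)%N -> rk (mask m us) = size (mask m us).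
Proof.
split=> [gp m|H s /subseqP[m sm ->]]; first by apply: gp; exact: mask_subseq.
have sm' : size m == size us by rewrite sm.
exact: (H (Tuple sm')).
Qed.

Lemma mset_genpos dT (T : measurableType dT) (g : seq (T -> vec)) : all_meas g ->
  measurable [set t | genpos [seq h t | h <- g]].
Proof.
move=> mg; rewrite (_ : [set t | _] = [set t | forall m : (size g).-tuple bool,
    (size (mask m g) <= d)%N -> rk [seq h t | h <- mask m g] = size (mask m g)]).
  apply: mset_forall => m; apply: mset_imply; last exact/mset_rk/all_meas_mask.
  have [sd|sd] := leqP (size (mask m g)) d.
    by rewrite (_ : [set _ | _] = setT)//; apply/seteqP; split.
  by rewrite (_ : [set _ | _] = set0)//; apply/seteqP; split.
apply/seteqP; split=> t /=; rewrite genpos_mask size_map => H m;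
by have := H m; rewrite -map_mask size_map.
Qed.

Lemma jmeas_genpos : jmeas (fun (_ : unit) (s : seq vec) => ind R (genpos s)).
Proof. by move=> dS S phi g mphi mg; exact/measurable_ind/mset_genpos. Qed.

Lemma jmeas_not_genpos : jmeas (fun (_ : unit) (s : seq vec) => ind R (~ genpos s)).
Proof. by move=> dS S phi g mphi mg; exact/measurable_ind/mset_not/mset_genpos. Qed.

Lemma genpos_cons u (us : seq vec) : genpos us ->
  (forall m : (size us).-tuple bool, (rk (mask m us) < d)%N -> pr (mask m us) u <> 0) ->
  genpos (u :: us).
Proof.
move=> gp H s /subseqP[[|[] m] //= [sm] -> {s}] sd; last first.
  by apply: gp => //; exact: mask_subseq.
have rm : rk (mask m us) = size (mask m us).
  by apply: gp; [exact: mask_subseq|exact: ltnW].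
have sm' : size m == size us by rewrite sm.
have pn : pr (mask m us) u != 0 by apply/eqP/(H (Tuple sm')); rewrite rm.
by rewrite /= pn rm.
Qed.

(** Prepending [u] breaks general position only if the tail lacks it already or [u] lies in the span
    of a sublist of rank below [d]. The second event is null for every fixed tail, so [u] is
    exchanged with the tail. *)
Lemma IT_not_genpos n : IT n (fun s : seq vec => ind R (~ genpos s)) = 0%E.
Proof.
elim: n => [|n IH] /=.
  by rewrite ind_false// => -[] s; rewrite subseq0 => /eqP ->.
pose Q (u : vec) (us : seq vec) := exists m : (size us).-tuple bool,
  (rk (mask m us) < d)%N /\ pr (mask m us) u = 0.
have mQ dT (T : measurableType dT) (f : T -> vec) (g : seq (T -> vec)) :
    measurable_fun setT f -> all_meas g ->
    measurable [set t | Q (f t) [seq h t | h <- g]].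
  move=> mf mg; rewrite (_ : [set t | _] = [set t | exists m : (size g).-tuple bool,
      (rk [seq h t | h <- mask m g] < d)%N /\ pr [seq h t | h <- mask m g] (f t) = 0]).
    apply: mset_exists => m; have mm := all_meas_mask m mg; apply: mset_and.
      apply: mset_bool; apply: measurable_fun_ltn => //; exact: measurable_rk.
    by apply: mset_eq0; exact: measurable_pr.
  apply/seteqP; split=> t /=; rewrite /Q size_map => -[m]; rewrite ?map_mask => ?; exists m.
    by rewrite !map_mask.
  by [].
have jQ : jmeas (fun (u : vec) us => ind R (Q u us)).
  by move=> dS S phi g mphi mg; exact/measurable_ind/mQ.
apply/eqP; rewrite eq_le; apply/andP; split; last first.
  by apply: integral_ge0 => u _; apply: IT_ge0 => s; exact: ind_ge0.
have j1 (u : vec) : jmeas (fun (_ : unit) us => ind R (Q u us)) by exact: jmeas_fix jQ.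
have -> : 0%E = (\int[gm R d]_u
    IT n (fun us => ind R (~ genpos us) + ind R (Q u us))%E)%E :> \bar R.
  under eq_integral => u _.
    rewrite ITD; [|exact: jmeas_not_genpos|by move=> s; exact: ind_ge0|exact: j1|
      by move=> s; exact: ind_ge0].
    rewrite IH add0e; over.
  have := @IT_swap R d _ _ (gm R d) n _ jQ (fun _ _ => ind_ge0 _ _) => /= ->.
  apply/esym; transitivity (IT n (fun _ : seq vec => 0 : \bar R)%E); last first.
    by elim: (n) => //= n' ->; rewrite integral0.
  apply: eq_IT => us _; rewrite integral_ind.
    apply: null_exists => m.
      have [rm|rm] := boolP (rk (mask m us) < d)%N; last first.
        by rewrite (_ : [set _ | _] = set0)//; apply/seteqP; split=> // u [].
      rewrite (_ : [set _ | _] = [set u | pr (mask m us) u = 0]).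
        by apply: mset_eq0; exact: measurable_pr_cst.
      by apply/seteqP; split=> // u [].
    have [rm|rm] := boolP (rk (mask m us) < d)%N; last first.
      by rewrite (_ : [set _ | _] = set0)//; apply/seteqP; split=> // u [].
    rewrite -(gm_pr_eq0 rm); congr (gm R d _).
    by apply/seteqP; split=> // u [].
  have := mQ _ _ id [seq (fun _ => v) | v <- us] (@measurable_id _ _ _) (all_meas_cst _ _).
  by under eq_set do rewrite map_cst.
apply: ge0_le_integral => //.
- by move=> u _; apply: IT_ge0 => s; exact: ind_ge0.
- apply: (@measurable_IT_cons _ _ n (fun s => ind R (~ genpos s))) => [|s].
    exact: jmeas_not_genpos.
  exact: ind_ge0.
- apply: (@measurable_IT _ _ _ _ n (fun u us => ind R (~ genpos us) + ind R (Q u us))%E).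
    move=> dS S phi g mphi mg; apply: emeasurable_funD.
      by apply: (@jmeas_not_genpos _ _ (fun=> tt)).
    exact: (jQ _ _ phi g).
  by move=> u s; rewrite adde_ge0// ind_ge0.
move=> u _; apply: IT_le.
- exact: jmeas_cons1 jmeas_not_genpos.
- by move=> s; exact: ind_ge0.
- move=> dS S phi g mphi mg; apply: emeasurable_funD.
    exact: (jmeas_not_genpos mphi).
  exact: (j1 u _ _ phi g).
move=> us; have [Qu|nQ] := pselect (Q u us).
  by rewrite (ind_true R Qu); apply: le_trans (ind_le1 _ _) _; rewrite leeDr// ind_ge0.
rewrite (ind_false R nQ) adde0; apply: ind_le; apply: contra_not => gp.
by apply: genpos_cons => // m rm p0; apply: nQ; exists m.
Qed.

Lemma IT_genpos n (f : seq vec -> \bar R) : jmeas (fun _ : unit => f) ->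
  (forall s, 0 <= f s)%E -> IT n (fun s => ind R (genpos s) * f s)%E = IT n f.
Proof.
move=> jf f0; rewrite -[LHS]adde0.
rewrite -(IT_null jmeas_not_genpos jf f0 (IT_not_genpos n)) -ITD; last 4 first.
- move=> dS S phi g mphi mg.
  by apply: emeasurable_funM; [exact: (jmeas_genpos mphi)|exact: (jf _ _ _ _ mphi)].
- by move=> s; rewrite mule_ge0// ind_ge0.
- move=> dS S phi g mphi mg.
  by apply: emeasurable_funM; [exact: (jmeas_not_genpos mphi)|exact: (jf _ _ _ _ mphi)].
- by move=> s; rewrite mule_ge0// ind_ge0.
by apply: eq_IT => s _; rewrite -ge0_muleDl ?ind_ge0// ind_not mul1e.
Qed.

(** Row [i] occupies the positions [i * d + j] of the flat list of normal variables, so the first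
    [d] of them integrate the first row. *)
Lemma gauss_exp_rows n (f : seq vec -> \bar R) : jmeas (fun _ : unit => f) ->
  (forall s, 0 <= f s)%E ->
  @gauss_exp R n d (fun G => f [seq row i G | i <- enum 'I_n]) = IT n f.
Proof.
move=> jf f0; pose rows m s := mkseq (fun i => (\row_(j < d) s`_(i * d + j) : vec)) m.
transitivity (gauss_iter (n * d) (fun s => f (rows n s))).
  apply: eq_gauss_iter => s _; congr f; rewrite /rows /mkseq -val_enum_ord -map_comp.
  by apply: eq_map => i; apply/rowP => j; rewrite !mxE.
elim: n f jf f0 => [|n IH] f jf f0 //.
rewrite [LHS](gauss_iter_cat d (n * d)) /=.
rewrite -gauss_iterE; last 2 first.
- exact: measurable_IT_cons.
- by move=> u; exact: IT_ge0.
apply: eq_gauss_iter => s sd; rewrite -IH//; last exact: jmeas_cons1.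
apply: eq_gauss_iter => t _; congr f; rewrite /rows /mkseq /=; congr (_ :: _).
  by apply/rowP => j; rewrite !mxE mul0n add0n nth_cat sd ltn_ord.
rewrite (iotaDl 1 0) -map_comp; apply: eq_map => i; apply/rowP => j.
by rewrite !mxE /= add1n mulSn -addnA nth_cat sd ltnNge leq_addr addKn.
Qed.

End general_position_ae.

(** * The expectation formula *)

Lemma polyhedral_cone_list (R : realType) d (C : set 'rV[R]_d) :
  polyhedral_cone C -> exists a, C = cone a.
Proof.
move=> [m [a ->]]; exists [seq a i | i <- enum 'I_m]; apply/seteqP; split=> x /= H.
  by apply/coneP => _ /mapP[i _ ->].
by move=> i; move/coneP: H; apply; rewrite map_f ?mem_enum.
Qed.

Theorem theorem1p2 (R : realType) (d : nat) (C A : set 'rV[R]_d) (n k : nat) :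
  (2 <= d)%N -> polyhedral_cone C -> conic A -> borel_set A ->
  (1 <= n)%N -> (1 <= k <= d)%N ->
  schlafli_exp n (fun S => curv (C `&` S) k A) =
  ((((C_nd n d)%:R : R)^-1)%:E *
    \sum_(s < (minn n (d - k)).+1) ('C(n, s))%:R%:E * curv C (k + s) A)%E.
Proof.
move=> _ /polyhedral_cone_list[a ->] cA /measurable_borel mA n0 /andP[k0 kd].
pose c : \bar R := ((C_nd n d)%:R^-1)%:E.
have c0 : (0 <= c)%E by rewrite lee_fin invr_ge0.
pose f (us : seq 'rV[R]_d) := (c * cell_sum us a k A)%E.
have f0 us : (0 <= f us)%E by rewrite mule_ge0// cell_sum_ge0.
have jf : jmeas (fun _ : unit => f).
  move=> dS S phi g mphi mg; apply: measurable_funeM.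
  exact: (jmeas_cell_sum a k mA mphi).
transitivity (@gauss_exp R n d (fun G =>
    let us := [seq row i G | i <- enum 'I_n] in ind R (genpos us) * f us)%E).
  congr gauss_exp; apply/funext => G /=.
  have := schlafli_mean a (fun i => row i G) mA k0 n0; rewrite /unitv /= => ->.
  by case: asboolP => gp; rewrite ?(ind_true R gp) ?(ind_false R gp) ?mul1e ?mul0e.
rewrite (@gauss_exp_rows _ _ _ (fun us => ind R (genpos us) * f us)%E); last 2 first.
- move=> dS S phi g mphi mg; apply: emeasurable_funM.
    exact: (jmeas_genpos mphi).
  exact: (jf _ _ _ _ mphi).
- by move=> us; rewrite mule_ge0// ind_ge0.
rewrite IT_genpos// ITZl//; last 2 first.
- exact: jmeas_cell_sum.
- by move=> us; exact: cell_sum_ge0.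
rewrite IT_cell_sum//; congr (_ * _)%E.
(* The terms with [k + s > d] vanish by [Psi_gt], so the sum over [s <= n] agrees with the one cut
   at [d - k]. *)
rewrite (big_ord_widen n.+1 (fun s => ('C(n, s))%:R%:E * curv (cone a) (k + s) A)%E).
  rewrite [RHS]big_mkcond; apply: eq_bigr => s _; case: ifPn => [_|].
    by rewrite curv_cone.
  by rewrite ltnS leq_min -ltnS ltn_ord /= -ltnNge => ds; rewrite Psi_gt ?mule0//; lia.
by rewrite ltnS geq_minl.
Qed.
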